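(* For diagrams $d\colon X\to A$ in a quasi-category $A$, the notion of limit and limit cone defined by absolute right lifting diagrams in $\mathrm{qCat}_2$ is equivalent to the notion of limit and limit cone introduced by Joyal, in which a limit cone is a terminal vertex of the slice quasi-category $A_{/d}$.
   Context: A quasi-category is a simplicial set with fillers for all inner horns; functors are simplicial maps between quasi-categories. $\mathrm{qCat}_2$ is the strict 2-category of quasi-categories with hom-categories $\hom'(A,B)=h(B^A)$, where $B^A$ is the internal hom and $h\colon\mathrm{sSet}\to\mathrm{Cat}$ is left adjoint to the nerve. $X$ is a simplicial set, and a diagram of shape $X$ in $A$ is a simplicial map $d\colon X\to A$, identified with the corresponding vertex $d\colon\Delta^0\to A^X$. $c\colon A\to A^X$ is the constant diagram functor, the transpose of the projection $A\times X\to A$. Limit defined by absolute right lifting: a 2-cell $\lambda\colon c\ell\Rightarrow d$ in $\mathrm{qCat}_2$ displays the vertex $\ell\colon\Delta^0\to A$ as the limit of $d$, with limit cone $\lambda$, if it displays $\ell$ as an absolute right lifting of $d$ through $c$; that is, if for every $Y$, every functor $b\colon Y\to A$ and every 2-cell $\chi\colon cb\Rightarrow d!$ (with $!\colon Y\to\Delta^0$ the unique map) there is a unique 2-cell $\zeta\colon b\Rightarrow\ell!$ with $\chi=\lambda!\cdot c\zeta$. Joyal's limit: for simplicial sets $Y,X$, each regarded as having exactly one $(-1)$-simplex, the join $Y\star X$ has as $n$-simplices the pairs $(y,x)\in Y_r\times X_s$ with $r,s\ge-1$ and $r+s+1=n$. The slice $A_{/d}$ is the quasi-category whose $n$-simplices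 are the maps $\Delta^n\star X\to A$ restricting to $d$ on $X$, and $\pi\colon A_{/d}\to A$ is the projection restricting such a map to $\Delta^n$. In Joyal's sense a limit cone for $d$ is a terminal vertex $t$ of $A_{/d}$, and it displays $\pi t$ as a limit of $d$. Here a vertex $t$ of a quasi-category $Q$ is terminal if every map $\partial\Delta^n\to Q$ with $n\ge1$ whose last vertex is $t$ extends to $\Delta^n$. *)

(* Defs.v *)
From HB Require Import structures.
From mathcomp Require Import all_boot boolp.

Set Implicit Arguments.
Unset Strict Implicit.
Unset Printing Implicit Defensive.

Local Open Scope quotient_scope.

(* Finite ordinals are indexed by their cardinality: [op p q] is the set of
   order-preserving maps [p-1] -> [q-1], the case p = 0 being the empty
   ordinal [-1]. *)
Definition monotone p q (f : {ffun 'I_p -> 'I_q}) : bool :=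
  [forall i : 'I_p, forall j : 'I_p, (i <= j) ==> (f i <= f j)].

Record op p q := Op { op_fun :> {ffun 'I_p -> 'I_q}; _ : monotone op_fun }.
HB.instance Definition _ p q := [isSub for @op_fun p q].

Lemma op_le p q (a : op p q) (i j : 'I_p) : i <= j -> a i <= a j.
Proof. by case: a => f /= /forallP/(_ i)/forallP/(_ j)/implyP. Qed.

Lemma op_ext p q (a b : op p q) : (forall i, a i = b i :> nat) -> a = b.
Proof. by move=> ab; apply/val_inj/ffunP => i; apply/val_inj/ab. Qed.

Lemma mk_op_mono p q (f : 'I_p -> 'I_q) :
  {homo f : i j / i <= j} -> monotone [ffun i => f i].
Proof.
by move=> fP; do 2!apply/forallP => ?; apply/implyP => ?; rewrite !ffunE fP.
Qed.

Definition mk_op p q (f : 'I_p -> 'I_q) (fP : {homo f : i j / i <= j}) :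
  op p q := Op (mk_op_mono fP).

Lemma mk_opE p q (f : 'I_p -> 'I_q) (fP : {homo f : i j / i <= j}) i :
  mk_op fP i = f i.
Proof. exact: ffunE. Qed.

Lemma op_id_subproof p : {homo (fun i : 'I_p => i) : i j / i <= j}.
Proof. by []. Qed.
Definition op_id p : op p p := mk_op (@op_id_subproof p).

Lemma op_comp_subproof p q r (a : op q r) (b : op p q) :
  {homo (fun i => a (b i)) : i j / i <= j}.
Proof. by move=> i j ij; do 2!apply: op_le. Qed.
Definition op_comp p q r (a : op q r) (b : op p q) : op p r :=
  mk_op (op_comp_subproof a b).

Lemma op_idE p i : op_id p i = i. Proof. exact: mk_opE. Qed.
Lemma op_compE p q r (a : op q r) (b : op p q) i : op_comp a b i = a (b i).
Proof. exact: mk_opE. Qed.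

Lemma op_comp1 p q (a : op p q) : op_comp a (op_id p) = a.
Proof. by apply: op_ext => i; rewrite op_compE op_idE. Qed.
Lemma op_1comp p q (a : op p q) : op_comp (op_id q) a = a.
Proof. by apply: op_ext => i; rewrite op_compE op_idE. Qed.
Lemma op_compA p q r s (a : op r s) (b : op q r) (c : op p q) :
  op_comp a (op_comp b c) = op_comp (op_comp a b) c.
Proof. by apply: op_ext => i; rewrite !op_compE. Qed.

Lemma op_cast_subproof p q (e : p = q) :
  {homo (fun i : 'I_p => cast_ord e i) : i j / i <= j}.
Proof. by []. Qed.
Definition op_cast p q (e : p = q) : op p q := mk_op (op_cast_subproof e).
Lemma op_castE p q (e : p = q) i : op_cast e i = i :> nat.
Proof. by rewrite mk_opE. Qed.

Lemma coface_subproof n (i : 'I_n.+1) :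
  {homo (fun j : 'I_n => lift i j) : j k / j <= k}.
Proof. by move=> j k jk; rewrite /= leq_bump2. Qed.
Definition coface n (i : 'I_n.+1) : op n n.+1 :=
  mk_op (coface_subproof i).

Lemma const_subproof p q (i : 'I_q) : {homo (fun _ : 'I_p => i) : j k / j <= k}.
Proof. by []. Qed.
Definition op_const p q (i : 'I_q) : op p q := mk_op (@const_subproof p q i).

Record sset := SSet {
  sob :> nat -> Type;
  sact : forall m n, op m.+1 n.+1 -> sob n -> sob m;
  sact_id : forall n (x : sob n), sact (op_id n.+1) x = x;
  sact_comp : forall m n p (a : op n.+1 p.+1) (b : op m.+1 n.+1) (x : sob p),
    sact (op_comp a b) x = sact b (sact a x) }.
Arguments sact {s m n} a x.

Record smap (X Y : sset) := SMap {
  smap_fun :> forall n, X n -> Y n;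
  smap_nat : forall m n (a : op m.+1 n.+1) (x : X n),
    smap_fun (sact a x) = sact a (smap_fun x) }.
Arguments smap_fun {X Y} s n x.

Lemma smap_ext (X Y : sset) (f g : smap X Y) :
  (forall n (x : X n), f n x = g n x) -> f = g.
Proof.
case: f g => [f fP] [g gP] /= fg.
have e : f = g by apply: functional_extensionality_dep => n; apply/funext/fg.
by case: _ / e gP => gP; congr SMap; apply: Prop_irrelevance.
Qed.

Definition sid (X : sset) : smap X X :=
  @SMap X X (fun _ x => x) (fun _ _ _ _ => erefl).

Lemma scomp_subproof (X Y Z : sset) (g : smap Y Z) (f : smap X Y)
    m n (a : op m.+1 n.+1) (x : X n) :
  g m (f m (sact a x)) = sact a (g n (f n x)).
Proof. by rewrite !smap_nat. Qed.
Definition scomp (X Y Z : sset) (g : smap Y Z) (f : smap X Y) : smap X Z :=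
  SMap (scomp_subproof g f).

Lemma scompA (W X Y Z : sset) (h : smap Y Z) (g : smap X Y) (f : smap W X) :
  scomp h (scomp g f) = scomp (scomp h g) f.
Proof. exact: smap_ext. Qed.

Definition simplex (n : nat) : sset :=
  @SSet (fun m => op m.+1 n.+1) (fun _ _ a b => op_comp b a)
    (fun _ b => op_comp1 b) (fun _ _ _ a b c => op_compA c a b).

Lemma yoneda_subproof (X : sset) n (x : X n)
    l m (a : op l.+1 m.+1) (b : simplex n m) :
  sact (sact a b) x = sact a (sact b x).
Proof. exact: sact_comp. Qed.
Definition yoneda (X : sset) n (x : X n) : smap (simplex n) X :=
  SMap (yoneda_subproof x).

Definition simplex_map m n (a : op m.+1 n.+1) : smap (simplex m) (simplex n) :=
  @yoneda (simplex n) m a.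

Lemma bang_subproof (X : sset) m n (a : op m.+1 n.+1) (x : X n) :
  op_const m.+1 (ord0 : 'I_1) = sact a (op_const n.+1 ord0 : simplex 0 n).
Proof. by apply: op_ext => i; rewrite !ord1. Qed.
Definition bang (X : sset) : smap X (simplex 0) :=
  @SMap X (simplex 0) _ (@bang_subproof X).

Lemma sprod_id (X Y : sset) n (x : X n * Y n) :
  (sact (op_id n.+1) x.1, sact (op_id n.+1) x.2) = x.
Proof. by rewrite !sact_id; case: x. Qed.
Lemma sprod_comp (X Y : sset) m n p (a : op n.+1 p.+1) (b : op m.+1 n.+1)
    (x : X p * Y p) :
  (sact (op_comp a b) x.1, sact (op_comp a b) x.2)
  = (sact b (sact a x.1), sact b (sact a x.2)).
Proof. by rewrite !sact_comp. Qed.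
Definition sprod (X Y : sset) : sset :=
  @SSet (fun n => X n * Y n)%type (fun _ _ a x => (sact a x.1, sact a x.2))
    (@sprod_id X Y) (@sprod_comp X Y).

Definition spr1 (X Y : sset) : smap (sprod X Y) X :=
  @SMap (sprod X Y) X (fun _ x => x.1) (fun _ _ _ _ => erefl).
Definition spr2 (X Y : sset) : smap (sprod X Y) Y :=
  @SMap (sprod X Y) Y (fun _ x => x.2) (fun _ _ _ _ => erefl).

Lemma sprod_map_subproof (X X' Y Y' : sset) (f : smap X X') (g : smap Y Y')
    m n (a : op m.+1 n.+1) (x : sprod X Y n) :
  (f m (sact a x).1, g m (sact a x).2)
  = sact a ((f n x.1, g n x.2) : sprod X' Y' n).
Proof. by rewrite /= !smap_nat. Qed.
Definition sprod_map (X X' Y Y' : sset) (f : smap X X') (g : smap Y Y') :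
  smap (sprod X Y) (sprod X' Y') :=
  @SMap (sprod X Y) (sprod X' Y') (fun n x => (f n x.1, g n x.2))
    (sprod_map_subproof f g).

Lemma sexp_id (B A : sset) n (u : smap (sprod (simplex n) A) B) :
  scomp u (sprod_map (simplex_map (op_id n.+1)) (sid A)) = u.
Proof. by apply: smap_ext => m [b x]; rewrite /= op_1comp. Qed.
Lemma sexp_comp (B A : sset) m n p (a : op n.+1 p.+1) (b : op m.+1 n.+1)
    (u : smap (sprod (simplex p) A) B) :
  scomp u (sprod_map (simplex_map (op_comp a b)) (sid A))
  = scomp (scomp u (sprod_map (simplex_map a) (sid A)))
          (sprod_map (simplex_map b) (sid A)).
Proof. by apply: smap_ext => l [c x]; rewrite /= op_compA. Qed.
(* [sexp B A] is B^A. *)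
Definition sexp (B A : sset) : sset :=
  @SSet (fun n => smap (sprod (simplex n) A) B)
    (fun _ _ a u => scomp u (sprod_map (simplex_map a) (sid A)))
    (@sexp_id B A) (@sexp_comp B A).

Lemma curry_elt_subproof (Z X A : sset) (g : smap (sprod Z X) A) n (z : Z n)
    l m (a : op l.+1 m.+1) (x : sprod (simplex n) X m) :
  g l (sact (sact a x).1 z, (sact a x).2) = sact a (g m (sact x.1 z, x.2)).
Proof. by rewrite -smap_nat /= sact_comp. Qed.
Definition curry_elt (Z X A : sset) (g : smap (sprod Z X) A) n (z : Z n) :
  sexp A X n :=
  @SMap (sprod (simplex n) X) A (fun m x => g m (sact x.1 z, x.2))
    (curry_elt_subproof g z).
Lemma curry_subproof (Z X A : sset) (g : smap (sprod Z X) A)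
    m n (a : op m.+1 n.+1) (z : Z n) :
  curry_elt g (sact a z) = sact a (curry_elt g z).
Proof. by apply: smap_ext => l [c x]; rewrite /= sact_comp. Qed.
Definition curry (Z X A : sset) (g : smap (sprod Z X) A) : smap Z (sexp A X) :=
  @SMap Z (sexp A X) (fun n z => curry_elt g z) (curry_subproof g).

Lemma exp_post_subproof (Y B C : sset) (k : smap B C)
    m n (a : op m.+1 n.+1) (u : sexp B Y n) :
  scomp k (sact a u) = sact a (scomp k u : sexp C Y n).
Proof. exact: smap_ext. Qed.
Definition exp_post (Y B C : sset) (k : smap B C) : smap (sexp B Y) (sexp C Y) :=
  @SMap (sexp B Y) (sexp C Y) (fun n v => scomp k v)
    (@exp_post_subproof Y B C k).

Lemma exp_pre_subproof (Z Y B : sset) (u : smap Z Y)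
    m n (a : op m.+1 n.+1) (v : sexp B Y n) :
  scomp (sact a v) (sprod_map (sid _) u)
  = sact a (scomp v (sprod_map (sid _) u) : sexp B Z n).
Proof. exact: smap_ext. Qed.
Definition exp_pre (Z Y B : sset) (u : smap Z Y) : smap (sexp B Y) (sexp B Z) :=
  @SMap (sexp B Y) (sexp B Z) (fun n v => scomp v (sprod_map (sid _) u))
    (@exp_pre_subproof Z Y B u).

Section Subcomplex.
Variables (n : nat) (P : forall m, pred (op m.+1 n.+1)).
Hypothesis Pact : forall l m (a : op l.+1 m.+1) (b : op m.+1 n.+1),
  P b -> P (op_comp b a).

Definition subcomplex_act l m (a : op l.+1 m.+1) (b : {b | @P m b}) :
  {b | @P l b} := exist _ (op_comp (val b) a) (Pact a (valP b)).
Lemma subcomplex_id m (b : {b | @P m b}) : subcomplex_act (op_id m.+1) b = b.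
Proof. by apply/val_inj/op_comp1. Qed.
Lemma subcomplex_comp k l m (a : op l.+1 m.+1) (c : op k.+1 l.+1)
    (b : {b | @P m b}) :
  subcomplex_act (op_comp a c) b = subcomplex_act c (subcomplex_act a b).
Proof. by apply/val_inj/op_compA. Qed.
Definition subcomplex : sset :=
  @SSet (fun m => {b | @P m b}) subcomplex_act subcomplex_id subcomplex_comp.
End Subcomplex.

(* [misses a j]: the simplex [a] of the standard simplex lies in the face
   opposite the vertex [j]. *)
Definition misses p q (a : op p q) (j : 'I_q) : bool := [forall i, a i != j].

Lemma misses_comp p q r (a : op q r) (b : op p q) j :
  misses a j -> misses (op_comp a b) j.
Proof. by move=> /forallP aj; apply/forallP => i; rewrite op_compE. Qed.

Definition in_horn n (k : 'I_n.+1) m (a : op m.+1 n.+1) : bool :=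
  [exists j, (j != k) && misses a j].
Lemma in_horn_act n (k : 'I_n.+1) l m (a : op l.+1 m.+1) (b : op m.+1 n.+1) :
  in_horn k b -> in_horn k (op_comp b a).
Proof.
move=> /existsP[j /andP[jk bj]]; apply/existsP; exists j.
by rewrite jk misses_comp.
Qed.
Definition horn n (k : 'I_n.+1) : sset := subcomplex (@in_horn_act n k).

Definition in_boundary n m (a : op m.+1 n.+1) : bool := [exists j, misses a j].
Lemma in_boundary_act n l m (a : op l.+1 m.+1) (b : op m.+1 n.+1) :
  in_boundary b -> in_boundary (op_comp b a).
Proof.
by move=> /existsP[j bj]; apply/existsP; exists j; apply: misses_comp.
Qed.
Definition boundary n : sset := subcomplex (@in_boundary_act n).

Definition quasi_category (A : sset) : Prop :=
  forall n (k : 'I_n.+1), 0 < k < n -> forall f : smap (horn k) A,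
  exists g : smap (simplex n) A, forall m (x : horn k m), g m (val x) = f m x.

Lemma last_vertex_subproof n : in_boundary (op_const 1 (@ord_max n.+1)).
Proof. by apply/existsP; exists ord0; apply/forallP => i; rewrite mk_opE. Qed.
Definition last_vertex n : boundary n.+1 0 :=
  exist _ (op_const 1 ord_max) (last_vertex_subproof n).

Definition terminal (Q : sset) (t : Q 0) : Prop :=
  forall n (f : smap (boundary n.+1) Q), f 0 (last_vertex n) = t ->
  exists g : smap (simplex n.+1) Q,
    forall m (x : boundary n.+1 m), g m (val x) = f m x.

(* The augmentation of X with a single (-1)-simplex, indexed by number of
   vertices: [aug X 0] is X_{-1} and [aug X r.+1] is X_r. *)
Definition aug (X : sset) (p : nat) : Type := if p is r.+1 then X r else unit.

Lemma op_absurd p : op p.+1 0 -> False.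
Proof. by move=> a; case: (a ord0). Qed.

Definition aug_act (X : sset) p q : op p q -> aug X q -> aug X p :=
  match p, q return op p q -> aug X q -> aug X p with
  | 0, _ => fun _ _ => tt
  | p.+1, 0 => fun a _ => False_rect _ (op_absurd a)
  | p.+1, q.+1 => fun a x => sact a x
  end.

Lemma aug_act_id (X : sset) p (x : aug X p) : aug_act (op_id p) x = x.
Proof. by case: p x => [[]|p x] //; apply: sact_id. Qed.
Lemma aug_act_comp (X : sset) p q r (a : op q r) (b : op p q) (x : aug X r) :
  aug_act (op_comp a b) x = aug_act b (aug_act a x).
Proof.
case: p b => [|p] // b; case: q a b => [|q] a b; first by case: (op_absurd b).
by case: r a x => [|r] a x; [case: (op_absurd a) | apply: sact_comp].
Qed.

Definition aug_map (X Y : sset) (f : smap X Y) p : aug X p -> aug Y p :=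
  if p is r.+1 return aug X p -> aug Y p then fun x => f r x else id.
Lemma aug_map_nat (X Y : sset) (f : smap X Y) p q (a : op p q) (x : aug X q) :
  aug_map f (aug_act a x) = aug_act a (aug_map f x).
Proof.
case: p a => [|p] //; case: q x => [|q] x a; first by case: (op_absurd a).
exact: smap_nat.
Qed.

(* A map a from [m] to the ordinal sum [n] of [r] and [s] is cut into the
   restriction of a to the initial segment mapped into [r], with [cutl a l]
   elements where l = r + 1, and the restriction to its complement, mapped into [s]. *)
Definition cutl p q (a : op p q) (l : nat) : nat := #|[pred i | a i < l]|.

Lemma cutl_lt p q (a : op p q) l (i : 'I_p) : (i < cutl a l) = (a i < l).
Proof.
rewrite /cutl; set D := [pred i | _].
have down (j k : 'I_p) : j <= k -> k \in D -> j \in D.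
  by rewrite !inE => jk; apply/leq_ltn_trans/op_le.
have cardlt k : k <= p -> #|[pred j : 'I_p | j < k]| = k.
  move=> kp; rewrite -sum1_card (big_ord_narrow kp) sum1_card card_ord //.
have -> : (a i < l) = (i \in D) by rewrite inE.
have [iD|iND] := boolP (i \in D).
  rewrite -[X in X < _]/(i : nat) -ltnS -[i.+1](cardlt _ (ltn_ord i)) ltnS.
  by apply/subset_leq_card/subsetP => j; rewrite inE ltnS => /down/(_ iD).
apply/negbTE; rewrite -leqNgt -[X in _ <= X](cardlt _ (ltnW (ltn_ord i))).
apply/subset_leq_card/subsetP => j jD; rewrite inE ltnNge.
by apply: contra iND => /down; apply.
Qed.

Lemma cutl_le p q (a : op p q) l : cutl a l <= p.
Proof. by rewrite -[X in _ <= X]card_ord max_card. Qed.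

Section Cut.
Variables (p q : nat) (a : op p q) (l r : nat) (lr : l + r = q).

Lemma resl_lt (i : 'I_(cutl a l)) : a (widen_ord (cutl_le a l) i) < l.
Proof. rewrite -cutl_lt; exact: (ltn_ord i). Qed.
Lemma resl_homo : {homo (fun i => Ordinal (resl_lt i)) : i j / i <= j}.
Proof. by move=> i j ij; apply: op_le. Qed.
Definition resl : op (cutl a l) l := mk_op resl_homo.

Lemma shiftr_lt (i : 'I_(p - cutl a l)) : cutl a l + i < p.
Proof. by rewrite -ltn_subRL. Qed.
Definition shiftr (i : 'I_(p - cutl a l)) : 'I_p := Ordinal (shiftr_lt i).
Lemma shiftr_ge (i : 'I_(p - cutl a l)) : l <= a (shiftr i).
Proof. by rewrite leqNgt -cutl_lt -leqNgt leq_addr. Qed.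
Lemma resr_lt (i : 'I_(p - cutl a l)) : a (shiftr i) - l < r.
Proof. by rewrite ltn_subLR ?shiftr_ge // lr. Qed.
Lemma resr_homo : {homo (fun i => Ordinal (resr_lt i)) : i j / i <= j}.
Proof. by move=> i j ij; apply/leq_sub2r/op_le; rewrite /= leq_add2l. Qed.
Definition resr : op (p - cutl a l) r := mk_op resr_homo.
End Cut.

(* An n-simplex of the join of Y and X: a pair (y, x) in Y_r x X_s with
   r, s >= -1 and r + s + 1 = n, where y has [jl] = r + 1 vertices
   and x has [jr] = s + 1 vertices. *)
Record join_ob (Y X : sset) (n : nat) := JoinOb {
  jl : nat;
  jr : nat;
  jlr : jl + jr = n.+1;
  jy : aug Y jl;
  jx : aug X jr }.

Lemma join_ob_ext (Y X : sset) n l r l' r' (lr : l + r = n.+1)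
    (lr' : l' + r' = n.+1) (y : aug Y l) (y' : aug Y l') (x : aug X r)
    (x' : aug X r') (el : l = l') (er : r = r') :
  y = aug_act (op_cast el) y' -> x = aug_act (op_cast er) x' ->
  JoinOb lr y x = JoinOb lr' y' x'.
Proof.
move=> -> ->; subst l' r'.
have E p : op_cast (erefl p) = op_id p.
  by apply: op_ext => i; rewrite op_castE op_idE.
by rewrite !E !aug_act_id (Prop_irrelevance lr lr').
Qed.
Arguments join_ob_ext {Y X n l r l' r' lr lr' y y' x x'} el er _ _.

Lemma join_act_subproof p q (a : op p q) l : cutl a l + (p - cutl a l) = p.
Proof. by rewrite subnKC ?cutl_le. Qed.

Definition join_act (Y X : sset) m n (a : op m.+1 n.+1) (u : join_ob Y X n) :
  join_ob Y X m :=
  JoinOb (join_act_subproof a (jl u))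
    (aug_act (resl a (jl u)) (jy u)) (aug_act (resr a (jlr u)) (jx u)).

Lemma cutl_uniq p q (a : op p q) l k :
  k <= p -> (forall i : 'I_p, (i < k) = (a i < l)) -> cutl a l = k.
Proof.
move=> kp ak; have ck := cutl_le a l.
have lt i (ip : i < p) : (i < cutl a l) = (i < k).
  by have := cutl_lt a l (Ordinal ip); rewrite -ak.
apply/eqP; rewrite eqn_leq; apply/andP; split; rewrite leqNgt; apply/negP => h.
- by have := lt k (leq_trans h ck); rewrite h ltnn.
- by have := lt _ (leq_trans h kp); rewrite h ltnn.
Qed.

Lemma cutl_id p l : l <= p -> cutl (op_id p) l = l.
Proof. by move=> lp; apply: cutl_uniq => // i; rewrite op_idE. Qed.
Lemma cutl_comp p q r (a : op q r) (b : op p q) l :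
  cutl (op_comp a b) l = cutl b (cutl a l).
Proof.
apply: cutl_uniq => [|i]; first exact: cutl_le.
by rewrite op_compE !cutl_lt.
Qed.
Lemma cutl0 p q (a : op p q) : cutl a 0 = 0.
Proof. exact: cutl_uniq. Qed.
Lemma cutl_max p q (a : op p q) : cutl a q = p.
Proof. by apply: cutl_uniq => // i; rewrite !ltn_ord. Qed.

Lemma reslE p q (a : op p q) l i : resl a l i = a (widen_ord (cutl_le a l) i) :> nat.
Proof. by rewrite mk_opE. Qed.
Lemma resrE p q (a : op p q) l r (lr : l + r = q) i :
  resr a lr i = a (shiftr i) - l :> nat.
Proof. by rewrite mk_opE. Qed.

Lemma join_id (Y X : sset) n (u : join_ob Y X n) :
  join_act (op_id n.+1) u = u.
Proof.
case: u => l r lr y x; rewrite /join_act /=.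
have ln : l <= n.+1 by rewrite -lr leq_addr.
have rn : n.+1 - l = r by rewrite -lr addKn.
apply: (join_ob_ext (cutl_id ln)
  (etrans (congr1 (subn n.+1) (cutl_id ln)) rn)).
- by congr aug_act; apply: op_ext => i; rewrite reslE op_castE op_idE.
- congr aug_act; apply: op_ext => i; rewrite resrE op_castE op_idE /=.
  by rewrite [X in X + _](cutl_id ln) addKn.
Qed.

Lemma join_comp (Y X : sset) m n p (a : op n.+1 p.+1) (b : op m.+1 n.+1)
    (u : join_ob Y X p) :
  join_act (op_comp a b) u = join_act b (join_act a u).
Proof.
case: u => l r lr y x; rewrite /join_act /=.
have e := cutl_comp a b l.
apply: (join_ob_ext e (congr1 (subn m.+1) e)).
- rewrite -!aug_act_comp; congr aug_act; apply: op_ext => i.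
  rewrite !(op_compE, reslE); congr (nat_of_ord (a _)); apply/val_inj.
  rewrite /= reslE; congr (nat_of_ord (b _)); apply/val_inj => /=.
  by rewrite op_castE.
- rewrite -!aug_act_comp; congr aug_act; apply: op_ext => i.
  rewrite !(op_compE, resrE); congr (nat_of_ord (a _) - _); apply/val_inj.
  rewrite /= resrE subnKC ?shiftr_ge //; congr (nat_of_ord (b _)).
  by apply/val_inj; rewrite /= op_castE [X in X + _]e.
Qed.

Definition join (Y X : sset) : sset :=
  @SSet (join_ob Y X) (@join_act Y X) (@join_id Y X) (@join_comp Y X).

Lemma join_inl_subproof (Y X : sset) m n (a : op m.+1 n.+1) (y : Y n) :
  @JoinOb Y X m m.+1 0 (addn0 _) (sact a y) tt
  = join_act a (@JoinOb Y X n n.+1 0 (addn0 _) y tt).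
Proof.
have e : m.+1 = cutl a n.+1 by rewrite cutl_max.
have e0 : 0 = m.+1 - cutl a n.+1 by rewrite -e subnn.
apply: (join_ob_ext e e0) => //.
rewrite -aug_act_comp /=; congr (sact _ y); apply: op_ext => i.
  rewrite op_compE reslE; congr (nat_of_ord (a _)); apply/val_inj => /=.
  by rewrite op_castE.
Qed.
Definition join_inl (Y X : sset) : smap Y (join Y X) :=
  @SMap Y (join Y X) (fun n y => @JoinOb Y X n n.+1 0 (addn0 _) y tt)
    (@join_inl_subproof Y X).

Lemma join_inr_subproof (Y X : sset) m n (a : op m.+1 n.+1) (x : X n) :
  @JoinOb Y X m 0 m.+1 erefl tt (sact a x)
  = join_act a (@JoinOb Y X n 0 n.+1 erefl tt x).
Proof.
have e : 0 = cutl a 0 by rewrite cutl0.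
have e1 : m.+1 = m.+1 - cutl a 0 by rewrite -e subn0.
apply: (join_ob_ext e e1) => //.
rewrite -[RHS](aug_act_comp (X := X)) /=; congr (sact _ x).
  apply: op_ext => i; rewrite op_compE resrE subn0.
  by congr (nat_of_ord (a _)); apply/val_inj; rewrite /= op_castE -e.
Qed.
Definition join_inr (Y X : sset) : smap X (join Y X) :=
  @SMap X (join Y X) (fun n x => @JoinOb Y X n 0 n.+1 erefl tt x)
    (@join_inr_subproof Y X).

Lemma join_mapl_subproof (Y Y' X : sset) (f : smap Y Y')
    m n (a : op m.+1 n.+1) (u : join Y X n) :
  JoinOb (jlr (sact a u)) (aug_map f (jy (sact a u))) (jx (sact a u))
  = sact a (JoinOb (jlr u) (aug_map f (jy u)) (jx u) : join Y' X n).
Proof. by rewrite /= /join_act /= aug_map_nat. Qed.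
Definition join_mapl (Y Y' X : sset) (f : smap Y Y') :
  smap (join Y X) (join Y' X) :=
  @SMap (join Y X) (join Y' X)
    (fun n u => JoinOb (jlr u) (aug_map f (jy u)) (jx u))
    (@join_mapl_subproof Y Y' X f).

Lemma join_mapl_inr (Y Y' X : sset) (f : smap Y Y') :
  scomp (join_mapl X f) (join_inr Y X) = join_inr Y' X.
Proof. exact: smap_ext. Qed.

Section Slice.
Variables (X A : sset) (d : smap X A).

Definition slice_ob (n : nat) : Type :=
  {f : smap (join (simplex n) X) A | scomp f (join_inr (simplex n) X) = d}.

Lemma slice_act_subproof m n (a : op m.+1 n.+1) (f : slice_ob n) :
  scomp (scomp (sval f) (join_mapl X (simplex_map a))) (join_inr _ X) = d.
Proof. by rewrite -scompA join_mapl_inr (svalP f). Qed.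
Definition slice_act m n (a : op m.+1 n.+1) (f : slice_ob n) : slice_ob m :=
  exist _ _ (slice_act_subproof a f).

Lemma slice_ext n (f g : slice_ob n) : sval f = sval g -> f = g.
Proof. by case: f g => [f ?] [g ?] /= e; apply: eq_exist. Qed.

Lemma slice_id n (f : slice_ob n) : slice_act (op_id n.+1) f = f.
Proof.
apply/slice_ext/smap_ext => m [[|l] r lr y x] //=.
by rewrite op_1comp.
Qed.
Lemma slice_comp m n p (a : op n.+1 p.+1) (b : op m.+1 n.+1) (f : slice_ob p) :
  slice_act (op_comp a b) f = slice_act b (slice_act a f).
Proof.
apply/slice_ext/smap_ext => k [[|l] r lr y x] //=.
by rewrite op_compA.
Qed.
Definition slice : sset := SSet slice_id slice_comp.

Lemma slice_pr_subproof m n (a : op m.+1 n.+1) (f : slice n) :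
  sval (sact a f) m (join_inl _ X m (op_id m.+1 : simplex m m))
  = sact a (sval f n (join_inl _ X n (op_id n.+1 : simplex n n))).
Proof. by rewrite -smap_nat -smap_nat /= op_1comp op_comp1. Qed.
Definition slice_pr : smap slice A :=
  @SMap slice A (fun n f => sval f n (join_inl _ X n (op_id n.+1 : simplex n n)))
    slice_pr_subproof.
End Slice.

(* The canonical collapse of Delta^1 x (Y x X) onto the join: an n-simplex
   (a, (y, x)), with a : [n] -> [1], is sent to the pair of the restriction of
   y to the fibre of a over 0 and of the restriction of x to the fibre over 1. *)

Section Fibres.
Variables (p q : nat) (a : op p q) (l : nat).
Lemma inl_op_subproof :
  {homo (fun i : 'I_(cutl a l) => widen_ord (cutl_le a l) i) : i j / i <= j}.
Proof. by []. Qed.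
Definition inl_op : op (cutl a l) p := mk_op inl_op_subproof.
Lemma inr_op_subproof :
  {homo (fun i : 'I_(p - cutl a l) => shiftr i) : i j / i <= j}.
Proof. by move=> i j ij; rewrite /= leq_add2l. Qed.
Definition inr_op : op (p - cutl a l) p := mk_op inr_op_subproof.
End Fibres.

Definition collapse_fun (Y X : sset) n
    (u : sprod (simplex 1) (sprod Y X) n) : join Y X n :=
  JoinOb (join_act_subproof u.1 1)
    (aug_act (inl_op u.1 1) (u.2.1 : aug Y n.+1))
    (aug_act (inr_op u.1 1) (u.2.2 : aug X n.+1)).

Lemma collapse_subproof (Y X : sset) m n (a : op m.+1 n.+1)
    (u : sprod (simplex 1) (sprod Y X) n) :
  collapse_fun (sact a u) = sact a (collapse_fun u).
Proof.
case: u => c [y x]; have e : cutl (op_comp c a) 1 = _ := cutl_comp c a 1.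
apply: (join_ob_ext e (congr1 (subn m.+1) e)).
- rewrite -[LHS](@aug_act_comp Y _ m.+1 n.+1) -!aug_act_comp; congr aug_act.
  apply: op_ext => i; rewrite !op_compE /= !ffunE /=.
  by congr (nat_of_ord (a _)); apply/val_inj.
- rewrite -[LHS](@aug_act_comp X _ m.+1 n.+1) -!aug_act_comp; congr aug_act.
  apply: op_ext => i; rewrite !op_compE /= !ffunE /= subnKC.
    by congr (nat_of_ord (a _)); apply/val_inj; rewrite /= [X in X + _]e.
  exact: shiftr_ge.
Qed.
Definition collapse (Y X : sset) :
  smap (sprod (simplex 1) (sprod Y X)) (join Y X) :=
  SMap (@collapse_subproof Y X).

Lemma cone_collapse_subproof (X : sset) m n (a : op m.+1 n.+1)
    (u : sprod (simplex 1) X n) :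
  collapse (simplex 0) X m ((sact a u).1, (bang X m (sact a u).2, (sact a u).2))
  = sact a (collapse (simplex 0) X n (u.1, (bang X n u.2, u.2))).
Proof. by rewrite -smap_nat (smap_nat (bang X)). Qed.
Definition cone_collapse (X : sset) :
  smap (sprod (simplex 1) X) (join (simplex 0) X) :=
  @SMap (sprod (simplex 1) X) (join (simplex 0) X)
    (fun n u => collapse (simplex 0) X n (u.1, (bang X n u.2, u.2)))
    (@cone_collapse_subproof X).

Record category := Category {
  cob :> Type;
  hom : cob -> cob -> Type;
  idm : forall x, hom x x;
  mcomp : forall x y z, hom y z -> hom x y -> hom x z;
  mcomp1 : forall x y (f : hom x y), mcomp f (idm x) = f;
  m1comp : forall x y (f : hom x y), mcomp (idm y) f = f;
  mcompA : forall w x y z (h : hom y z) (g : hom x y) (f : hom w x),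
    mcomp h (mcomp g f) = mcomp (mcomp h g) f }.
Arguments idm {c} x.
Arguments mcomp {c x y z} g f.

Definition hom_cast (C : category) (x x' y y' : C) (ex : x = x') (ey : y = y') :
  hom x y -> hom x' y' :=
  match ex, ey with erefl, erefl => id end.

Lemma hom_cast_id (C : category) (x y : C) (ex : x = x) (ey : y = y)
  (f : hom x y) : hom_cast ex ey f = f.
Proof.
by rewrite (Prop_irrelevance ex erefl) (Prop_irrelevance ey erefl).
Qed.
Lemma hom_cast_trans (C : category) (x x' x'' y y' y'' : C)
    (ex : x = x') (ey : y = y') (ex' : x' = x'') (ey' : y' = y'') (f : hom x y) :
  hom_cast ex' ey' (hom_cast ex ey f)
  = hom_cast (etrans ex ex') (etrans ey ey') f.
Proof. by case: _ / ex'; case: _ / ey'. Qed.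
Lemma hom_cast_comp (C : category) (x x' y y' z z' : C)
    (ex : x = x') (ey ey' : y = y') (ez : z = z') (g : hom y z) (f : hom x y) :
  mcomp (hom_cast ey ez g) (hom_cast ex ey' f) = hom_cast ex ez (mcomp g f).
Proof.
rewrite (Prop_irrelevance ey' ey).
by case: _ / ex; case: _ / ey; case: _ / ez.
Qed.
Lemma hom_cast_idm (C : category) (x x' : C) (e e' : x = x') :
  hom_cast e e' (idm x) = idm x'.
Proof. by rewrite (Prop_irrelevance e' e); case: _ / e. Qed.

Record functor (C D : category) := Functor {
  fob :> C -> D;
  fmap : forall x y : C, hom x y -> hom (fob x) (fob y);
  fmap1 : forall x, fmap (idm x) = idm (fob x);
  fmap_comp : forall x y z (g : hom y z) (f : hom x y),
    fmap (mcomp g f) = mcomp (fmap g) (fmap f) }.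
Arguments fmap {C D} F {x y} f : rename.

Lemma functor_ext (C D : category) (F G : functor C D)
    (e : forall x, F x = G x) :
  (forall x y (f : hom x y), hom_cast (e x) (e y) (fmap F f) = fmap G f) ->
  F = G.
Proof.
case: F G e => [F Fm F1 Fc] [G Gm G1 Gc] /= e.
have E : F = G by apply: funext.
case: _ / E Gm G1 Gc e => Gm G1 Gc e h.
have E : Fm = Gm.
  do 3!apply: functional_extensionality_dep => ?.
  by rewrite -h hom_cast_id.
by case: _ / E G1 Gc h => G1 Gc _; congr Functor; apply: Prop_irrelevance.
Qed.

Lemma fmap_eq (C D : category) (F G : functor C D) (x y : C) (f : hom x y)
    (ex : F x = G x) (ey : F y = G y) :
  F = G -> hom_cast ex ey (fmap F f) = fmap G f.
Proof. by move=> E; case: _ / E ex ey => ex ey; rewrite hom_cast_id. Qed.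

Definition fcomp (C D E : category) (G : functor D E) (F : functor C D) :
  functor C E.
Proof.
refine (@Functor C E (fun x => G (F x)) (fun x y f => fmap G (fmap F f)) _ _).
- by move=> x; rewrite !fmap1.
- by move=> x y z g f; rewrite !fmap_comp.
Defined.

Definition ord_cat (n : nat) : category.
Proof.
refine (@Category 'I_n.+1 (fun i j => i <= j) (fun i => leqnn i)
  (fun i j k jk ij => leq_trans ij jk) _ _ _) => *; exact: bool_irrelevance.
Defined.

Definition op_functor m n (a : op m.+1 n.+1) : functor (ord_cat m) (ord_cat n).
Proof.
refine (@Functor (ord_cat m) (ord_cat n) a (fun i j ij => op_le a ij) _ _) => *;
exact: bool_irrelevance.
Defined.

Lemma ord_functor_eq n (C : category) (K : functor (ord_cat n) C)
    (i i' j j' : ord_cat n) (ij : hom i j) (ij' : hom i' j')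
    (ei : K i = K i') (ej : K j = K j') :
  i = i' -> j = j' -> hom_cast ei ej (fmap K ij) = fmap K ij'.
Proof.
move=> Ei Ej; case: _ / Ei ij' ei => ij' ei; case: _ / Ej ij' ej => ij' ej.
by rewrite hom_cast_id; congr fmap; exact: bool_irrelevance.
Qed.

Lemma nerve_id (C : category) n (K : functor (ord_cat n) C) :
  fcomp K (op_functor (op_id n.+1)) = K.
Proof.
have e (i : ord_cat n) : fcomp K (op_functor (op_id n.+1)) i = K i.
  by rewrite /= op_idE.
apply: (functor_ext (e := e)) => i j ij.
exact: (@ord_functor_eq n C K _ _ _ _ (op_le _ ij) ij (e i) (e j)
  (op_idE i) (op_idE j)).
Qed.
Lemma nerve_comp (C : category) m n p (a : op n.+1 p.+1) (b : op m.+1 n.+1)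
    (K : functor (ord_cat p) C) :
  fcomp K (op_functor (op_comp a b))
  = fcomp (fcomp K (op_functor a)) (op_functor b).
Proof.
have e (i : ord_cat m) : fcomp K (op_functor (op_comp a b)) i
  = fcomp (fcomp K (op_functor a)) (op_functor b) i by rewrite /= op_compE.
apply: (functor_ext (e := e)) => i j ij.
exact: (@ord_functor_eq p C K _ _ _ _ (op_le _ ij) (op_le _ (op_le _ ij))
  (e i) (e j) (op_compE a b i) (op_compE a b j)).
Qed.
Definition nerve (C : category) : sset :=
  @SSet (fun n => functor (ord_cat n) C)
    (fun m n a K => fcomp K (op_functor a)) (@nerve_id C) (@nerve_comp C).

Lemma fcompA (B C D E : category) (H : functor D E) (G : functor C D)
    (F : functor B C) : fcomp H (fcomp G F) = fcomp (fcomp H G) F.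
Proof.
have e x : fcomp H (fcomp G F) x = fcomp (fcomp H G) F x by [].
by apply: (functor_ext (e := e)) => x y f; apply: hom_cast_id.
Qed.
Lemma nerve_map_subproof (C D : category) (G : functor C D)
    m n (a : op m.+1 n.+1) (K : nerve C n) :
  fcomp G (sact a K) = sact a (fcomp G K : nerve D n).
Proof. exact: fcompA. Qed.
Definition nerve_map (C D : category) (G : functor C D) :
  smap (nerve C) (nerve D) :=
  @SMap (nerve C) (nerve D) (fun n K => fcomp G K) (nerve_map_subproof G).

Definition face (S : sset) n (i : 'I_n.+2) : S n.+1 -> S n := sact (coface i).
Definition degen0 (S : sset) (x : S 0) : S 1 := sact (op_const 2 ord0) x.
Definition esrc (S : sset) (e : S 1) : S 0 := face ord_max e.
Definition etgt (S : sset) (e : S 1) : S 0 := face ord0 e.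

(* ho(S) is presented as the free category on the graph of 0- and 1-simplices
   of S, modulo the relations given by [hrel]; [ho_adjunction] below shows that
   this is left adjoint to the nerve. *)
Inductive hpath (S : sset) : S 0 -> S 0 -> Type :=
| hnil x : hpath x x
| hcons x y z (e : S 1) of esrc e = x & etgt e = y & hpath y z : hpath x z.
Arguments hnil {S} x.
Arguments hcons {S x y z} e _ _ _.

Fixpoint hcat (S : sset) (x y z : S 0) (p : hpath x y) : hpath y z -> hpath x z :=
  match p in hpath x y return hpath y z -> hpath x z with
  | hnil _ => id
  | hcons _ _ _ e ex ey p => fun q => hcons e ex ey (hcat p q)
  end.

(* The congruence on paths generated by: degenerate edges are identities, and
   d1 s = d0 s . d2 s for each 2-simplex s. *)
Inductive hrel (S : sset) : forall x y : S 0, hpath x y -> hpath x y -> Prop :=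
| hrel_refl x y (p : hpath x y) : hrel p p
| hrel_sym x y (p q : hpath x y) : hrel p q -> hrel q p
| hrel_trans x y (p q r : hpath x y) : hrel p q -> hrel q r -> hrel p r
| hrel_cons x y z (e : S 1) (ex : esrc e = x) (ey : etgt e = y)
    (p q : hpath y z) :
    hrel p q -> hrel (hcons e ex ey p) (hcons e ex ey q)
| hrel_degen x y (ex : esrc (degen0 x) = x) (ex' : etgt (degen0 x) = x)
    (p : hpath x y) :
    hrel (hcons (degen0 x) ex ex' p) p
| hrel_face x y z w (s : S 2)
    (ex2 : esrc (face ord_max s) = x) (ey2 : etgt (face ord_max s) = y)
    (ex0 : esrc (face ord0 s) = y) (ey0 : etgt (face ord0 s) = z)
    (ex1 : esrc (face (inord 1) s) = x) (ey1 : etgt (face (inord 1) s) = z)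
    (p : hpath z w) :
    hrel (hcons _ ex2 ey2 (hcons _ ex0 ey0 p)) (hcons _ ex1 ey1 p).

Section HomotopyCategory.
Variable S : sset.
Implicit Types x y z w : S 0.

Lemma hrel_catl x y z (p p' : hpath x y) (q : hpath y z) :
  hrel p p' -> hrel (hcat p q) (hcat p' q).
Proof.
move=> h; elim: h z q => {x y p p'} /=.
- by move=> *; apply: hrel_refl.
- by move=> x y p q _ IH z r; apply/hrel_sym/IH.
- by move=> x y p q r _ IH _ IH' z t; apply: hrel_trans (IH _ _) (IH' _ _).
- by move=> x y z e ex ey p q _ IH w r; apply/hrel_cons/IH.
- by move=> *; apply: hrel_degen.
- by move=> *; apply: hrel_face.
Qed.
Lemma hrel_catr x y z (p : hpath x y) (q q' : hpath y z) :
  hrel q q' -> hrel (hcat p q) (hcat p q').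
Proof. by elim: p q q' => //= *; apply: hrel_cons; auto. Qed.
Lemma hcat_nil x y (p : hpath x y) : hcat p (hnil y) = p.
Proof. by elim: p => //= *; congr hcons. Qed.
Lemma hcatA w x y z (p : hpath w x) (q : hpath x y) (r : hpath y z) :
  hcat (hcat p q) r = hcat p (hcat q r).
Proof. by elim: p q => //= *; congr hcons. Qed.

Definition hrelb x y (p q : {classic hpath x y}) : bool := `[< hrel p q >].
Lemma hrelb_equiv x y : equiv_class_of (@hrelb x y).
Proof.
split=> [p|p q|q p r].
- by apply/asboolP/hrel_refl.
- by apply/asboolP/asboolP; apply: hrel_sym.
- by move=> /asboolP pq /asboolP qr; apply/asboolP/(hrel_trans pq).
Qed.
Canonical hrel_equiv x y := EquivRelPack (hrelb_equiv x y).

Definition hhom x y : Type := {eq_quot (hrel_equiv x y)}.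
Definition hclass x y (p : hpath x y) : hhom x y :=
  \pi_{eq_quot (hrel_equiv x y)}%qT p.
Definition hrepr x y (f : hhom x y) : hpath x y :=
  repr (f : {eq_quot (hrel_equiv x y)}).

Lemma hreprK x y (f : hhom x y) : hclass (hrepr f) = f.
Proof. exact: reprK. Qed.
Lemma hclassP x y (p q : hpath x y) : hclass p = hclass q <-> hrel p q.
Proof.
split=> [/eqmodP/asboolP //|pq].
by apply/eqmodP/asboolP.
Qed.
Lemma hrepr_class x y (p : hpath x y) : hrel (hrepr (hclass p)) p.
Proof. by apply/hclassP; rewrite hreprK. Qed.

Definition hcomp x y z (g : hhom y z) (f : hhom x y) : hhom x z :=
  hclass (hcat (hrepr f) (hrepr g)).

Lemma hcomp_class x y z (q : hpath y z) (p : hpath x y) :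
  hcomp (hclass q) (hclass p) = hclass (hcat p q).
Proof.
apply/hclassP; apply: hrel_trans (hrel_catl _ (hrepr_class p)) _.
exact/hrel_catr/hrepr_class.
Qed.

Definition ho : category.
Proof.
refine (@Category (S 0) hhom (fun x => hclass (hnil x)) hcomp _ _ _).
- by move=> x y f; rewrite -(hreprK f) hcomp_class.
- by move=> x y f; rewrite -(hreprK f) hcomp_class hcat_nil.
- move=> w x y z h g f; rewrite -(hreprK f) -(hreprK g) -(hreprK h).
  by rewrite !hcomp_class hcatA.
Defined.

Definition hedge x y (e : S 1) (ex : esrc e = x) (ey : etgt e = y) :
  hom (x : ho) (y : ho) := hclass (hcons e ex ey (hnil y)).
End HomotopyCategory.

Section HomotopyFunctor.
Variables (S T : sset) (F : smap S T).

Lemma face_map n (i : 'I_n.+2) (s : S n.+1) y :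
  face i s = y -> face i (F n.+1 s) = F n y.
Proof. by move=> <-; rewrite /face smap_nat. Qed.

Fixpoint hpath_map x y (p : hpath x y) : hpath (F 0 x) (F 0 y) :=
  match p in hpath x y return hpath (F 0 x) (F 0 y) with
  | hnil x => hnil (F 0 x)
  | hcons _ _ _ e ex ey p =>
      hcons (F 1 e) (face_map ex) (face_map ey) (hpath_map p)
  end.

Lemma hcons_eq (U : sset) (x y z : U 0) (e e' : U 1)
    (ex : esrc e = x) (ex' : esrc e' = x) (ey : etgt e = y) (ey' : etgt e' = y)
    (p : hpath y z) : e = e' -> hcons e ex ey p = hcons e' ex' ey' p.
Proof.
move=> E; subst e'.
by rewrite (Prop_irrelevance ex ex') (Prop_irrelevance ey ey').
Qed.

Lemma hpath_map_rel x y (p q : hpath x y) :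
  hrel p q -> hrel (hpath_map p) (hpath_map q).
Proof.
elim=> {x y p q} /=.
- by move=> *; apply: hrel_refl.
- by move=> *; apply: hrel_sym.
- by move=> x y p q r _ pq _ qr; apply: hrel_trans pq qr.
- by move=> *; apply: hrel_cons.
- move=> x y ex ex' p.
  have E : F 1 (degen0 x) = degen0 (F 0 x) by rewrite /degen0 smap_nat.
  have sx : esrc (degen0 (F 0 x)) = F 0 x by rewrite -E; apply: face_map.
  have tx : etgt (degen0 (F 0 x)) = F 0 x by rewrite -E; apply: face_map.
  by rewrite (hcons_eq _ sx _ tx _ E); apply: hrel_degen.
- move=> x y z w s ex2 ey2 ex0 ey0 ex1 ey1 p.
  have E i : F 1 (face i s) = face i (F 2 s) by rewrite /face smap_nat.
  have sE i u (e : esrc (face i s) = u) : esrc (face i (F 2 s)) = F 0 u.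
    by rewrite -E; apply: face_map.
  have tE i u (e : etgt (face i s) = u) : etgt (face i (F 2 s)) = F 0 u.
    by rewrite -E; apply: face_map.
  rewrite (hcons_eq _ (sE _ _ ex2) _ (tE _ _ ey2) _ (E _)).
  rewrite (hcons_eq _ (sE _ _ ex0) _ (tE _ _ ey0) _ (E _)).
  rewrite (hcons_eq _ (sE _ _ ex1) _ (tE _ _ ey1) _ (E _)).
  exact: hrel_face.
Qed.

Lemma hpath_map_cat x y z (p : hpath x y) (q : hpath y z) :
  hpath_map (hcat p q) = hcat (hpath_map p) (hpath_map q).
Proof. by elim: p q => //= *; congr hcons. Qed.

Definition ho_hom x y (f : hhom x y) : hhom (F 0 x) (F 0 y) :=
  hclass (hpath_map (hrepr f)).

Lemma ho_hom_class x y (p : hpath x y) :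
  ho_hom (hclass p) = hclass (hpath_map p).
Proof. by apply/hclassP/hpath_map_rel/hrepr_class. Qed.

Definition ho_map : functor (ho S) (ho T).
Proof.
refine (@Functor (ho S) (ho T) (F 0) ho_hom _ _).
- by move=> x; apply: ho_hom_class.
- move=> x y z g f; rewrite /= -(hreprK f) -(hreprK g) hcomp_class.
  by rewrite !ho_hom_class hpath_map_cat hcomp_class.
Defined.
End HomotopyFunctor.

Section Unit.
Variable S : sset.

Lemma edge_op_subproof n (i j : 'I_n.+1) (ij : i <= j) :
  {homo (fun k : 'I_2 => if k == ord0 then i else j) : k l / k <= l}.
Proof. by move=> [[|[|k]] kP] [[|[|l]] lP] //=. Qed.
Definition edge_op n (i j : 'I_n.+1) (ij : i <= j) : op 2 n.+1 :=
  mk_op (edge_op_subproof ij).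

Definition vertex n (i : 'I_n.+1) (s : S n) : S 0 := sact (op_const 1 i) s.
Definition edge n (i j : 'I_n.+1) (ij : i <= j) (s : S n) : S 1 :=
  sact (edge_op ij) s.

Lemma edge_src n (i j : 'I_n.+1) (ij : i <= j) (s : S n) :
  esrc (edge ij s) = vertex i s.
Proof.
rewrite /esrc /face -sact_comp; congr (sact _ s); apply: op_ext => k.
by rewrite op_compE !mk_opE ord1.
Qed.
Lemma edge_tgt n (i j : 'I_n.+1) (ij : i <= j) (s : S n) :
  etgt (edge ij s) = vertex j s.
Proof.
rewrite /etgt /face -sact_comp; congr (sact _ s); apply: op_ext => k.
by rewrite op_compE !mk_opE ord1.
Qed.

Definition unit_hom n (s : S n) (i j : ord_cat n) (ij : hom i j) :
  hom (vertex i s : ho S) (vertex j s : ho S) :=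
  hedge (edge_src ij s) (edge_tgt ij s).

Lemma tri_op_subproof n (i j k : 'I_n.+1) (ij : i <= j) (jk : j <= k) :
  {homo (fun l : 'I_3 => if l == ord0 then i else if l == ord_max then k else j)
     : l m / l <= m}.
Proof.
move=> [[|[|[|l]]] lP] [[|[|[|m]]] mP] //= _; exact: leq_trans ij jk.
Qed.

Definition unit_fun n (s : S n) : nerve (ho S) n.
Proof.
refine (@Functor (ord_cat n) (ho S) (fun i => vertex i s) (unit_hom s) _ _).
- move=> i; apply/hclassP.
  have E : edge (leqnn i) s = degen0 (vertex i s).
    rewrite /edge /degen0 -sact_comp; congr (sact _ s); apply: op_ext => k.
    by rewrite op_compE !mk_opE if_same.
  have ex : esrc (degen0 (vertex i s)) = vertex i s by rewrite -E edge_src.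
  have ey : etgt (degen0 (vertex i s)) = vertex i s by rewrite -E edge_tgt.
  by rewrite (hcons_eq _ ex _ ey _ E); apply: hrel_degen.
- move=> i j k jk ij; rewrite /= hcomp_class; apply/hclassP/hrel_sym => /=.
  pose t : S 2 := sact (mk_op (tri_op_subproof ij jk)) s.
  have E (l : 'I_3) (u v : 'I_n.+1) (uv : u <= v) :
      (forall m : 'I_2, mk_op (tri_op_subproof ij jk) (lift l m)
         = if m == ord0 then u else v) ->
      edge uv s = face l t.
    move=> tE; rewrite /t /face /edge -sact_comp; congr (sact _ s).
    by apply: op_ext => m; rewrite op_compE [coface l m]mk_opE tE mk_opE.
  have E2 : edge ij s = face ord_max t.
    by apply: E => -[[|[|m]] mP] //; rewrite mk_opE.
  have E0 : edge jk s = face ord0 t.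
    by apply: E => -[[|[|m]] mP] //; rewrite mk_opE.
  have E1 : edge (leq_trans ij jk) s = face (inord 1) t.
    have -> : inord 1 = lift ord0 ord0 :> 'I_3 by apply/val_inj; apply: (@inordK 2 1 isT).
    by apply: E => -[[|[|m]] mP] //; rewrite mk_opE.
  have sE l (u v : 'I_n.+1) (uv : u <= v) :
      edge uv s = face l t -> esrc (face l t) = vertex u s.
    by move=> <-; apply: edge_src.
  have tE l (u v : 'I_n.+1) (uv : u <= v) :
      edge uv s = face l t -> etgt (face l t) = vertex v s.
    by move=> <-; apply: edge_tgt.
  rewrite (hcons_eq _ (sE _ _ _ _ E2) _ (tE _ _ _ _ E2) _ E2).
  rewrite (hcons_eq _ (sE _ _ _ _ E0) _ (tE _ _ _ _ E0) _ E0).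
  rewrite (hcons_eq _ (sE _ _ _ _ E1) _ (tE _ _ _ _ E1) _ E1).
  exact: hrel_face.
Defined.

Lemma hedge_cast (x x' y y' : ho S) (ex : x = x') (ey : y = y') (e : S 1)
    (e1 : esrc e = x) (e2 : etgt e = y) :
  hom_cast ex ey (hedge e1 e2) = hedge (etrans e1 ex) (etrans e2 ey).
Proof. by case: _ / ex; case: _ / ey. Qed.

Lemma hedge_eq (x y : ho S) (e e' : S 1) (ex : esrc e = x) (ex' : esrc e' = x)
    (ey : etgt e = y) (ey' : etgt e' = y) :
  e = e' -> hedge ex ey = hedge ex' ey'.
Proof. by move=> E; congr hclass; apply: hcons_eq. Qed.

Lemma unit_subproof m n (a : op m.+1 n.+1) (s : S n) :
  unit_fun (sact a s) = sact a (unit_fun s).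
Proof.
have e i : unit_fun (sact a s) i = (sact a (unit_fun s) : nerve (ho S) m) i.
  rewrite /= /vertex -sact_comp; congr (sact _ s); apply: op_ext => k.
  by rewrite op_compE !mk_opE.
apply: (functor_ext (e := e)) => i j ij; rewrite [LHS]hedge_cast.
apply: hedge_eq; rewrite /edge -sact_comp; congr (sact _ s).
by apply: op_ext => k; rewrite op_compE !mk_opE; case: ifP.
Qed.
Definition ho_unit : smap S (nerve (ho S)) :=
  @SMap S (nerve (ho S)) (fun n s => unit_fun s) unit_subproof.
End Unit.

Section Adjunction.
Variables (S : sset) (C : category).

Lemma vertex0 (x : S 0) : vertex ord0 x = x.
Proof.
rewrite -[RHS]sact_id /vertex; congr (sact _ x).
by apply: op_ext => i; rewrite !mk_opE !ord1.
Qed.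

Lemma edge01 (e : S 1) (le01 : (ord0 : 'I_2) <= (ord_max : 'I_2)) :
  edge le01 e = e.
Proof.
rewrite -[RHS]sact_id /edge; congr (sact _ e).
by apply: op_ext => -[[|[|i]] iP]; rewrite !mk_opE.
Qed.

Lemma esrcE (u : S 1) : esrc u = vertex ord0 u.
Proof.
congr (sact _ u); apply: op_ext => i; rewrite !mk_opE /=.
by rewrite ord1.
Qed.
Lemma etgtE (u : S 1) : etgt u = vertex ord_max u.
Proof.
congr (sact _ u); apply: op_ext => i; rewrite !mk_opE /=.
by rewrite ord1.
Qed.

Lemma ho_functor_eq (G H : functor (ho S) C) :
  scomp (nerve_map G) (ho_unit S) = scomp (nerve_map H) (ho_unit S) -> G = H.
Proof.
move=> GH.
have GHn n (s : S n) : fcomp G (unit_fun s) = fcomp H (unit_fun s).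
  by have := congr1 (fun f : smap S (nerve C) => f n s) GH.
have e x : G x = H x.
  have := congr1 (fun K : functor (ord_cat 0) C => fob K ord0) (GHn 0 x).
  by rewrite /= vertex0.
have le01 : (ord0 : 'I_2) <= (ord_max : 'I_2) by [].
have gen x y (u : S 1) (ux : esrc u = x) (uy : etgt u = y) :
    hom_cast (e x) (e y) (fmap G (hedge ux uy)) = fmap H (hedge ux uy).
  have vx : vertex ord0 u = x by rewrite -ux esrcE.
  have vy : vertex ord_max u = y by rewrite -uy etgtE.
  move: ux uy; case: _ / vx; case: _ / vy => ux uy.
  have := @fmap_eq (ord_cat 1) C (fcomp G (unit_fun u)) (fcomp H (unit_fun u)) ord0 ord_max le01
    (e (vertex ord0 u)) (e (vertex ord_max u)) (GHn 1 u).
  rewrite /= /unit_hom; move: (edge_src _ _) (edge_tgt _ _).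
  rewrite edge01 => p q.
  by rewrite (Prop_irrelevance p ux) (Prop_irrelevance q uy).
apply: (functor_ext (e := e)) => x y f; rewrite -(hreprK f).
elim: (hrepr f) => {f x y} [x|x y z u ux uy p IH].
  by rewrite -[hclass _]/(idm (x : ho S)) !fmap1 hom_cast_idm.
have -> : hclass (hcons u ux uy p)
    = mcomp (hclass p : hom (y : ho S) (z : ho S)) (hedge ux uy).
  by rewrite /= hcomp_class.
by rewrite !fmap_comp -gen -IH hom_cast_comp.
Qed.

Variable F : smap S (nerve C).

Definition adj_ob (x : S 0) : C := F 0 x ord0.

Lemma adj_vertex n (s : S n) (i : ord_cat n) x :
  vertex i s = x -> F n s i = adj_ob x.
Proof. by move=> <-; rewrite /adj_ob /vertex smap_nat /= mk_opE. Qed.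

Let le01 : hom (ord0 : ord_cat 1) ord_max := isT.

Definition adj_edge x y (u : S 1) (ux : esrc u = x) (uy : etgt u = y) :
  hom (adj_ob x) (adj_ob y) :=
  hom_cast (adj_vertex (etrans (esym (esrcE u)) ux))
    (adj_vertex (etrans (esym (etgtE u)) uy)) (fmap (F 1 u) le01).

Lemma adj_edgeE n (s : S n) (i j : ord_cat n) (ij : hom i j) (u : S 1) x y
    (ux : esrc u = x) (uy : etgt u = y)
    (ix : vertex i s = x) (jy : vertex j s = y) :
  u = edge ij s ->
  adj_edge ux uy
  = hom_cast (adj_vertex ix) (adj_vertex jy) (fmap (F n s) ij).
Proof.
move=> E; rewrite /adj_edge.
move: (adj_vertex _) (adj_vertex _) => e1 e2.
have FE : F 1 u = sact (edge_op ij) (F n s) by rewrite E smap_nat.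
have i0 : edge_op ij ord0 = i by rewrite mk_opE.
have j1 : edge_op ij ord_max = j by rewrite mk_opE.
move: e1 e2; rewrite FE /= => e1 e2.
have ei : F n s (edge_op ij ord0) = F n s i by rewrite i0.
have ej : F n s (edge_op ij ord_max) = F n s j by rewrite j1.
rewrite -(@ord_functor_eq n C (F n s) _ _ _ _ (op_le (edge_op ij) le01) ij ei ej
  i0 j1).
by rewrite hom_cast_trans; congr hom_cast; apply: Prop_irrelevance.
Qed.

Fixpoint adj_path x y (p : hpath x y) : hom (adj_ob x) (adj_ob y) :=
  match p in hpath x y return hom (adj_ob x) (adj_ob y) with
  | hnil x => idm (adj_ob x)
  | hcons _ _ _ u ux uy p => mcomp (adj_path p) (adj_edge ux uy)
  end.

Lemma adj_path_cat x y z (p : hpath x y) (q : hpath y z) :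
  adj_path (hcat p q) = mcomp (adj_path q) (adj_path p).
Proof.
elim: p q => [x' q|x' y' z' u ux uy p IH q] /=; first by rewrite mcomp1.
by rewrite IH mcompA.
Qed.

Lemma adj_path_rel x y (p q : hpath x y) : hrel p q -> adj_path p = adj_path q.
Proof.
elim=> {x y p q} //=.
- by move=> x y p q r _ -> _ ->.
- by move=> x y z e ex ey p q _ ->.
- move=> x y ex ex' p.
  have E : degen0 x = edge (leqnn (ord0 : 'I_1)) x.
    by congr (sact _ x); apply: op_ext => i; rewrite !mk_opE if_same.
  rewrite (adj_edgeE ex ex' (vertex0 x) (vertex0 x) E).
  have -> : leqnn (ord0 : 'I_1) = idm (ord0 : ord_cat 0) by [].
  by rewrite fmap1 hom_cast_idm mcomp1.
- move=> x y z w s ex2 ey2 ex0 ey0 ex1 ey1 p; rewrite -mcompA; congr mcomp.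
  pose o0 : ord_cat 2 := ord0.
  pose o1 : ord_cat 2 := inord 1.
  pose o2 : ord_cat 2 := ord_max.
  have l01 : hom o0 o1 by [].
  have l12 : hom o1 o2 by rewrite /= inordK.
  have l02 : hom o0 o2 by [].
  have E (l : 'I_3) (u v : ord_cat 2) (uv : hom u v) :
     (forall m : 'I_2, lift l m = (if m == ord0 then u else v)) ->
     face l s = edge uv s.
    move=> h; congr (sact _ s); apply: op_ext => m.
    by rewrite [coface l m]mk_opE h [edge_op uv m]mk_opE.
  have E2 : face ord_max s = edge l01 s.
    by apply: E => -[[|[|m]] mP] //; apply/val_inj; rewrite //= inordK.
  have E0 : face ord0 s = edge l12 s.
    by apply: E => -[[|[|m]] mP] //; apply/val_inj; rewrite //= inordK.
  have E1 : face (inord 1) s = edge l02 s.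
    by apply: E => -[[|[|m]] mP] //; apply/val_inj; rewrite //= inordK.
  have vx : vertex o0 s = x by rewrite -ex2 E2 edge_src.
  have vy : vertex o1 s = y by rewrite -ey2 E2 edge_tgt.
  have vz : vertex o2 s = z by rewrite -ey0 E0 edge_tgt.
  rewrite (adj_edgeE ex2 ey2 vx vy E2) (adj_edgeE ex0 ey0 vy vz E0).
  rewrite (adj_edgeE ex1 ey1 vx vz E1) hom_cast_comp -fmap_comp.
  by congr hom_cast; congr fmap; apply: bool_irrelevance.
Qed.

Definition adj_functor : functor (ho S) C.
Proof.
refine (@Functor (ho S) C adj_ob (fun x y f => adj_path (hrepr f)) _ _).
- by move=> x; apply: (adj_path_rel (hrepr_class _)).
- move=> x y z g f; rewrite -adj_path_cat.
  exact: (adj_path_rel (hrepr_class _)).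
Defined.

(* The universal property of the unit S -> N(ho S), for every category C. *)
Lemma ho_adjunction :
  exists! G : functor (ho S) C, scomp (nerve_map G) (ho_unit S) = F.
Proof.
have FE : scomp (nerve_map adj_functor) (ho_unit S) = F.
  apply: smap_ext => n s /=.
  have e (i : ord_cat n) : fcomp adj_functor (unit_fun s) i = F n s i.
    by rewrite /= -(adj_vertex (erefl (vertex i s))).
  apply: (functor_ext (e := e)) => i j ij.
  have -> : fmap (fcomp adj_functor (unit_fun s)) ij
      = adj_edge (edge_src ij s) (edge_tgt ij s).
    by rewrite /= (adj_path_rel (hrepr_class _)) /= m1comp.
  by rewrite (adj_edgeE _ _ erefl erefl erefl) hom_cast_trans hom_cast_id.
exists adj_functor; split=> // G GF.
by apply: ho_functor_eq; rewrite FE.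
Qed.
End Adjunction.

Lemma ho_unit_nat (S T : sset) (F : smap S T) :
  scomp (nerve_map (ho_map F)) (ho_unit S) = scomp (ho_unit T) F.
Proof.
apply: smap_ext => n s /=.
have e (i : ord_cat n) :
    fcomp (ho_map F) (unit_fun s) i = unit_fun (F n s) i.
  by rewrite /= /vertex smap_nat.
apply: (functor_ext (e := e)) => i j ij.
have -> : fmap (fcomp (ho_map F) (unit_fun s)) ij
    = hedge (face_map F (edge_src ij s)) (face_map F (edge_tgt ij s)).
  exact: ho_hom_class.
rewrite [LHS]hedge_cast; apply: hedge_eq.
by rewrite /edge smap_nat.
Qed.

(* The 2-cells between maps Y -> B are the morphisms of ho(B^Y); they are
   composed vertically by [mcomp]. *)

Section TwoCells.
Variables Y B : sset.

Definition vtx (f : smap Y B) : sexp B Y 0 := scomp f (spr2 (simplex 0) Y).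
Definition cell (f g : smap Y B) : Type :=
  hom (vtx f : ho (sexp B Y)) (vtx g : ho (sexp B Y)).
Definition cell_cast (f f' g g' : smap Y B) (ef : f = f') (eg : g = g') :
  cell f g -> cell f' g' :=
  @hom_cast (ho (sexp B Y)) _ _ _ _ (congr1 vtx ef) (congr1 vtx eg).
End TwoCells.

Lemma vtx_post (Y B C : sset) (k : smap B C) (f : smap Y B) :
  ho_map (exp_post Y k) (vtx f) = vtx (scomp k f).
Proof. exact: scompA. Qed.
Definition whisker_post (Y B C : sset) (k : smap B C) (f g : smap Y B)
    (z : cell f g) : cell (scomp k f) (scomp k g) :=
  hom_cast (vtx_post k f) (vtx_post k g) (fmap (ho_map (exp_post Y k)) z).

Lemma vtx_pre (Z Y B : sset) (u : smap Z Y) (f : smap Y B) :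
  ho_map (exp_pre B u) (vtx f) = vtx (scomp f u).
Proof. exact: smap_ext. Qed.
Definition whisker_pre (Z Y B : sset) (f g : smap Y B) (z : cell f g)
    (u : smap Z Y) : cell (scomp f u) (scomp g u) :=
  hom_cast (vtx_pre u f) (vtx_pre u g) (fmap (ho_map (exp_pre B u)) z).

(* [lam] displays l as an absolute right lifting of d through c, for d and l
   with domain the terminal quasi-category. The cast identifies (c l)! with
   c (l !). *)
Definition absolute_right_lifting (B C : sset) (c : smap B C)
    (d : smap (simplex 0) C) (l : smap (simplex 0) B)
    (lam : cell (scomp c l) d) : Prop :=
  forall Y : sset, quasi_category Y ->
  forall (b : smap Y B) (chi : cell (scomp c b) (scomp d (bang Y))),
  exists! zeta : cell b (scomp l (bang Y)),
    chi = mcomp (cell_cast (esym (scompA c l (bang Y))) erefl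
                   (whisker_pre lam (bang Y)))
                (whisker_post c zeta).

Definition const_diag (X A : sset) : smap A (sexp A X) := curry (spr1 A X).

(* The vertex of A^X corresponding to a diagram X -> A. *)
Definition diag_vertex (X A : sset) (d : smap X A) :
  smap (simplex 0) (sexp A X) := curry (scomp d (spr2 (simplex 0) X)).

Section Limits.
Variables (X A : sset) (d : smap X A).

Definition cone (l : A 0) : Type :=
  cell (scomp (const_diag X A) (yoneda l)) (diag_vertex d).

Definition limit_cone (l : A 0) (lam : cone l) : Prop :=
  absolute_right_lifting lam.

Definition joyal_limit_cone (t : slice d 0) : Prop := terminal t.

Lemma aug_pt_uniq l (u v : aug (simplex 0) l) : u = v.
Proof.
case: l u v => [|l] u v; first by case: u; case: v.
by apply: op_ext => i; rewrite !ord1.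
Qed.
Lemma aug0_uniq (Z : sset) r (u v : aug Z r) : r = 0 -> u = v.
Proof. by move=> r0; subst r; case: u; case: v. Qed.

Lemma cone_collapse0 m (c : simplex 1 m) (x : X m) (y : simplex 0 m) :
  (forall i, c i = ord0) -> cone_collapse X m (c, x) = join_inl _ X m y.
Proof.
move=> c0.
have e : cutl c 1 = m.+1 by apply: cutl_uniq => // i; rewrite c0 ltn_ord.
have e' : m.+1 - cutl c 1 = 0 by rewrite e subnn.
apply: (join_ob_ext e e'); first exact: aug_pt_uniq.
exact: aug0_uniq.
Qed.
Lemma cone_collapse1 m (c : simplex 1 m) (x : X m) :
  (forall i, c i = ord_max) -> cone_collapse X m (c, x) = join_inr _ X m x.
Proof.
move=> c1.
have e : cutl c 1 = 0 by apply: cutl_uniq => // i; rewrite c1.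
have e' : m.+1 - cutl c 1 = m.+1 by rewrite e subn0.
apply: (join_ob_ext e e'); first exact: aug_pt_uniq.
congr (@aug_act X _ m.+1 _ x); apply: op_ext => i.
by rewrite op_castE !mk_opE /= [X in X + _]e.
Qed.

(* The 1-simplex of A^X underlying a vertex of the slice: the composite
   Delta^1 x X -> join (Delta^0) X -> A. *)
Definition slice_edge (t : slice d 0) : sexp A X 1 :=
  scomp (sval t) (cone_collapse X).
Definition slice_edge_pt (t : slice d 0) :
  sexp (sexp A X) (simplex 0) 1 :=
  scomp (yoneda (slice_edge t)) (spr1 (simplex 1) (simplex 0)).

Lemma slice_edge_src t :
  esrc (slice_edge_pt t)
  = vtx (scomp (const_diag X A) (yoneda (slice_pr d 0 t))).
Proof.
apply: smap_ext => n [b b']; apply: smap_ext => m [a x].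
transitivity (sval t m (join_inl _ X m (op_const m.+1 ord0 : simplex 0 m))).
  congr (sval t m _); apply: cone_collapse0.
  by move=> i; rewrite !op_compE mk_opE ord1; apply/val_inj.
rewrite -[RHS]/(sact a (sact b'
  (sval t 0 (join_inl _ X 0 (op_id 1 : simplex 0 0))))).
rewrite -!smap_nat; congr (sval t m (join_inl _ X m _)).
by apply: op_ext => i; rewrite !ord1.
Qed.
Lemma slice_edge_tgt t : etgt (slice_edge_pt t) = vtx (diag_vertex d).
Proof.
apply: smap_ext => n [b b']; apply: smap_ext => m [a x].
transitivity (sval t m (join_inr _ X m x)); last first.
  exact: (congr1 (fun f : smap X A => f m x) (svalP t)).
congr (sval t m _); apply: cone_collapse1.
by move=> i; rewrite !op_compE mk_opE ord1; apply/val_inj.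
Qed.

Definition slice_cone_cell (t : slice d 0) : cone (slice_pr d 0 t) :=
  hedge (slice_edge_src t) (slice_edge_tgt t).
Definition slice_cone (t : slice d 0) : {l : A 0 & cone l} :=
  existT _ (slice_pr d 0 t) (slice_cone_cell t).
End Limits.

(* Main.v *)
(* The projection A_{/d} -> A is a right fibration, and t in Q is terminal iff
   Q_{/t} -> Q is a trivial fibration. For Q = A_{/d} over l = pi t, the map
   Q_{/t} -> A_{/l} is a trivial fibration, so 2-cells b => l! are represented by
   maps Y -> Q_{/t}. On the other hand, 2-cells c b => d! are represented by maps
   Y -> A_{/d} over b, up to homotopy over b: a 2-cell is a map from
   (Y * pt) x X to A, and it extends along an inner anodyne inclusion into a
   complex ([bridge]) that also contains Y * X. In these terms, composition with
   the cone of t is the projection Q_{/t} -> Q. If t is terminal, then lifting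
   maps and homotopies through the trivial fibration Q_{/t} -> Q gives the
   universal property. Conversely, the universal property for Y = Q and Y = Q_{/t}
   makes the right fibration Q_{/t} -> Q a deformation retraction over Q, hence a
   trivial fibration. *)
From mathcomp Require Import all_boot boolp zify.
Require Import Defs.

Set Implicit Arguments.
Unset Strict Implicit.
Unset Printing Implicit Defensive.

(** * Subcomplexes and lifting *)

(** The obstacle is that a 2-cell c b => d! lives on (Y * pt) x X, while a map Y -> A_{/d} lives on
    Y * X. The natural map [jmu] from the first to the second yields [theta] : A_{/d} -> (A^X)_{/d},
    which goes the wrong way for reading a 2-cell as a map into A_{/d}. [theta] is not shown to be
    an equivalence: it suffices that it is bijective on homotopy classes of maps over a fixed b.
    Surjectivity ([strictify]) and injectivity ([strict_homotopy]) are one extension problem,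
    absolute in the first case and relative to the two ends of Delta^1 x Y in the second. Q_{/t} ->
    A_{/l} is a trivial fibration because a boundary inclusion joined with a point is the horn
    inclusion at the last vertex, against which A_{/d} -> A lifts. For the same reason homotopies
    are lifted along right fibrations backwards, from the end 1 of Delta^1. No class of anodyne maps
    is formed: everything is a lifting property of one given map. The product inclusions are reduced
    by skeleta to two pairings of the chains of a grid, one for a horn and one for a missing
    corner. *)

Lemma existT_inj (I : Type) (F : I -> Type) i (x y : F i) :
  existT F i x = existT F i y -> x = y.
Proof.
by move=> E; have := projT2_eq E; rewrite (Prop_irrelevance (projT1_eq E) erefl).
Qed.

Lemma sval_inj (T : Type) (F : T -> Prop) (x y : {x | F x}) :
  sval x = sval y -> x = y.
Proof. by case: x y => [x ?] [y ?] /= e; apply: eq_exist. Qed.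

Record subc (T : sset) := Subc {
  sc :> forall n, T n -> Prop;
  sc_act : forall m n (a : op m.+1 n.+1) (x : T n), sc x -> sc (sact a x) }.
Arguments sc {T} s n x : rename.

Lemma subc_ext (T : sset) (S S' : subc T) :
  (forall n x, S n x <-> S' n x) -> S = S'.
Proof.
case: S S' => [S SP] [S' S'P] /= h.
have e : S = S' by do 2!apply: functional_extensionality_dep => ?; apply: propext.
by case: _ / e S'P {h} => S'P; congr Subc; apply: Prop_irrelevance.
Qed.

Section Sub.
Variables (T : sset) (S : subc T).
Definition sub_act m n (a : op m.+1 n.+1) (x : {x : T n | S n x}) :
  {x : T m | S m x} := exist _ (sact a (sval x)) (sc_act a (svalP x)).
Lemma sub_id n (x : {x : T n | S n x}) : sub_act (op_id n.+1) x = x.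
Proof. by case: x => x h; apply: eq_exist; apply: sact_id. Qed.
Lemma sub_comp m n p (a : op n.+1 p.+1) (b : op m.+1 n.+1)
    (x : {x : T p | S p x}) :
  sub_act (op_comp a b) x = sub_act b (sub_act a x).
Proof. by apply: eq_exist; apply: sact_comp. Qed.
Definition sub : sset := @SSet (fun n => {x : T n | S n x}) sub_act sub_id sub_comp.
Definition incl : smap sub T := @SMap sub T (fun n x => sval x) (fun _ _ _ _ => erefl).
End Sub.

Lemma sub_ext (T : sset) (S : subc T) n (x y : sub S n) : sval x = sval y -> x = y.
Proof. exact: sval_inj. Qed.

Definition fullc (T : sset) : subc T := @Subc T (fun _ _ => True) (fun _ _ _ _ _ => I).
Definition emptyc (T : sset) : subc T := @Subc T (fun _ _ => False) (fun _ _ _ _ h => h).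
Lemma preim_subproof (K T : sset) (f : smap K T) (S : subc T) m n
    (a : op m.+1 n.+1) (x : K n) : S n (f n x) -> S m (f m (sact a x)).
Proof. by rewrite smap_nat; apply: sc_act. Qed.
Definition preimc (K T : sset) (f : smap K T) (S : subc T) : subc K :=
  Subc (@preim_subproof K T f S).
Lemma unionc_subproof (T : sset) I (S : I -> subc T) m n (a : op m.+1 n.+1) (x : T n) :
  (exists i, S i n x) -> exists i, S i m (sact a x).
Proof. by case=> i h; exists i; apply: sc_act. Qed.
Definition unionc (T : sset) I (S : I -> subc T) : subc T := Subc (@unionc_subproof T I S).
Lemma orc_subproof (T : sset) (S S' : subc T) m n (a : op m.+1 n.+1) (x : T n) :
  S n x \/ S' n x -> S m (sact a x) \/ S' m (sact a x).
Proof. by case=> h; [left | right]; apply: sc_act. Qed.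
Definition orc (T : sset) (S S' : subc T) : subc T := Subc (@orc_subproof T S S').
Lemma andc_subproof (T : sset) (S S' : subc T) m n (a : op m.+1 n.+1) (x : T n) :
  S n x /\ S' n x -> S m (sact a x) /\ S' m (sact a x).
Proof. by case=> h h'; split; apply: sc_act. Qed.
Definition andc (T : sset) (S S' : subc T) : subc T := Subc (@andc_subproof T S S').

(** Uniqueness of the values makes any choice of them natural. A map on a union can therefore be
    given by one clause per piece, without deciding which piece a simplex lies in. *)
Lemma rel_smap (T P : sset) (R : forall n, T n -> P n -> Prop) :
  (forall n x, exists v, R n x v) ->
  (forall n x v v', R n x v -> R n x v' -> v = v') ->
  (forall m n (a : op m.+1 n.+1) x v, R n x v -> R m (sact a x) (sact a v)) ->
  exists h : smap T P, forall n x, R n x (h n x).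
Proof.
move=> tot fn nat.
have hP m n (a : op m.+1 n.+1) x :
    sval (cid (tot m (sact a x))) = sact a (sval (cid (tot n x))).
  apply: fn (svalP (cid (tot m (sact a x)))) _.
  exact: nat (svalP (cid (tot n x))).
exists (@SMap T P (fun n x => sval (cid (tot n x))) hP) => n x.
exact: (svalP (cid (tot n x))).
Qed.

Lemma glue (T P : sset) (S' : subc T) I (S : I -> subc T)
    (f : forall i, smap (sub (S i)) P) :
  (forall n x, S' n x -> exists i, S i n x) ->
  (forall i j n x (hi : S i n x) (hj : S j n x),
    f i n (exist _ x hi) = f j n (exist _ x hj)) ->
  exists h : smap (sub S') P, forall i n x (hi : S i n x) (h' : S' n x),
    h n (exist _ x h') = f i n (exist _ x hi).
Proof.
move=> cov comp.
pose R n (x : sub S' n) (v : P n) :=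
  exists i (hi : S i n (sval x)), v = f i n (exist _ (sval x) hi).
have [|||h hP] := @rel_smap (sub S') P R.
- by move=> n [x h']; have [i hi] := cov _ _ h'; exists (f i n (exist _ x hi)), i, hi.
- by move=> n x v v' [i [hi ->]] [j [hj ->]].
- move=> m n a x v [i [hi ->]]; exists i, (sc_act a hi).
  by rewrite -smap_nat; congr (f i m _); apply: sub_ext.
- exists h => i n x hi h'; have [j [hj ->]] := hP _ (exist _ x h').
  exact: comp.
Qed.

Section Lifting.
Variables (P Q : sset) (p : smap P Q).

(* The right lifting property of [p] against the inclusion of [S] into [S']. *)
Definition lifts (T : sset) (S S' : subc T) : Prop :=
  forall (f : smap (sub S) P) (g : smap T Q),
  (forall n x, p n (f n x) = g n (sval x)) ->
  exists h : smap (sub S') P,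
    (forall n x (hx : S n x) (hx' : S' n x), h n (exist _ x hx') = f n (exist _ x hx))
    /\ (forall n x, p n (h n x) = g n (sval x)).

Lemma lifts_triv (T : sset) (S S' : subc T) :
  (forall n x, S' n x -> S n x) -> lifts S S'.
Proof.
move=> ss f g fg.
have nat m n (a : op m.+1 n.+1) (x : sub S' n) :
    f m (exist _ (sval (sact a x)) (ss _ _ (svalP (sact a x))))
    = sact a (f n (exist _ (sval x) (ss _ _ (svalP x)))).
  by rewrite -smap_nat; congr (f m _); apply: sub_ext.
exists (SMap nat); split=> [n x hx hx'|n x] /=; last by rewrite fg.
by congr (f n _); apply: sub_ext.
Qed.

(* [S'] is obtained from [S] by attaching the [C' i] along the [C i]. *)
Lemma attach (T : sset) (S S' : subc T) (I : Type) (K : I -> sset)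
    (k : forall i, smap (K i) T) (C C' : forall i, subc (K i)) :
  (forall i n y, C' i n y -> S' n (k i n y)) ->
  (forall i n y, C i n y -> C' i n y) ->
  (forall i n y, C' i n y -> (C i n y <-> S n (k i n y))) ->
  (forall n x, S' n x -> S n x \/ exists i y, C' i n y /\ k i n y = x) ->
  (forall i j n y z, C' i n y -> C' j n z -> ~ S n (k i n y) ->
    k i n y = k j n z -> i = j) ->
  (forall i n y z, C' i n y -> C' i n z -> ~ S n (k i n y) ->
    k i n y = k i n z -> y = z) ->
  (forall i, lifts (C i) (C' i)) -> lifts S S'.
Proof.
move=> kS' CC' CS cov u1 u2 L f g fg.
have kC i n (y : sub (C i) n) : S n (k i n (sval y)).
  by apply/(CS _ _ _ (CC' _ _ _ (svalP y)))/svalP.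
have nat i m n (a : op m.+1 n.+1) (y : sub (C i) n) :
    f m (exist _ (k i m (sval (sact a y))) (kC _ _ (sact a y)))
    = sact a (f n (exist _ (k i n (sval y)) (kC _ _ y))).
  by rewrite -smap_nat; congr (f m _); apply: sub_ext; rewrite /= smap_nat.
have ex i : exists h : smap (sub (C' i)) P,
    (forall n y (hC : C i n y) (hC' : C' i n y) (hS : S n (k i n y)),
      h n (exist _ y hC') = f n (exist _ (k i n y) hS))
    /\ forall n y, p n (h n y) = g n (k i n (sval y)).
  have [n y|h [h1 h2]] := L i (SMap (nat i)) (scomp g (k i)); first by rewrite fg.
  exists h; split=> // n y hC hC' hS; rewrite (h1 _ _ hC) /=.
  by congr (f n _); apply: sub_ext.
pose H i := sval (cid (ex i)).
have H1 i : forall n y (hC' : C' i n y) (hS : S n (k i n y)),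
    H i n (exist _ y hC') = f n (exist _ (k i n y) hS).
  move=> n y hC' hS; apply: (proj1 (svalP (cid (ex i)))).
  exact/CS.
have H2 i := proj2 (svalP (cid (ex i))).
(* A new simplex takes its value from any cell through it. Cells may overlap only inside [S], where
   the values are those of f. *)
pose R n (x : sub S' n) (v : P n) :=
  (exists hx : S n (sval x), v = f n (exist _ (sval x) hx)) \/
  (exists i y (hy : C' i n y), k i n y = sval x /\ v = H i n (exist _ y hy)).
have [|||h hP] := @rel_smap (sub S') P R.
- move=> n [x hx']; case: (cov _ _ hx') => [hx|[i [y [hy e]]]].
    by exists (f n (exist _ x hx)); left; exists hx.
  by exists (H i n (exist _ y hy)); right; exists i, y, hy.
- move=> n [x hx'] v v' /= [[hx ->]|[i [y [hy [e ->]]]]] [[hx1 ->]|[j [z [hz [e1 ->]]]]].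
  + by congr (f n _); apply: sub_ext.
  + rewrite /= in e1; subst x; symmetry; exact: H1.
  + rewrite /= in e; subst x; exact: H1.
  + rewrite /= in e e1; subst x.
    have [hS|nS] := pselect (S n (k i n y)).
      rewrite (H1 _ _ _ _ hS); have hS1 := hS; rewrite -e1 in hS1.
      by rewrite (H1 _ _ _ _ hS1); congr (f n _); apply: sub_ext.
    have ij := u1 _ _ _ _ _ hy hz nS (esym e1); subst j.
    have yz := u2 _ _ _ _ hy hz nS (esym e1); subst z.
    by congr (H i n _); apply: sub_ext.
- move=> m n a x v [[hx ->]|[i [y [hy [e ->]]]]].
    left; exists (sc_act a hx); rewrite -smap_nat.
    by congr (f m _); apply: sub_ext.
  right; exists i, (sact a y), (sc_act a hy); split; first by rewrite smap_nat e.
  by rewrite -smap_nat; congr (H i m _); apply: sub_ext.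
exists h; split=> [n x hx hx'|n x].
  case: (hP n (exist _ x hx')) => /= [[hx1 ->]|[i [y [hy [e ->]]]]].
    by congr (f n _); apply: sub_ext.
  by subst x; rewrite (H1 _ _ _ _ hx).
case: (hP n x) => [[hx ->]|[i [y [hy [e ->]]]]]; first by rewrite fg.
by rewrite H2 /= e.
Qed.

Lemma lifts_chain (T : sset) (S : nat -> subc T) :
  (forall r n x, S r n x -> S r.+1 n x) ->
  (forall r, lifts (S r) (S r.+1)) -> lifts (S 0) (unionc S).
Proof.
move=> sub1 L f g fg.
pose ok r := {h : smap (sub (S r)) P | forall n x, p n (h n x) = g n (sval x)}.
have step r (h : ok r) : exists h' : ok r.+1, forall n x (hx : S r n x) (hx' : S r.+1 n x),
    sval h' n (exist _ x hx') = sval h n (exist _ x hx).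
  by case: h => h hg; have [h' [h1 h2]] := L r h g hg; exists (exist _ h' h2).
pose fix H r : ok r := if r is r'.+1 then sval (cid (step r' (H r'))) else exist _ f fg.
have HS r n x hx hx' : sval (H r.+1) n (exist _ x hx') = sval (H r) n (exist _ x hx).
  exact: (svalP (cid (step r (H r)))).
have mon r s n x : S r n x -> S (r + s) n x.
  by move=> hx; elim: s => [|s IH]; rewrite ?addn0 // addnS; apply: sub1.
have Hrs s r n x (hx : S r n x) (hx' : S (r + s) n x) :
    sval (H (r + s)) n (exist _ x hx') = sval (H r) n (exist _ x hx).
  elim: s hx' => [|s IH]; rewrite ?addn0 => hx'.
    by congr (sval (H r) n _); apply: sub_ext.
  move: hx'; rewrite addnS => hx'.
  by rewrite (HS _ _ _ (mon r s n x hx)) IH.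
have Hall r s n x (hx : S r n x) (hx' : S s n x) :
    sval (H r) n (exist _ x hx) = sval (H s) n (exist _ x hx').
  wlog rs : r s hx hx' / r <= s.
    by move=> W; have [/W-> //|/ltnW/W->] := leqP r s.
  by move: hx'; rewrite -(subnKC rs) => hx'; rewrite Hrs.
have [n x //|i j n x hi hj|h hP] :=
  @glue T P (unionc S) nat S (fun r => sval (H r)); first exact: Hall.
exists h; split=> [n x hx hx'|n [x hx']]; first by rewrite (hP 0).
by case: (hx') => r hx; rewrite (hP r n x hx) (svalP (H r)).
Qed.

Lemma lifts_iso (T T' : sset) (phi : smap T T') (psi : smap T' T) (S S' : subc T') :
  (forall n x, psi n (phi n x) = x) -> (forall n x, phi n (psi n x) = x) ->
  lifts (preimc phi S) (preimc phi S') -> lifts S S'.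
Proof.
move=> psiK phiK L f g fg.
have nat m n (a : op m.+1 n.+1) (y : sub (preimc phi S) n) :
    f m (exist _ (phi m (sval (sact a y))) (svalP (sact a y)))
    = sact a (f n (exist _ (phi n (sval y)) (svalP y))).
  by rewrite -smap_nat; congr (f m _); apply: sub_ext; rewrite /= smap_nat.
have [n x|h [h1 h2]] := L (SMap nat) (scomp g phi); first by rewrite fg.
have S'psi n (y : sub S' n) : preimc phi S' n (psi n (sval y)).
  by rewrite /= phiK; apply: svalP.
have nat' m n (a : op m.+1 n.+1) (y : sub S' n) :
    h m (exist _ (psi m (sval (sact a y))) (S'psi _ (sact a y)))
    = sact a (h n (exist _ (psi n (sval y)) (S'psi _ y))).
  by rewrite -smap_nat; congr (h m _); apply: sub_ext; rewrite /= smap_nat.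
exists (SMap nat'); split=> [n x hx hx'|n x] /=; last by rewrite h2 /= phiK.
have hp : preimc phi S n (psi n x) by rewrite /= phiK.
by rewrite (h1 _ _ hp) /=; congr (f n _); apply: sub_ext; rewrite /= phiK.
Qed.
End Lifting.

(** * Skeletal induction *)

Definition surj p q (a : op p q) : Prop := forall j, exists i, a i = j.

Lemma nsurj_misses p q (a : op p q) : ~ surj a -> exists j, misses a j.
Proof.
move/existsNP => [j /forallNP h]; exists j; apply/forallP => i.
by apply/eqP; apply: h.
Qed.

Lemma misses_nsurj p q (a : op p q) j : misses a j -> ~ surj a.
Proof. by move=> /forallP aj /(_ j) [i ai]; have := aj i; rewrite ai eqxx. Qed.

Lemma coface_factor p q (a : op p q.+1) j :
  misses a j -> exists a' : op p q, a = op_comp (coface j) a'.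
Proof.
move=> /forallP aj.
have lt i : unbump j (a i) < q.
  have := aj i; have := ltn_ord (a i); have := ltn_ord j.
  by rewrite -val_eqE /= /unbump; case: ltnP => /=; lia.
have mono : {homo (fun i => Ordinal (lt i)) : i k / i <= k}.
  move=> i k ik /=; have := op_le a ik; have := aj i; have := aj k.
  by rewrite -!val_eqE /= /unbump; case: ltnP => /=; case: ltnP => /=; lia.
exists (mk_op mono); apply: op_ext => i.
have := aj i; rewrite op_compE !mk_opE -val_eqE /= /bump /unbump.
by case: (ltnP j (a i)) => /=; case: leqP => /=; lia.
Qed.

(** The section can be made to pass through any prescribed point i0. Letting i0 vary, the sections
    of a surjection determine it; [nd_uniq] relies on this. *)
Lemma surj_section p q (a : op p q) (i0 : 'I_p) : surj a ->
  exists b : op q p, op_comp a b = op_id q /\ b (a i0) = i0.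
Proof.
move=> sa.
have ex j : exists i, a i = j /\ (j = a i0 -> i = i0).
  have [->|ne] := eqVneq j (a i0); first by exists i0.
  by have [i ai] := sa j; exists i; split=> // e; rewrite e eqxx in ne.
pose f j := sval (cid (ex j)).
have fP j : a (f j) = j by case: (svalP (cid (ex j))).
have fm : {homo f : i j / i <= j}.
  move=> i j ij; rewrite leqNgt; apply/negP => lt.
  have := op_le a (ltnW lt); rewrite !fP => ji.
  have e : i = j by apply/val_inj/eqP; rewrite eqn_leq ij.
  by rewrite e ltnn in lt.
exists (mk_op fm); split; first by apply: op_ext => j; rewrite op_compE mk_opE fP op_idE.
by rewrite mk_opE; case: (svalP (cid (ex (a i0)))) => _; apply.
Qed.

Lemma surj_le p q (a : op p q) (i : 'I_p) : surj a -> a i <= i.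
Proof.
move=> sa; case: i => i; elim: i => [|i IH] ip.
  have q0 : 0 < q by apply: leq_ltn_trans (ltn_ord (a (Ordinal ip))).
  have [j aj] := sa (Ordinal q0).
  have : Ordinal ip <= j by [].
  by move/(op_le a); rewrite aj.
have := IH (ltnW ip); set x := a _ => xi.
rewrite leqNgt; apply/negP => lt.
have xq : x.+1 < q by apply: leq_ltn_trans (ltn_ord (a (Ordinal ip))) => /=; move: lt xi => /=; lia.
have [j aj] := sa (Ordinal xq).
have [ji|ij] := leqP j i.
  have : j <= Ordinal (ltnW ip) by [].
  by move/(op_le a); rewrite aj /= -/x ltnn.
have : Ordinal ip <= j by [].
move/(op_le a); rewrite aj /= => h; move: lt h xi => /=; lia.
Qed.

(** A surjection satisfies a i <= i. A section b through i is injective, hence surjective, and the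
    same bound for b gives i = b (a i) <= a i. *)
Lemma surj_id p (a : op p p) : surj a -> a = op_id p.
Proof.
move=> sa; apply: op_ext => i; rewrite op_idE.
apply/eqP; rewrite eqn_leq surj_le //=.
have [b [ab bi]] := surj_section i sa.
have sb : surj b.
  have inj : injective b.
    by move=> x y /(congr1 a); rewrite -!op_compE ab !op_idE.
  by move=> j; exists (invF inj j); rewrite f_invF.
by rewrite -{1}bi surj_le.
Qed.

Section Skeleton.
Variable V : sset.
Implicit Types m n r : nat.

(** The bound is strict, so [skel r] is the (r-1)-skeleton and [skel 0] is empty; a chain of
    attachments can start there. *)
Definition in_skel r n (x : V n) : Prop :=
  exists m (a : op n.+1 m.+1) (z : V m), m < r /\ x = sact a z.

Lemma in_skel_act r m n (a : op m.+1 n.+1) (x : V n) :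
  in_skel r x -> in_skel r (sact a x).
Proof.
by case=> k [b [z [kr ->]]]; exists k, (op_comp b a), z; rewrite sact_comp.
Qed.

Definition skel r : subc V := Subc (@in_skel_act r).

Definition nd r (z : V r) : Prop := ~ in_skel r z.

Lemma nsurj_skel r n (a : op n.+1 r.+1) (z : V r) :
  ~ surj a -> in_skel r (sact a z).
Proof.
case/nsurj_misses => j; case: r a j z => [|r] a j z.
  by move=> /forallP /(_ ord0); rewrite [a _]ord1 [j]ord1.
by case/coface_factor => a' ->; exists r, a', (sact (coface j) z); rewrite sact_comp.
Qed.

Lemma nd_surj_skel r n (a : op n.+1 r.+1) (z : V r) :
  nd z -> surj a -> ~ in_skel r (sact a z).
Proof.
move=> ndz sa; have [b [ab _]] := surj_section ord0 sa.
by move/(in_skel_act b); rewrite -sact_comp ab sact_id.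
Qed.

(** The uniqueness half of the Eilenberg-Zilber lemma. A section of a is also a section of a', since
    otherwise z would come from a lower dimension; as sections of a pass through every point, a'
    equals a. *)
Lemma nd_uniq r n (a a' : op n.+1 r.+1) (z z' : V r) : nd z -> nd z' ->
  surj a -> surj a' -> sact a z = sact a' z' -> z = z' /\ a = a'.
Proof.
move=> ndz ndz' sa sa' e.
have key b : op_comp a b = op_id r.+1 -> op_comp a' b = op_id r.+1.
  move=> ab; apply: surj_id.
  have [//|ns] := pselect (surj (op_comp a' b)).
  case: ndz; rewrite -[z]sact_id -ab sact_comp e -sact_comp; exact: nsurj_skel.
split.
  have [b [ab _]] := surj_section ord0 sa.
  by rewrite -[z]sact_id -ab sact_comp e -sact_comp key // sact_id.
apply: op_ext => i; have [b [ab bi]] := surj_section i sa.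
have := congr1 (fun c : op _ _ => c (a i)) (key _ ab).
by rewrite /= op_compE op_idE bi => ->.
Qed.
End Skeleton.

Section SkelLifts.
Variables (P Q : sset) (p : smap P Q) (T V : sset) (phi : smap T V).
Variables (S S' : subc T).
Variables (K : forall m, V m -> sset) (k : forall m (z : V m), smap (K z) T).
Variable psi : forall m (z : V m), smap (K z) (simplex m).

Lemma nsurjc_subproof m (z : V m) l n (b : op l.+1 n.+1) (y : K z n) :
  ~ surj (psi z n y) -> ~ surj (psi z l (sact b y)).
Proof.
move=> ns s; apply: ns => j; have [i <-] := s j.
by rewrite smap_nat /= op_compE; exists (b i).
Qed.
Definition nsurjc m (z : V m) : subc (K z) := Subc (@nsurjc_subproof m z).

(* [S'] is built from [S] over the skeleta of [V], so it suffices to lift in the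
   pullbacks [K z] of [phi] along the nondegenerate simplices [z] of [V]. *)
Lemma skel_lifts :
  (forall n x, S n x -> S' n x) ->
  (forall m (z : V m) n y, phi n (k z n y) = sact (psi z n y : op _ _) z) ->
  (forall m (z : V m) n (x : T n) (a : op n.+1 m.+1), phi n x = sact a z ->
     exists y, k z n y = x /\ psi z n y = a) ->
  (forall m (z : V m) n (y y' : K z n), k z n y = k z n y' ->
     psi z n y = psi z n y' -> y = y') ->
  (forall m (z : V m), nd z ->
     lifts p (andc (orc (preimc (k z) S) (nsurjc z)) (preimc (k z) S'))
       (preimc (k z) S')) ->
  lifts p S S'.
Proof.
move=> SS' kphi ex uq L.
(* Stage r contains what lies over the simplices of [V] of dimension below r. What is new at the
   next stage lies over exactly one nondegenerate r-simplex, by [nd_uniq]. *)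
pose F r := orc S (andc S' (preimc phi (skel V r))).
have F0 : F 0 = S.
  apply: subc_ext => n x; split; last by left.
  by case=> // -[_ [m [a [z []]]]].
have FU : unionc F = S'.
  apply: subc_ext => n x; split; first by case=> r [/SS'|[]].
  move=> hx; exists n.+1; right; split=> //=.
  by exists n, (op_id n.+1), (phi n x); rewrite sact_id.
rewrite -F0 -FU; apply: lifts_chain => r.
  move=> n x [|[hx [m [a [z [mr e]]]]]]; first by left.
  by right; split=> //; exists m, a, z; split=> //; lia.
pose I := {z : V r | nd z}.
apply: (@attach P Q p T _ _ I (fun i => K (sval i)) (fun i => k (sval i))
  (fun i => andc (orc (preimc (k (sval i)) S) (nsurjc (sval i))) (preimc (k (sval i)) S'))
  (fun i => preimc (k (sval i)) S')).
- move=> i n y hy; right; split=> //=; rewrite kphi.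
  by exists r, (psi (sval i) n y), (sval i).
- by move=> i n y [].
- move=> i n y hy; split.
    case=> -[h|h] _; first by left.
    by right; split=> //=; rewrite kphi; apply: nsurj_skel.
  case=> [h|[_ /= h]]; split=> //; first by left.
  right => s; rewrite kphi in h; exact: nd_surj_skel (svalP i) s h.
- move=> n x [h|[hx [m [a [z [mr e]]]]]]; first by left; left.
  have [hs|ns] := pselect (F r n x); [by left | right].
  have hm : m = r.
    apply/eqP; rewrite eqn_leq; apply/andP; split; first by lia.
    rewrite leqNgt; apply/negP => lt; apply: ns; right; split=> //.
    by exists m, a, z.
  subst m; have ndz : nd z.
    move=> h; apply: ns; right; split=> //=; rewrite e; exact: in_skel_act.
  have [y [ky _]] := ex _ _ _ _ _ e.
  by exists (exist _ z ndz), y; rewrite /= ky.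
- move=> i j n y z hy hz ns e.
  have eq : sact (psi (sval i) n y : op _ _) (sval i) = sact (psi (sval j) n z : op _ _) (sval j).
    by rewrite -!kphi e.
  have sP (i' : I) y' : preimc (k (sval i')) S' n y' ->
      ~ F r n (k (sval i') n y') -> surj (psi (sval i') n y').
    move=> hy' ns'; apply: contrapT => nsu; apply: ns'.
    by right; split=> //=; rewrite kphi; apply: nsurj_skel.
  have sy := sP _ _ hy ns.
  have sz : surj (psi (sval j) n z) by apply: sP => //; rewrite -e.
  have [ij _] := nd_uniq (svalP i) (svalP j) sy sz eq.
  by case: i j ij {sP y z hy hz ns e eq sy sz} => [i ?] [j ?] /= ij; apply: eq_exist.
- move=> i n y z hy hz ns e.
  have sP y' : preimc (k (sval i)) S' n y' ->
      ~ F r n (k (sval i) n y') -> surj (psi (sval i) n y').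
    move=> hy' ns'; apply: contrapT => nsu; apply: ns'.
    by right; split=> //=; rewrite kphi; apply: nsurj_skel.
  have sy := sP _ hy ns.
  have sz : surj (psi (sval i) n z) by apply: sP => //; rewrite -e.
  apply: (uq _ _ _ _ _ e).
  have eq : sact (psi (sval i) n y : op _ _) (sval i) = sact (psi (sval i) n z : op _ _) (sval i).
    by rewrite -!kphi e.
  by have [_] := nd_uniq (svalP i) (svalP i) sy sz eq.
- by move=> i; apply: L; apply: (svalP i).
Qed.
End SkelLifts.

Lemma hornc_subproof n (k : 'I_n.+1) l m (a : op l.+1 m.+1) (b : simplex n m) :
  in_horn k (b : op _ _) -> in_horn k (sact a b : op _ _).
Proof. exact: in_horn_act. Qed.
Definition hornc n (k : 'I_n.+1) : subc (simplex n) :=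
  @Subc (simplex n) (fun m b => in_horn k (b : op m.+1 n.+1)) (@hornc_subproof n k).
Lemma bndc_subproof n l m (a : op l.+1 m.+1) (b : simplex n m) :
  in_boundary (b : op _ _) -> in_boundary (sact a b : op _ _).
Proof. exact: in_boundary_act. Qed.
Definition bndc n : subc (simplex n) :=
  @Subc (simplex n) (fun m b => in_boundary (b : op m.+1 n.+1)) (@bndc_subproof n).

Lemma bndcP n m (b : simplex n m) : bndc n m b <-> ~ surj (b : op _ _).
Proof.
split=> [/existsP[j /misses_nsurj] //|/nsurj_misses[j bj]].
by apply/existsP; exists j.
Qed.

(** * Fibrations *)

(* Inner fibrations for [r = false], right fibrations for [r = true]. *)
Definition horn_fib (r : bool) (P Q : sset) (p : smap P Q) : Prop :=
  forall n (k : 'I_n.+1), 0 < k -> r || (k < n) ->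
  lifts p (hornc k) (fullc (simplex n)).

Definition tfib (P Q : sset) (p : smap P Q) : Prop :=
  forall n, lifts p (bndc n) (fullc (simplex n)).

(** [skel_lifts] with [phi] the identity: a nondegenerate simplex of S' outside S is attached along
    its whole boundary. *)
Lemma tfib_lifts (P Q : sset) (p : smap P Q) (T : sset) (S S' : subc T) :
  tfib p -> (forall n x, S n x -> S' n x) -> lifts p S S'.
Proof.
move=> tp SS'.
apply: (@skel_lifts _ _ p T T (sid T) S S' (fun m _ => simplex m)
  (fun m z => yoneda z) (fun m z => sid (simplex m))) => //.
- by move=> m z n x a /= e; exists a.
- move=> m z ndz.
  have [hz|nz] := pselect (S m z).
    apply: lifts_triv => n x h; split=> //; left => /=; exact: sc_act.
  have [hz'|nz'] := pselect (S' m z); last first.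
    apply: lifts_triv => n x h; split=> //.
    right => s; apply: nz'; have [b [ab _]] := surj_section ord0 s.
    by rewrite -[z]sact_id -ab sact_comp; apply: sc_act.
  have -> : preimc (yoneda z) S' = fullc (simplex m).
    by apply: subc_ext => n x; split=> // _; apply: sc_act.
  have -> : andc (orc (preimc (yoneda z) S) (nsurjc (fun m _ => sid (simplex m)) z))
      (fullc (simplex m)) = bndc m.
    apply: subc_ext => n x; split=> [[[h|h] _]|/bndcP h]; last by split=> //; right.
      apply/bndcP => s; apply: nz; have [b [ab _]] := surj_section ord0 s.
      by rewrite -[z]sact_id -ab sact_comp; apply: sc_act.
    exact/bndcP.
  exact: tp.
Qed.

(** * Anodyne extensions in a product of simplices *)

Section Grid.
Variables M N : nat.
Notation G := ('I_M.+1 * 'I_N.+1)%type.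
Notation T := (sprod (simplex M) (simplex N)).
Implicit Types (g h : G) (D E : {set G}).

Definition gle g h : bool := (g.1 <= h.1) && (g.2 <= h.2).
Definition gpt n (x : T n) (i : 'I_n.+1) : G :=
  ((x.1 : op _ _) i, (x.2 : op _ _) i).
Definition gim n (x : T n) : {set G} := [set gpt x i | i : 'I_n.+1].
Definition chain D : Prop := {in D &, forall g h, gle g h || gle h g}.

Lemma gle_refl g : gle g g. Proof. by rewrite /gle !leqnn. Qed.
Lemma gle_anti g h : gle g h -> gle h g -> g = h.
Proof.
case: g h => [a b] [c d]; rewrite /gle /= => /andP[ac bd] /andP[ca db].
by congr pair; apply/val_inj/eqP; rewrite eqn_leq ?ac ?ca ?bd ?db.
Qed.

Lemma gpt_mono n (x : T n) (i j : 'I_n.+1) : i <= j -> gle (gpt x i) (gpt x j).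
Proof.
move=> ij; apply/andP; split; first exact: (op_le (x.1 : op _ _) ij).
exact: (op_le (x.2 : op _ _) ij).
Qed.

Lemma gim_chain n (x : T n) : chain (gim x).
Proof.
move=> g h /imsetP[i _ ->] /imsetP[j _ ->].
by have [ij|/ltnW ij] := leqP i j; apply/orP; [left | right]; apply: gpt_mono.
Qed.

Lemma gim_mem n (x : T n) i : gpt x i \in gim x. Proof. exact: imset_f. Qed.

Lemma gpt_act m n (a : op m.+1 n.+1) (x : T n) i : gpt (sact a x) i = gpt x (a i).
Proof. by rewrite /gpt /= !op_compE. Qed.

Lemma gim_act m n (a : op m.+1 n.+1) (x : T n) : gim (sact a x) \subset gim x.
Proof. by apply/subsetP => g /imsetP[i _ ->]; rewrite gpt_act gim_mem. Qed.

Lemma chain_sub D E : D \subset E -> chain E -> chain D.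
Proof. by move=> /subsetP DE cE g h /DE gE /DE hE; apply: cE. Qed.

Lemma gpt_ext n (x y : T n) : (forall i, gpt x i = gpt y i) -> x = y.
Proof.
case: x y => [a b] [c d] e; congr pair; apply: op_ext => i.
  by have := e i; case=> ->.
by have := e i; case=> _ ->.
Qed.

Lemma chain_enum D : chain D -> D != set0 ->
  exists n (z : T n), injective (gpt z) /\ gim z = D.
Proof.
move=> cD /set0Pn[g0 g0D].
(* On a chain, [gle] is the order by coordinate sum, and the latter is total on the whole grid, so
   it can be used for sorting. *)
pose hle (g h : G) := g.1 + g.2 <= h.1 + h.2.
pose s := sort hle (enum D).
have ms g : (g \in s) = (g \in D) by rewrite mem_sort mem_enum.
have us : uniq s by rewrite sort_uniq enum_uniq.
have ss : sorted hle s by apply: sort_sorted => g h; rewrite /hle; apply: leq_total.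
have s0 : 0 < size s.
  by rewrite lt0n size_eq0; apply/eqP => e; have := ms g0; rewrite e g0D.
have sz : size s = (size s).-1.+1 by rewrite prednK.
move: (size s).-1 sz => n sz.
have mono (i j : 'I_n.+1) : i <= j -> gle (nth g0 s i) (nth g0 s j).
  move=> ij.
  have lei : i < size s by rewrite sz.
  have lej : j < size s by rewrite sz.
  have : hle (nth g0 s i) (nth g0 s j).
    by apply: (@sorted_leq_nth _ hle) => // [g h k|g]; rewrite /hle; lia.
  have := cD (nth g0 s i) (nth g0 s j); rewrite -!ms !mem_nth // => /(_ isT isT).
  by rewrite /gle /hle; lia.
have m1 : {homo (fun i : 'I_n.+1 => (nth g0 s i).1) : i j / i <= j}.
  by move=> i j /mono/andP[].
have m2 : {homo (fun i : 'I_n.+1 => (nth g0 s i).2) : i j / i <= j}.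
  by move=> i j /mono/andP[].
exists n, (mk_op m1, mk_op m2).
have e i : gpt ((mk_op m1, mk_op m2) : T n) i = nth g0 s i.
  by rewrite /gpt /= !mk_opE; case: (nth g0 s i).
split.
  move=> i j; rewrite !e => /eqP.
  by rewrite nth_uniq ?sz // => /eqP/val_inj.
apply/setP => g; rewrite -ms; apply/imsetP/idP => [[i _ ->]|gs].
  by rewrite e mem_nth // sz.
have ig : index g s < n.+1 by rewrite -sz index_mem.
by exists (Ordinal ig); rewrite // e nth_index.
Qed.

Lemma gim_factor m n (x : T m) (z : T n) : injective (gpt z) ->
  gim x \subset gim z -> exists a : op m.+1 n.+1, sact a z = x.
Proof.
move=> iz /subsetP xz.
have ex i : exists j, gpt z j = gpt x i.
  by have /imsetP[j _ ->] := xz _ (gim_mem x i); exists j.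
pose f i := sval (cid (ex i)).
have fP i : gpt z (f i) = gpt x i := svalP (cid (ex i)).
have fm : {homo f : i j / i <= j}.
  move=> i j ij; rewrite leqNgt; apply/negP => lt.
  have l1 := gpt_mono z (ltnW lt); have l2 := gpt_mono x ij.
  rewrite -!fP in l2; have e := iz _ _ (gle_anti l2 l1).
  by rewrite e ltnn in lt.
by exists (mk_op fm); apply: gpt_ext => i; rewrite gpt_act mk_opE fP.
Qed.

Lemma act_inj m n (z : T n) (a b : op m.+1 n.+1) : injective (gpt z) ->
  sact a z = sact b z -> a = b.
Proof.
move=> iz e; apply: op_ext => i; congr nat_of_ord; apply: iz.
by rewrite -!gpt_act e.
Qed.

Lemma gim_inj m n (x : T m) (z : T n) : injective (gpt x) -> injective (gpt z) ->
  gim x = gim z -> existT (fun n => T n) m x = existT (fun n => T n) n z.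
Proof.
move=> ix iz e.
have mn : m = n.
  have := congr1 (fun D : {set G} => #|D|) e.
  by rewrite !card_imset // !card_ord => -[].
subst m; have [|a az] := gim_factor (x := x) iz; first by rewrite e.
have sa : surj a.
  move=> j; have := gim_mem z j; rewrite -e -az => /imsetP[i _].
  by rewrite gpt_act => /iz ->; exists i.
by rewrite -az (surj_id sa) sact_id.
Qed.

(* The nondegenerate simplices of T are the nonempty chains of the grid. The
   chains to be added are paired as D \ v D, D U v D, and attached in the order
   of [rho], each pair along the horn that omits the face opposite v D. *)
Section Pairing.
Variables (SS TT : {set G} -> Prop) (v : {set G} -> G) (mu : {set G} -> nat) (r : bool).
Variable Bd : nat.
Definition adm D := [/\ chain D, TT D & ~ SS D].
Hypothesis SSd : forall D E, D \subset E -> SS E -> SS D.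
Hypothesis TTd : forall D E, D \subset E -> TT E -> TT D.
Hypothesis muB : forall D, mu D <= Bd.
Hypothesis vU : forall D, adm D -> v (v D |: D) = v D.
Hypothesis vD : forall D, adm D -> v (D :\ v D) = v D.
Hypothesis muU : forall D, adm D -> mu (v D |: D) = mu D.
Hypothesis muD : forall D, adm D -> mu (D :\ v D) = mu D.
Hypothesis chainU : forall D, adm D -> chain (v D |: D).
Hypothesis TTU : forall D, adm D -> TT (v D |: D).
Hypothesis SSD : forall D, adm D -> ~ SS (D :\ v D).
Hypothesis vlow : forall D, adm D -> exists2 g, g \in D & ~~ gle (v D) g.
Hypothesis vhigh : forall D, adm D -> r \/ exists2 g, g \in D & ~~ gle g (v D).
Hypothesis mu_lt : forall E w, adm E -> v E \in E -> w \in E -> w != v E ->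
  ~ SS (E :\ w) -> v (E :\ w) \notin E :\ w -> mu (E :\ w) < mu E.

(** The lexicographic order of (size of the larger member of the pair, [mu]), coded as one number;
    [Bd] bounds [mu]. *)
Definition rho D := #|v D |: D| * Bd.+1 + mu D.

Lemma adm_sub D E : D \subset E -> ~ SS D -> adm E -> adm D.
Proof. by move=> DE nD [cE tE _]; split=> //; [apply: chain_sub cE | apply: TTd tE]. Qed.

Lemma rhoU D : adm D -> rho (v D |: D) = rho D.
Proof. by move=> aD; rewrite /rho vU // muU // setUA setUid. Qed.

Lemma setDU1 (D : {set G}) w : w |: (D :\ w) = w |: D.
Proof. by apply/setP => g; rewrite !inE; case: eqP. Qed.

Lemma rhoD D : adm D -> rho (D :\ v D) = rho D.
Proof. by move=> aD; rewrite /rho vD // muD // setDU1. Qed.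

(** The first component drops, unless [E] is the larger member of its pair and [E :\ w] the smaller
    member of its own; then [mu_lt] decides. *)
Lemma rho_lt E w : adm E -> w \in E -> w != v E -> ~ SS (E :\ w) ->
  rho (E :\ w) < rho E.
Proof.
move=> aE wE wv nS; rewrite /rho.
have m1 := muB (E :\ w); have m2 := muB E.
have c1 : #|E| = #|E :\ w|.+1 by rewrite (cardsD1 w) wE.
have [vE|vE] := boolP (v E \in E); rewrite !cardsU1 vE c1.
  have [h|h] := boolP (v (E :\ w) \in E :\ w); last first.
    by rewrite /= add1n add0n ltn_add2l; apply: mu_lt.
  rewrite /= !add0n mulSn; move: (_ * _) (mu _) (mu _) m1 m2 => a b c; lia.
rewrite /= add1n !mulSn.
by case: (_ \notin _); rewrite /= ?add1n ?add0n ?mulSn;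
  move: (_ * _) (mu _) (mu _) m1 m2 => a b c; lia.
Qed.

Lemma rho_le E w : adm E -> w \in E -> ~ SS (E :\ w) -> rho (E :\ w) <= rho E.
Proof.
move=> aE wE nS; have [->|ne] := eqVneq w (v E); first by rewrite rhoD.
exact/ltnW/rho_lt.
Qed.

Lemma rho_mono D E : adm E -> D \subset E -> ~ SS D -> rho D <= rho E.
Proof.
move: {2}#|E :\: D| (leqnn #|E :\: D|) => c; elim: c E => [|c IH] E cE aE DE nD.
  have ED : E \subset D by rewrite -setD_eq0 -cards_eq0 -leqn0.
  by have -> : D = E by apply/eqP; rewrite eqEsubset DE.
have [ED|] := boolP (E \subset D).
  by have -> : D = E by apply/eqP; rewrite eqEsubset DE.
case/subsetPn => w wE wD.
have DEw : D \subset E :\ w by rewrite subsetD1 DE.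
have nS : ~ SS (E :\ w) by move/(SSd DEw).
apply: leq_trans (rho_le aE wE nS); apply: IH => //.
  have e : (E :\ w) :\: D = (E :\: D) :\ w by apply/setP => g; rewrite !inE andbCA.
  have wED : w \in E :\: D by rewrite !inE wE wD.
  by move: cE; rewrite e (cardsD1 w (E :\: D)) wED.
apply: adm_sub aE => //; exact: subD1set.
Qed.


Lemma rhoc_subproof s m n (a : op m.+1 n.+1) (x : T n) :
  TT (gim x) /\ (SS (gim x) \/ rho (gim x) < s) ->
  TT (gim (sact a x)) /\ (SS (gim (sact a x)) \/ rho (gim (sact a x)) < s).
Proof.
move=> [tx sx]; split; first exact: TTd (gim_act a x) tx.
have [h|h] := pselect (SS (gim (sact a x))); [by left | right].
case: sx => [/(SSd (gim_act a x)) //|]; apply: leq_ltn_trans.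
apply: (rho_mono _ (gim_act a x) h); split=> //; first exact: gim_chain.
by move=> hx; apply: h; apply: SSd (gim_act a x) hx.
Qed.
Definition rhoc s : subc T := Subc (@rhoc_subproof s).

Variables (P Q : sset) (p : smap P Q).
Hypothesis hp : horn_fib r p.
Variables S S' : subc T.
Hypothesis SE : forall n (x : T n), S n x <-> TT (gim x) /\ SS (gim x).
Hypothesis S'E : forall n (x : T n), S' n x <-> TT (gim x).

(** A pair of rank s, recorded by its larger member [czs] and the position [cv] of the paired vertex
    in it. The smaller member is the face opposite [cv]. *)
Record pcell s := PCell { cdim : nat; czs : T cdim; cadm : adm (gim czs);
  cinj : injective (gpt czs); crho : rho (gim czs) = s; cv : 'I_cdim.+1;
  cvP : gpt czs cv = v (gim czs) }.

Lemma pcell_eq s (c c' : pcell s) : gim (czs c) = gim (czs c') -> c = c'.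
Proof.
move=> e; have := gim_inj (@cinj _ c) (@cinj _ c') e.
case: c c' e => [n z az iz rz k kP] [n' z' az' iz' rz' k' kP'] /= e E.
have nn : n = n' := congr1 (@projT1 _ _) E; subst n'.
have zz : z = z' := existT_inj E.
subst z'; have kk : k = k' by apply: iz; rewrite kP kP'.
subst k'; rewrite (Prop_irrelevance az az') (Prop_irrelevance iz iz').
by rewrite (Prop_irrelevance rz rz') (Prop_irrelevance kP kP').
Qed.

Lemma grid_lifts : lifts p S S'.
Proof.
have -> : S = rhoc 0.
  apply: subc_ext => n x; rewrite SE /=.
  by split=> [[h1 h2]|[h1 [|//]]]; split=> //; left.
have -> : S' = unionc rhoc.
  apply: subc_ext => n x; rewrite S'E /=; split=> [h|[s []//]].
  by exists (rho (gim x)).+1; split=> //; right.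
apply: lifts_chain => s.
  by move=> n x [h [h'|h']]; split=> //; [left | right; apply: ltnW].
(* A face of a cell is outside the horn at [cv] exactly if it contains all vertices but possibly the
   paired one ([NH]). Such a face is one of the two members of the pair, of rank s, hence not yet
   present ([NR]); the other faces have smaller rank or lie in [SS] ([HR]). *)
have NR (c : pcell s) m (a : simplex (cdim c) m) :
    v (gim (czs c)) |: gim (sact (a : op _ _) (czs c)) = gim (czs c) ->
    ~ rhoc s m (sact (a : op _ _) (czs c)).
  set E := gim (czs c); set D := gim _ => DE [_].
  have [cE tE nE] := cadm c.
  have EvD : E :\ v E \subset D.
    apply/subsetP => g; rewrite !inE => /andP[gv gE].
    by move: gE; rewrite -/E -DE !inE (negPf gv).
  have nEv := SSD (cadm c); rewrite -/E in nEv.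
  have aD : adm D.
    split; [exact: gim_chain | exact: TTd (gim_act _ _) tE |].
    by move/(SSd EvD).
  case=> [|lt]; first by case: aD.
  have rE : rho E = s := crho c; have := rho_mono aD EvD nEv.
  by rewrite rhoD ?rE; [rewrite leqNgt lt | exact: cadm].
have NH (c : pcell s) m (a : simplex (cdim c) m) :
    ~ hornc (cv c) m a -> v (gim (czs c)) |: gim (sact (a : op _ _) (czs c)) = gim (czs c).
  move=> nh; apply/setP => g; rewrite !inE; apply/orP/idP => [[/eqP ->|]|].
  - by rewrite -cvP gim_mem.
  - exact/subsetP/gim_act.
  case/imsetP => j _ ->; rewrite -cvP (inj_eq (@cinj _ c)).
  have [->|jk] := eqVneq j (cv c); [by left | right].
  have [i ai] : exists i, (a : op _ _) i = j.
    apply: contrapT => na; apply: nh; apply/existsP; exists j; rewrite jk /=.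
    by apply/forallP => i; apply/eqP => e; apply: na; exists i.
  by rewrite -ai -gpt_act gim_mem.
have HR (c : pcell s) m (a : simplex (cdim c) m) :
    hornc (cv c) m a <-> rhoc s m (sact (a : op _ _) (czs c)).
  split; last first.
    move=> h; apply: contrapT => /NH/NR; exact.
  case/existsP => j /andP[jk aj].
  have sub : gim (sact (a : op _ _) (czs c)) \subset gim (czs c) :\ gpt (czs c) j.
    rewrite subsetD1 gim_act /=; apply/imsetP => -[i _]; rewrite gpt_act.
    by move/(@cinj _ c) => e; have := forallP aj i; rewrite -e eqxx.
  have [cE tE nE] := cadm c.
  split; first exact: TTd (gim_act _ _) tE.
  have [h|h] := pselect (SS (gim (czs c) :\ gpt (czs c) j)); first by left; apply: SSd h.
  have [h'|h'] := pselect (SS (gim (sact (a : op _ _) (czs c)))); [by left | right].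
  apply: (@leq_trans (rho (gim (czs c)))); last by rewrite (crho c).
  apply: leq_ltn_trans (rho_lt (cadm c) (gim_mem _ j) _ h).
    by apply: rho_mono sub h'; apply: adm_sub (cadm c) => //; apply: subD1set.
  by rewrite -cvP (inj_eq (@cinj _ c)).
apply: (@attach P Q p T _ _ (pcell s) (fun c => simplex (cdim c))
  (fun c => yoneda (czs c)) (fun c => hornc (cv c)) (fun c => fullc _)) => //.
- move=> c n a _ /=; have [cE tE nE] := cadm c.
  split; first exact: TTd (gim_act _ _) tE.
  have [h|h] := pselect (SS (gim (sact (a : op _ _) (czs c)))); [by left | right].
  rewrite ltnS; apply: (@leq_trans (rho (gim (czs c)))); last by rewrite (crho c).
  by apply: rho_mono (gim_act _ _) h; apply: cadm.
- move=> n x [tx sx].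
  have [h|h] := pselect (rhoc s n x); [by left | right].
  have nS : ~ SS (gim x) by move=> hS; apply: h; split=> //; left.
  have rs : rho (gim x) = s.
    by case: sx => // sx; apply/eqP; rewrite eqn_leq -ltnS sx leqNgt; apply/negP => lt;
      apply: h; split=> //; right.
  have aD : adm (gim x) by split=> //; apply: gim_chain.
  have nS' : ~ SS (v (gim x) |: gim x) by move/(SSd (subsetUr _ _)).
  have [n' [z [iz ze]]] : exists n' (z : T n'), injective (gpt z) /\ gim z = v (gim x) |: gim x.
    apply: chain_enum; first exact: chainU.
    by apply/set0Pn; exists (v (gim x)); rewrite !inE eqxx.
  have az : adm (gim z) by rewrite ze; split=> //; [apply: chainU | apply: TTU].
  have rz : rho (gim z) = s by rewrite ze rhoU.
  have /imsetP[k _ kP] : v (gim x) \in gim z by rewrite ze !inE eqxx.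
  have kP' : gpt z k = v (gim z) by rewrite ze vU // kP.
  exists (PCell az iz rz kP') => /=.
  have [|a ax] := gim_factor (x := x) iz; first by rewrite ze subsetUr.
  by exists a.
- move=> c c' n a a' _ _ h e; apply: pcell_eq.
  have {}e : sact (a : op _ _) (czs c) = sact (a' : op _ _) (czs c') := e.
  have {}h : ~ rhoc s n (sact (a : op _ _) (czs c)) := h.
  have h' := h; rewrite e in h'.
  have E1 := NH c n a (fun hh => h (proj1 (HR c n a) hh)).
  have E2 := NH c' n a' (fun hh => h' (proj1 (HR c' n a') hh)).
  (* The paired vertex can be read off from either member of the pair, so two cells sharing a new
     face have the same vertices and coincide. *)
  have V1 (c1 : pcell s) (b : simplex (cdim c1) n) :
      ~ rhoc s n (sact (b : op _ _) (czs c1)) ->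
      v (gim (czs c1)) = v (gim (sact (b : op _ _) (czs c1))).
    move=> hb; have E3 := NH c1 n b (fun hh => hb (proj1 (HR c1 n b) hh)).
    have [vin|vout] := boolP (v (gim (czs c1)) \in gim (sact (b : op _ _) (czs c1))).
      by move: E3; rewrite (setUidPr _) ?sub1set // => ->.
    have -> : gim (sact (b : op _ _) (czs c1)) = gim (czs c1) :\ v (gim (czs c1)).
      by rewrite -{1}E3 setU1K.
    by rewrite vD //; apply: cadm.
  by rewrite -E1 -E2 (V1 c a h) (V1 c' a' h') e.
- by move=> c n a a' _ _ _; apply: act_inj; apply: cinj.
- move=> c; apply: hp.
  + have [g /imsetP[j _ ->]] := vlow (cadm c); rewrite -cvP => h.
    case: (posnP (cv c)) => // k0; case/negP: h; apply: gpt_mono; by rewrite k0.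
  + case: (vhigh (cadm c)) => [-> //|[g /imsetP[j _ ->]]]; rewrite -cvP => h.
    apply/orP; right; rewrite ltnNge; apply/negP => k0; case/negP: h; apply: gpt_mono.
    by apply: leq_trans k0; rewrite -ltnS.
Qed.
End Pairing.
End Grid.

(* A junk value when no [i] satisfies [A]. *)
Definition omax n (A : pred 'I_n.+1) : 'I_n.+1 := inord (\max_(i | A i) i).

Lemma eq_omax n (A B : pred 'I_n.+1) : A =1 B -> omax A = omax B.
Proof. by move=> AB; rewrite /omax (eq_bigl _ _ AB). Qed.

Lemma omaxP n (A : pred 'I_n.+1) i0 : A i0 ->
  A (omax A) /\ forall i, A i -> i <= omax A.
Proof.
move=> Ai0.
have [|i Ai e] := @eq_bigmax_cond _ A (fun i : 'I_n.+1 => i : nat).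
  by apply/card_gt0P; exists i0.
have E : omax A = i by rewrite /omax e inord_val.
by split=> [|j Aj]; rewrite E // -e; apply: (@leq_bigmax_cond _ A (fun i : 'I_n.+1 => i : nat)).
Qed.

(* A chain is paired through the point (k, i), for (k - 1, i) its last point in
   the column k - 1. *)
Section HornGrid.
Variables (n m : nat) (k : 'I_n.+1) (r : bool).
Hypotheses (k0 : 0 < k) (kn : r || (k < n)).
Notation G := ('I_n.+1 * 'I_m.+1)%type.
Implicit Types D E : {set G}.

Definition hg_SS D : Prop :=
  (exists i : 'I_m.+1, forall g, g \in D -> g.2 != i) \/
  (exists2 j, j != k & forall g, g \in D -> g.1 != j).

Lemma hg_k1_subproof : k.-1 < n.+1.
Proof. by have := ltn_ord k; lia. Qed.
Definition hg_k1 : 'I_n.+1 := Ordinal hg_k1_subproof.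
Definition hg_i0 D := omax (fun i => (hg_k1, i) \in D).
Definition hg_v D : G := (k, hg_i0 D).
Definition hg_mu D := #|[set g in D | g.1 == hg_k1]|.

Lemma hg_k1k : hg_k1 != k.
Proof. by rewrite -val_eqE /=; move: k0; case: (k : nat) => //= l _; rewrite neq_ltn ltnSn. Qed.

Lemma hg_adm D : ~ hg_SS D ->
  (forall i, exists j, (j, i) \in D) /\ (forall j, j != k -> exists i, (j, i) \in D).
Proof.
move=> nD; split=> [i|j jk]; apply: contrapT => h; apply: nD.
  left; exists i => -[j i'] gD; apply/eqP => /= e; subst i'.
  by apply: h; exists j.
right; exists j => // -[j' i] gD; apply/eqP => /= e; subst j'.
by apply: h; exists i.
Qed.

Lemma hg_i0P D : ~ hg_SS D -> (hg_k1, hg_i0 D) \in D /\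
  forall i, (hg_k1, i) \in D -> i <= hg_i0 D.
Proof.
move=> /hg_adm[_ /(_ _ hg_k1k)[i iD]].
exact: (@omaxP _ (fun i => (hg_k1, i) \in D) i).
Qed.

Lemma hg_vE D E : (forall i, ((hg_k1, i) \in D) = ((hg_k1, i) \in E)) ->
  hg_v D = hg_v E.
Proof. by move=> DE; rewrite /hg_v /hg_i0 (eq_omax DE). Qed.

Lemma hg_muE D E : (forall i, ((hg_k1, i) \in D) = ((hg_k1, i) \in E)) ->
  hg_mu D = hg_mu E.
Proof.
move=> DE; congr (#|pred_of_set _|); apply/setP => -[j i]; rewrite !inE /=.
by case: eqP => [->|]; rewrite ?andbF // DE.
Qed.

Lemma hg_rowU D i j : ((hg_k1, i) \in (k, j) |: D) = ((hg_k1, i) \in D).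
Proof. by rewrite !inE xpair_eqE (negPf hg_k1k). Qed.
Lemma hg_rowD D i j : ((hg_k1, i) \in D :\ (k, j)) = ((hg_k1, i) \in D).
Proof. by rewrite !inE xpair_eqE (negPf hg_k1k). Qed.

Lemma hg_SSd D E : D \subset E -> hg_SS E -> hg_SS D.
Proof.
move=> /subsetP DE [[i h]|[j jk h]]; [left; exists i | right; exists j] => // g /DE; exact: h.
Qed.

Variables (P Q : sset) (p : smap P Q).
Hypothesis hp : horn_fib r p.

Lemma horn_grid_lifts (S : subc (sprod (simplex n) (simplex m))) :
  (forall l (x : sprod (simplex n) (simplex m) l), S l x <-> hg_SS (gim x)) ->
  lifts p S (fullc _).
Proof.
move=> SE.
apply: (@grid_lifts n m hg_SS (fun _ => True) hg_v hg_mu r #|{: G}|) => //.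
- exact: hg_SSd.
- by move=> D; apply: max_card.
- by move=> D _; apply: hg_vE => i; apply: hg_rowU.
- by move=> D _; apply: hg_vE => i; apply: hg_rowD.
- by move=> D _; apply: hg_muE => i; apply: hg_rowU.
- by move=> D _; apply: hg_muE => i; apply: hg_rowD.
- move=> D [cD _ nD]; have [i0D i0m] := hg_i0P nD.
  have cmp g : g \in D -> gle g (hg_v D) || gle (hg_v D) g.
    move=> gD; case/orP: (cD _ _ gD i0D) => /andP[/= h1 h2].
      by apply/orP; left; rewrite /gle /= h2 andbT (leq_trans h1) //= leq_pred.
    have [lt|ge] := ltnP g.1 k; last by apply/orP; right; rewrite /gle /= ge h2.
    have e : g.1 = hg_k1.
      by apply/val_inj; move: lt h1 => /=; lia.
    have := i0m g.2; rewrite -e -surjective_pairing gD => /(_ isT) h.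
    by apply/orP; left; rewrite /gle /= h andbT; apply: ltnW.
  move=> g h; rewrite !inE => /orP[/eqP ->|gD] /orP[/eqP ->|hD].
  + by rewrite gle_refl.
  + by rewrite orbC cmp.
  + by rewrite cmp.
  + exact: cD.
- move=> D [cD _ nD]; have [i0D _] := hg_i0P nD; have [ex2 ex1] := hg_adm nD.
  case=> [[i h]|[j jk h]].
    have [j ji] := ex2 i; have [e|ne] := eqVneq (j, i) (hg_v D).
      have := h (hg_k1, hg_i0 D); rewrite hg_rowD i0D => /(_ isT) /=.
      by case: e => _ ->; rewrite eqxx.
    by have := h (j, i); rewrite !inE ne ji eqxx => /(_ isT).
  have [i ji] := ex1 j jk; have := h (j, i).
  by rewrite !inE ji andbT xpair_eqE (negPf jk) /= eqxx => /(_ isT).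
- move=> D [cD _ nD]; have [i0D _] := hg_i0P nD; exists (hg_k1, hg_i0 D) => //.
  by rewrite /gle /= negb_and -ltnNge; apply/orP; left; lia.
- move=> D [cD _ nD]; case/orP: kn => [->|lt]; [by left | right].
  have [_ ex1] := hg_adm nD.
  have k2 : k.+1 < n.+1 by [].
  have [|i ki] := ex1 (Ordinal k2); first by rewrite -val_eqE /= neq_ltn ltnSn orbT.
  by exists (Ordinal k2, i) => //; rewrite /gle /= negb_and -ltnNge ltnSn.
(* If w were outside the column k - 1, then [E :\ w] would have the same paired point as [E] and
   contain it, against [vw]. So w is in that column, whose points [hg_mu] counts. *)
- move=> E w [cE _ nE] vE wE wv nS vw.
  have wk : w.1 = hg_k1.
    apply/eqP; apply/negPn/negP => ne.
    have e : hg_v (E :\ w) = hg_v E.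
      apply: hg_vE => i; rewrite !inE; case: eqP => // e.
      by rewrite -e eqxx in ne.
    by move: vw; rewrite e !inE eq_sym wv vE.
  rewrite /hg_mu; have -> : [set g in E :\ w | g.1 == hg_k1] = [set g in E | g.1 == hg_k1] :\ w.
    by apply/setP => g; rewrite !inE andbA.
  by rewrite [X in _ < X](cardsD1 w) !inE wE wk eqxx.
- by move=> l x; rewrite SE; split=> [|[]].
Qed.
End HornGrid.

(** * Products of a horn inclusion with an arbitrary inclusion *)

Definition prodc n (k : 'I_n.+1) (V : sset) (U : subc V) : subc (sprod (simplex n) V) :=
  orc (preimc (spr1 _ _) (hornc k)) (preimc (spr2 _ _) U).

(** The pushout-product of a horn inclusion with U in V is filled over the nondegenerate simplices
    of V; for one of them outside U this is the pushout-product with a boundary, the case of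
    [horn_grid_lifts]. *)
Lemma prod_lifts r (P Q : sset) (p : smap P Q) n (k : 'I_n.+1) (V : sset) (U : subc V) :
  horn_fib r p -> 0 < k -> r || (k < n) -> lifts p (prodc k U) (fullc _).
Proof.
move=> hp k0 kn.
apply: (@skel_lifts _ _ p (sprod (simplex n) V) V (spr2 _ _) _ _
  (fun m _ => sprod (simplex n) (simplex m))
  (fun m z => sprod_map (sid _) (yoneda z)) (fun m _ => spr2 _ _)) => //.
- by move=> m z l [b y] a /= e; exists (b, a); rewrite /= -e.
- by move=> m z l [b a] [b' a'] /= [-> _] ->.
move=> m z ndz.
have [Uz|nU] := pselect (U m z).
  apply: lifts_triv => l x _; split=> //; left; right => /=; exact: sc_act.
have -> : preimc (sprod_map (sid _) (yoneda z)) (fullc (sprod (simplex n) V))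
    = fullc (sprod (simplex n) (simplex m)) by apply: subc_ext.
apply: (@horn_grid_lifts n m k r) => // l [b a].
have bh (c : op l.+1 n.+1) : in_horn k c <-> exists2 j, j != k & misses c j.
  split=> [/existsP[j /andP[]]|[j jk cj]]; first by exists j.
  by apply/existsP; exists j; rewrite jk.
split.
- case=> -[[/bh[j jk /forallP bj]|Ua]|/nsurj_misses[i /forallP ai]] _.
  + by right; exists j => // g /imsetP[i _ ->]; apply: bj.
  + left; have [sa|/nsurj_misses[i /forallP ai]] := pselect (surj (a : op _ _)).
      case: nU; have [c [ac _]] := surj_section ord0 sa.
      rewrite -[z]sact_id -ac sact_comp; exact: sc_act Ua.
    by exists i => g /imsetP[j _ ->]; apply: ai.
  + by left; exists i => g /imsetP[j _ ->]; apply: ai.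
- case=> [[i h]|[j jk h]]; split=> //.
    right; apply: (@misses_nsurj _ _ _ i); apply/forallP => j.
    exact: (h (gpt ((b, a) : sprod (simplex n) (simplex m) l) j) (gim_mem _ _)).
  left; left; apply/bh; exists j => //; apply/forallP => i.
  exact: (h (gpt ((b, a) : sprod (simplex n) (simplex m) l) i) (gim_mem _ _)).
Qed.

(** * Edges in a quasi-category *)

Lemma qcat_fib (A : sset) : quasi_category A -> horn_fib false (bang A).
Proof.
move=> qA n k k0 /= kn f g _.
have nat l m (a : op l.+1 m.+1) (x : horn k m) :
    f l (sact a x : horn k l) = sact a (f m x).
  by rewrite -smap_nat; congr (f l _); apply: sub_ext.
have [|h hP] := qA n k _ (@SMap (horn k) A (fun m (x : horn k m) => f m x) nat).
  by rewrite k0.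
exists (scomp h (incl _)); split=> [m x hx hx'|m x].
  exact: (hP m (exist _ x hx : horn k m)).
by apply: op_ext => i; rewrite !ord1.
Qed.

Lemma fib_qcat (A : sset) : horn_fib false (bang A) -> quasi_category A.
Proof.
move=> hA n k /andP[k0 kn] f.
have nat l m (a : op l.+1 m.+1) (x : sub (hornc k) m) :
    f l (sact a x : sub (hornc k) l) = sact a (f m x).
  by rewrite -smap_nat; congr (f l _); apply/val_inj.
have [|h [h1 _]] := hA n k k0 kn (@SMap (sub (hornc k)) A (fun m (x : sub _ m) => f m x) nat)
   (bang (simplex n)); first by move=> m x; apply: op_ext => i; rewrite !ord1.
have natf l m (a : op l.+1 m.+1) (x : simplex n m) :
    h l (exist _ (sact a x) I) = sact a (h m (exist _ x I)).
  by rewrite -smap_nat; congr (h l _); apply: sub_ext.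
exists (@SMap (simplex n) A (fun m x => h m (exist _ x I)) natf) => m x /=.
rewrite (h1 _ _ (svalP x)) /=; by congr (f m _); apply/val_inj.
Qed.

Lemma lifts_pt (A T : sset) (S S' : subc T) (f : smap (sub S) A) :
  lifts (bang A) S S' -> exists h : smap (sub S') A,
  forall n x (hx : S n x) (hx' : S' n x), h n (exist _ x hx') = f n (exist _ x hx).
Proof.
move=> L; have [|h [h1 _]] := L f (bang T); last by exists h.
by move=> n x; apply: op_ext => i; rewrite !ord1.
Qed.

Lemma full_smap_subproof (T P : sset) (h : smap (sub (fullc T)) P) l m
    (a : op l.+1 m.+1) (x : T m) :
  h l (exist _ (sact a x) I) = sact a (h m (exist _ x I)).
Proof. by rewrite -smap_nat; congr (h l _); apply: sub_ext. Qed.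
Definition full_smap (T P : sset) (h : smap (sub (fullc T)) P) : smap T P :=
  SMap (@full_smap_subproof T P h).

Lemma lifts_full (P Q : sset) (p : smap P Q) (T : sset) (S : subc T)
    (f : smap (sub S) P) (g : smap T Q) :
  lifts p S (fullc T) -> (forall n x, p n (f n x) = g n (sval x)) ->
  exists h : smap T P, (forall n x (hx : S n x), h n x = f n (exist _ x hx))
    /\ (forall n x, p n (h n x) = g n x).
Proof.
move=> L /L[h [h1 h2]]; exists (full_smap h); split=> [n x hx|n x] /=; last by rewrite h2.
exact: h1.
Qed.

(** * Exponentials *)

Section Uncurry.
Variables (Z X A : sset) (F : smap Z (sexp A X)).
Definition uncurry_fun n (x : sprod Z X n) : A n := F n x.1 n (op_id n.+1, x.2).
Lemma uncurryE m n (a : op m.+1 n.+1) (z : Z n) (x : X m) :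
  F n z m (a, x) = uncurry_fun (sact a z, x).
Proof. by rewrite /uncurry_fun /= smap_nat /= op_comp1. Qed.
Lemma uncurry_subproof m n (a : op m.+1 n.+1) (x : sprod Z X n) :
  uncurry_fun (sact a x) = sact a (uncurry_fun x).
Proof.
case: x => z x; rewrite -uncurryE /uncurry_fun -smap_nat /=.
by rewrite op_1comp.
Qed.
Definition uncurry : smap (sprod Z X) A := SMap uncurry_subproof.
End Uncurry.


(** A horn in A^Y transposes to a map on horn x Y, which is [prod_lifts] with [U] empty. *)
Lemma exp_qcat (A Y : sset) : quasi_category A -> quasi_category (sexp A Y).
Proof.
move=> /qcat_fib hA; apply: fib_qcat => n k k0 kn f g _.
pose S := prodc k (emptyc Y).
have Sh m (x : sub S m) : hornc k m (sval x).1 by case: (svalP x).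
have nat l m (a : op l.+1 m.+1) (x : sub S m) :
    uncurry f l (exist _ (sval (sact a x)).1 (Sh _ (sact a x)), (sval (sact a x)).2)
    = sact a (uncurry f m (exist _ (sval x).1 (Sh _ x), (sval x).2)).
  rewrite -smap_nat; congr (uncurry f l _); congr pair; exact: sub_ext.
have [h hP] := @lifts_pt A _ S (fullc _) (SMap nat) (@prod_lifts false _ _ (bang A) n k Y (emptyc Y) hA k0 kn).
pose H : sexp A Y n := full_smap h.
exists (scomp (yoneda H) (incl _)); split=> [m x hx hx'|m x]; last first.
  by apply: op_ext => i; rewrite !ord1.
apply: smap_ext => l [b y] /=.
have hb : S l (op_comp (x : op _ _) b, y) by left; apply: in_horn_act.
rewrite (hP _ _ hb) /= uncurryE; congr (uncurry f l _); congr pair.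
exact: sub_ext.
Qed.

(** * The homotopy category of a quasi-category, by edges *)

Section Horns.
Variable B : sset.

(** With indices in nat the simplicial identities become arithmetic; the value is meaningful only
    for i < n.+2, the range of [inord]. *)
Definition fc n (i : nat) (s : B n.+1) : B n := face (inord i : 'I_n.+2) s.

Lemma faceE n (i : 'I_n.+2) (s : B n.+1) : face i s = fc i s.
Proof. by rewrite /fc inord_val. Qed.

Lemma fc_fc n i j (t : B n.+2) : i < j -> j < n.+3 ->
  fc i (fc j t) = fc j.-1 (fc i t).
Proof.
move=> ij jn; rewrite /fc /face -!sact_comp; congr (sact _ t).
apply: op_ext => x; rewrite !op_compE !mk_opE /=.
by rewrite !inordK //; try lia; rewrite /bump; do 4!case: leqP => /=; lia.
Qed.

Lemma horn_fill n k (s : nat -> B n.+1) : quasi_category B -> 0 < k < n.+2 ->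
  (forall i j, i < j -> j < n.+3 -> i != k -> j != k -> fc i (s j) = fc j.-1 (s i)) ->
  exists t : B n.+2, forall j, j < n.+3 -> j != k -> fc j t = s j.
Proof.
move=> qB /andP[k0 kn] comp.
pose K : 'I_n.+3 := inord k.
have KE : K = k :> nat by rewrite inordK //; lia.
pose R m (x : sub (hornc K) m) (v : B m) := exists (j : 'I_n.+3) (a : op m.+1 n.+2),
  [/\ j != K, sval x = op_comp (coface j) a & v = sact a (s j)].
have fn m x v v' : R m x v -> R m x v' -> v = v'.
  move=> [j [a [jK e ->]]] [j' [a' [jK' e' ->]]].
  have {e'}e : op_comp (coface j) a = op_comp (coface j') a' by rewrite -e -e'.
  have eb i : bump j (a i) = bump j' (a' i).
    have : op_comp (coface j) a i = op_comp (coface j') a' i :> nat by rewrite e.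
    by rewrite !op_compE !mk_opE.
  wlog jj : j j' a a' jK jK' e eb / j <= j'.
    move=> W; case: (leqP j j') => [|/ltnW] jj; first exact: (W j j' a a').
    by symmetry; apply: (W j' j a' a).
  move: jj; rewrite leq_eqVlt => /orP[/eqP/val_inj jj|jj].
    subst j'; congr (sact _ _); apply: op_ext => i.
    exact: (can_inj (bumpK j)) (eb i).
  (* The simplex lies in two faces j < j', hence in their intersection: both descriptions factor
     through the same codimension two face, where [comp] applies. *)
  have j'n : j'.-1 < n.+2 by have := ltn_ord j'; lia.
  have jn : j < n.+2 by have := ltn_ord j'; lia.
  have [|c ac] := @coface_factor _ _ a (Ordinal j'n).
    apply/forallP => i; rewrite -val_eqE /=; apply/eqP => h.
    by have := eb i; rewrite h /bump; do 2!case: leqP => /=; lia.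
  have [|c' ac'] := @coface_factor _ _ a' (Ordinal jn).
    apply/forallP => i; rewrite -val_eqE /=; apply/eqP => h.
    by have := eb i; rewrite h /bump; do 2!case: leqP => /=; lia.
  have cc : c = c'.
    apply: op_ext => i; have := eb i; rewrite ac ac' !op_compE !mk_opE /= /bump.
    by do 4!case: leqP => /=; lia.
  rewrite ac ac' !sact_comp cc; congr (sact _ _).
  have := comp j j' jj (ltn_ord _); rewrite -!KE => /(_ jK jK').
  by rewrite -[sact _ (s j)]/(face _ (s j)) -[sact _ (s j')]/(face _ (s j')) !faceE.
have [|m x|m l a x v|f fP] := @rel_smap (sub (hornc K)) B R.
- move=> m x; have /existsP[j /andP[jK xj]] := svalP x.
  have [a xa] := coface_factor xj; exists (sact a (s j)), j, a; split=> //.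
- exact: fn.
- move=> [j [b [jK e ->]]]; exists j, (op_comp b a); split=> //.
    by rewrite /= e op_compA.
  by rewrite sact_comp.
have [|h hP] := @lifts_pt B _ (hornc K) (fullc _) f.
  by apply: qcat_fib => //=; rewrite KE.
exists (h n.+2 (exist _ (op_id n.+3) I)) => j jn jk.
have jK : (inord j : 'I_n.+3) != K by rewrite -val_eqE /= KE inordK.
have hj : hornc K n.+1 (coface (inord j) : simplex n.+2 n.+1).
  apply/existsP; exists (inord j); rewrite jK; apply/forallP => i.
  by rewrite mk_opE eq_sym neq_lift.
rewrite /fc /face -smap_nat.
have -> : sact (coface (inord j)) (exist _ (op_id n.+3) I : sub (fullc (simplex n.+2)) n.+2)
    = exist _ (coface (inord j) : simplex n.+2 n.+1) I.
  by apply: sub_ext; rewrite /= op_1comp.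
rewrite (hP _ _ hj); apply: fn (fP _ _) _.
exists (inord j), (op_id _); split=> //; first by rewrite /= op_comp1.
by rewrite sact_id inordK.
Qed.

Definition tri (u w e : B 1) : Prop :=
  exists s : B 2, [/\ fc 2 s = u, fc 0 s = w & fc 1 s = e].

Lemma esrc_fc (e : B 1) : esrc e = fc 1 e.
Proof. by rewrite /esrc faceE. Qed.
Lemma etgt_fc (e : B 1) : etgt e = fc 0 e.
Proof. by rewrite /etgt faceE. Qed.

Lemma tri_bd u w e : tri u w e ->
  [/\ etgt u = esrc w, esrc e = esrc u & etgt e = etgt w].
Proof.
case=> s [<- <- <-]; rewrite !esrc_fc !etgt_fc; split.
- exact: (@fc_fc 0 0 2).
- by symmetry; exact: (@fc_fc 0 1 2).
- exact: (@fc_fc 0 0 1).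
Qed.

Lemma sact_id_eq n (c : op n.+1 n.+1) (e : B n) :
  (forall i, c i = i :> nat) -> sact c e = e.
Proof.
by move=> ci; rewrite -[RHS]sact_id; congr (sact _ e); apply: op_ext => i; rewrite op_idE.
Qed.

Lemma tri_degl e x : esrc e = x -> tri (degen0 x) e e.
Proof.
move=> <-.
have m : {homo (fun i : 'I_3 => inord i.-1 : 'I_2) : i j / i <= j}.
  by move=> [[|[|[|i]]] iP] [[|[|[|j]]] jP] //= _; rewrite ?inordK.
exists (sact (mk_op m) e); rewrite /fc /face /degen0 /esrc /face -!sact_comp.
split; [congr (sact _ e); apply: op_ext | apply: sact_id_eq | apply: sact_id_eq];
  by move=> [[|[|i]] iP] //; rewrite !op_compE !mk_opE /= ?inordK.
Qed.

Lemma tri_degr e x : etgt e = x -> tri e (degen0 x) e.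
Proof.
move=> <-.
have m : {homo (fun i : 'I_3 => inord (minn i 1) : 'I_2) : i j / i <= j}.
  by move=> [[|[|[|i]]] iP] [[|[|[|j]]] jP] //= _; rewrite ?inordK.
exists (sact (mk_op m) e); rewrite /fc /face /degen0 /etgt /face -!sact_comp.
split; [apply: sact_id_eq | congr (sact _ e); apply: op_ext | apply: sact_id_eq];
  by move=> [[|[|i]] iP] //; rewrite !op_compE !mk_opE /= ?inordK.
Qed.

Hypothesis qB : quasi_category B.

Lemma tri_ex u w : etgt u = esrc w -> exists e, tri u w e.
Proof.
move=> uw; pose s i := if i == 0 then w else u.
have [||t tP] := @horn_fill 0 1 s qB.
- by [].
- move=> [|[|i]] [|[|[|j]]] // _ _ _ _; rewrite /s /=.
  by rewrite -esrc_fc -etgt_fc.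
by exists (fc 1 t), t; split; rewrite // tP.
Qed.

(* [tri_assoc1] and [tri_assoc2] fill the inner horns of the 3-simplex at the
   vertices 1 and 2. *)
Lemma tri_assoc1 e01 e12 e23 e02 e13 e03 :
  tri e01 e12 e02 -> tri e01 e13 e03 -> tri e12 e23 e13 -> tri e02 e23 e03.
Proof.
move=> [s3 [a3 b3 c3]] [s2 [a2 b2 c2]] [s0 [a0 b0 c0]].
pose s i := if i == 0 then s0 else if i == 2 then s2 else s3.
have [||t tP] := @horn_fill 1 1 s qB.
- by [].
- by move=> [|[|[|i]]] [|[|[|[|j]]]] // _ _ _ _; rewrite /s /= ?a3 ?b3 ?c3 ?a2 ?b2 ?c2 ?a0 ?b0 ?c0.
exists (fc 1 t); split.
- by rewrite -[2]/(3.-1) -fc_fc // tP.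
- by rewrite fc_fc // tP.
- by rewrite -[X in fc X _]/(2.-1) -fc_fc // tP.
Qed.

Lemma tri_assoc2 e01 e12 e23 e02 e13 e03 :
  tri e01 e12 e02 -> tri e02 e23 e03 -> tri e12 e23 e13 -> tri e01 e13 e03.
Proof.
move=> [s3 [a3 b3 c3]] [s1 [a1 b1 c1]] [s0 [a0 b0 c0]].
pose s i := if i == 0 then s0 else if i == 1 then s1 else s3.
have [||t tP] := @horn_fill 1 2 s qB.
- by [].
- by move=> [|[|[|i]]] [|[|[|[|j]]]] // _ _ _ _; rewrite /s /= ?a3 ?b3 ?c3 ?a1 ?b1 ?c1 ?a0 ?b0 ?c0.
exists (fc 2 t); split.
- by rewrite -[X in fc X _]/(3.-1) -fc_fc // tP.
- by rewrite fc_fc // tP.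
- by rewrite fc_fc // tP.
Qed.

Definition hmtp (e e' : B 1) := tri (degen0 (esrc e)) e e'.

Lemma hmtp_refl e : hmtp e e. Proof. exact: tri_degl. Qed.
Lemma hmtp_src e e' : hmtp e e' -> esrc e' = esrc e.
Proof. by case/tri_bd => h1 h2 h3; rewrite h2 -h1 /esrc /etgt /face /degen0 -!sact_comp;
  congr sact; apply: op_ext => i; rewrite !op_compE !mk_opE. Qed.
Lemma degen_src (x : B 0) : esrc (degen0 x) = x.
Proof.
rewrite /esrc /face /degen0 -sact_comp -[RHS]sact_id; congr (sact _ x).
by apply: op_ext => i; rewrite op_compE mk_opE !ord1.
Qed.
Lemma degen_tgt (x : B 0) : etgt (degen0 x) = x.
Proof.
rewrite /etgt /face /degen0 -sact_comp -[RHS]sact_id; congr (sact _ x).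
by apply: op_ext => i; rewrite op_compE mk_opE !ord1.
Qed.

Lemma hmtp_degen (x : B 0) : tri (degen0 x) (degen0 x) (degen0 x).
Proof. exact/tri_degl/degen_src. Qed.

Lemma hmtp_sym e e' : hmtp e e' -> hmtp e' e.
Proof.
move=> h; rewrite /hmtp (hmtp_src h).
exact: tri_assoc2 (hmtp_degen _) (hmtp_refl e) h.
Qed.
Lemma hmtp_trans e e' e'' : hmtp e e' -> hmtp e' e'' -> hmtp e e''.
Proof.
move=> h h'; rewrite /hmtp; rewrite /hmtp (hmtp_src h) in h'.
exact: tri_assoc1 (hmtp_degen _) h' h.
Qed.
Lemma tri_hmtpr u e e' e1 : tri u e e1 -> hmtp e e' -> tri u e' e1.
Proof.
move=> t /hmtp_sym h; have [ue _ _] := tri_bd t.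
have s := hmtp_src h; rewrite /hmtp in h.
apply: tri_assoc1 t h; apply: tri_degr; by rewrite ue s.
Qed.
Lemma tri_uniq u e e1 e1' : tri u e e1 -> tri u e e1' -> hmtp e1 e1'.
Proof.
move=> t t'; have [_ s _] := tri_bd t.
by apply: tri_assoc2 t' t; apply: tri_degl; rewrite s.
Qed.
Lemma tri_hmtpl u e e1 e1' : tri u e e1 -> hmtp e1 e1' -> tri u e e1'.
Proof.
move=> t h; have [_ s _] := tri_bd t.
by apply: tri_assoc1 h t; apply: tri_degl; rewrite s.
Qed.

(** The edge e is a composite of the path p. This relation is functional up to homotopy and
    invariant under [hrel], so an equality in ho B, a quotient of paths, can be read back in B. *)
Fixpoint rep (x y : B 0) (p : hpath x y) (e : B 1) : Prop :=
  match p with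
  | hnil x => hmtp (degen0 x) e
  | hcons _ _ _ u _ _ p => exists e', rep p e' /\ tri u e' e
  end.

Lemma rep_bd x y (p : hpath x y) e : rep p e -> esrc e = x /\ etgt e = y.
Proof.
elim: p e => [z|x' y' z u ux uy p IH] e /=.
  move=> h; rewrite (hmtp_src h) degen_src; split=> //.
  by have [_ _ ->] := tri_bd h; rewrite degen_tgt.
by case=> e' [/IH[sx ty] /tri_bd[h1 h2 h3]]; rewrite h2 h3.
Qed.

Lemma rep_hmtp x y (p : hpath x y) e e' : rep p e -> hmtp e e' -> rep p e'.
Proof.
case: p => [z|x' y' z u ux uy p] /=; first exact: hmtp_trans.
by case=> e1 [h t] ee; exists e1; split=> //; apply: tri_hmtpl ee.
Qed.

Lemma rep_uniq x y (p : hpath x y) e e' : rep p e -> rep p e' -> hmtp e e'.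
Proof.
elim: p e e' => [z|x' y' z u ux uy p IH] e e' /=.
  by move=> h h'; apply: hmtp_trans h'; apply: hmtp_sym.
case=> e1 [r1 t1] [e2 [r2 t2]].
exact: tri_uniq (tri_hmtpr t1 (IH _ _ r1 r2)) t2.
Qed.


Lemma fc_max (s : B 2) : face ord_max s = fc 2 s. Proof. exact: faceE. Qed.
Lemma fc_zero (s : B 2) : face ord0 s = fc 0 s. Proof. exact: faceE. Qed.

Lemma rep_rel x y (p q : hpath x y) : hrel p q -> forall e, rep p e <-> rep q e.
Proof.
elim=> {x y p q} /=.
- by [].
- by move=> x y p q _ IH e; split=> /IH.
- by move=> x y p q r _ IH _ IH' e; split=> [/IH/IH'|/IH'/IH].
- by move=> x y z u ux uy p q _ IH e; split=> -[e' [/IH h t]]; exists e'.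
- move=> x y ex ex' p e; split=> [[e' [h t]]|h].
    apply: rep_hmtp h _; have [t1 _ _] := tri_bd t.
    by rewrite /hmtp -t1 ex'.
  exists e; split=> //; apply: tri_degl; by have [->] := rep_bd h.
- move=> x y z w s ex2 ey2 ex0 ey0 ex1 ey1 p e.
  have ts : tri (face ord_max s) (face ord0 s) (face (inord 1) s).
    by exists s; rewrite fc_max fc_zero.
  split=> [[e' [[e'' [h t]] t']]|[e'' [h t]]].
    by exists e''; split=> //; apply: tri_assoc1 ts t' t.
  have [|e' t'] := @tri_ex (face ord0 s) e''.
    by rewrite ey0; have [->] := rep_bd h.
  exists e'; split; first by exists e''.
  exact: tri_assoc2 ts t t'.
Qed.

(** Each edge represents the path consisting of it alone. If the two paths are related, [rep_rel]
    makes e a composite of the second one as well, and composites are unique up to homotopy. *)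
Lemma hedge_homotopic (x y : ho B) (e e' : B 1) (ex : esrc e = x) (ey : etgt e = y)
    (ex' : esrc e' = x) (ey' : etgt e' = y) :
  hedge ex ey = hedge ex' ey' -> tri (degen0 x) e' e.
Proof.
have sing u (ux : esrc u = x) (uy : etgt u = y) : rep (hcons u ux uy (hnil y)) u.
  exists (degen0 y); split; [exact: hmtp_refl | exact: tri_degr].
move=> /hclassP/rep_rel/(_ e)[/(_ (sing _ _ _)) h _].
by have := rep_uniq (sing e' ex' ey') h; rewrite /hmtp ex'.
Qed.

Lemma hedge_tri (x y z : ho B) (u w e : B 1) (ux : esrc u = x) (uy : etgt u = y)
    (wy : esrc w = y) (wz : etgt w = z) (ex : esrc e = x) (ez : etgt e = z) :
  tri u w e -> mcomp (hedge wy wz) (hedge ux uy) = hedge ex ez.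
Proof.
move=> [s [a b c]]; rewrite /= hcomp_class /=.
rewrite -fc_max in a; rewrite -fc_zero in b; rewrite /fc in c.
subst u w e; apply/hclassP; exact: hrel_face.
Qed.

Lemma hedge_degen (x : ho B) (e1 : esrc (degen0 (x : B 0)) = x) (e2 : etgt (degen0 (x : B 0)) = x) :
  hedge e1 e2 = idm x.
Proof. apply/hclassP; exact: hrel_degen. Qed.

Lemma hom_hedge (x y : ho B) (f : hom x y) :
  exists (e : B 1) (ex : esrc e = x) (ey : etgt e = y), f = hedge ex ey.
Proof.
rewrite -(hreprK f); move: (hrepr f) => p {f}.
elim: p => [z|x' y' z u ux uy p [e [ex [ey IH]]]].
  by exists (degen0 z), (degen_src z), (degen_tgt z); rewrite hedge_degen.
have [|e1 t] := @tri_ex u e; first by rewrite uy ex.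
have [_ s1 t1] := tri_bd t.
exists e1, (etrans s1 ux), (etrans t1 ey).
rewrite -(hedge_tri ux uy ex ey _ _ t) -IH /= hcomp_class //.
Qed.
End Horns.

(** * Joins and slices *)

Section Join.
Variables Y X : sset.

Lemma join_ob_inv n l r (lr lr' : l + r = n.+1) (y y' : aug Y l) (x x' : aug X r) :
  JoinOb lr y x = JoinOb lr' y' x' -> y = y' /\ x = x'.
Proof.
move=> e; have [-> ->] // := existT_inj (congr1 (fun u : join_ob Y X n =>
  existT (fun p : nat * nat => aug Y p.1 * aug X p.2)%type (jl u, jr u) (jy u, jx u)) e).
Qed.

Lemma join_inl_inj n : injective (join_inl Y X n).
Proof. by move=> y y' /join_ob_inv[]. Qed.
Lemma join_inr_inj n : injective (join_inr Y X n).
Proof. by move=> x x' /join_ob_inv[]. Qed.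

Lemma join_inlP n (u : join Y X n) : jr u = 0 -> exists y, u = join_inl Y X n y.
Proof.
case: u => l r lr y x /= r0; subst r.
have e : l = n.+1 by rewrite -lr addn0.
subst l; exists y; case: x; congr JoinOb; exact: Prop_irrelevance.
Qed.

Lemma join_inrP n (u : join Y X n) : jl u = 0 -> exists x, u = join_inr Y X n x.
Proof.
case: u => l r lr y x /= l0; subst l.
have e : r = n.+1 := lr.
subst r; exists x; case: y; congr JoinOb; exact: Prop_irrelevance.
Qed.

(** Every simplex of Y * X outside X comes from some Delta^m * X, where the simplices of a slice are
    defined; equalities of maps out of a join are checked on these two kinds. *)
Lemma join_case n (u : join Y X n) :
  (exists x, u = join_inr Y X n x) \/
  exists m (y : Y m) (w : join (simplex m) X n), u = join_mapl X (yoneda y) n w.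
Proof.
case: u => [[|l] r lr y x]; first by left; apply: join_inrP.
right; exists l, y, (@JoinOb (simplex l) X n l.+1 r lr (op_id l.+1) x).
by rewrite /= sact_id.
Qed.
End Join.

Section JoinMap.
Variables (Y Y' X X' : sset) (f : smap Y Y') (g : smap X X').
Lemma join_map_subproof m n (a : op m.+1 n.+1) (u : join Y X n) :
  JoinOb (jlr (sact a u)) (aug_map f (jy (sact a u))) (aug_map g (jx (sact a u)))
  = sact a (JoinOb (jlr u) (aug_map f (jy u)) (aug_map g (jx u)) : join Y' X' n).
Proof. by rewrite /= /join_act /= !aug_map_nat. Qed.
Definition join_map : smap (join Y X) (join Y' X') :=
  @SMap (join Y X) (join Y' X')
    (fun n u => JoinOb (jlr u) (aug_map f (jy u)) (aug_map g (jx u)))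
    (@join_map_subproof).
End JoinMap.

(** The (-1)-simplex belongs to every U, so that [joincl U] is the subcomplex U * X, which contains
    X. *)
Definition augc (Y : sset) (U : subc Y) l : aug Y l -> Prop :=
  if l is m.+1 then fun y => U m y else fun _ => True.
Arguments augc {Y} U {l} y.

Lemma augc_act (Y : sset) (U : subc Y) p q (a : op p q) (y : aug Y q) :
  augc U y -> augc U (aug_act a y).
Proof.
case: p a => [|p] a //; case: q a y => [|q] a y; first by case: (op_absurd a).
exact: sc_act.
Qed.

Section JoinC.
Variables Y X : sset.
Lemma joincl_subproof (U : subc Y) m n (a : op m.+1 n.+1) (u : join Y X n) :
  augc U (jy u) -> augc U (jy (sact a u)).
Proof. exact: augc_act. Qed.
Definition joincl (U : subc Y) : subc (join Y X) := Subc (@joincl_subproof U).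
Lemma joincr_subproof (U : subc X) m n (a : op m.+1 n.+1) (u : join Y X n) :
  augc U (jx u) -> augc U (jx (sact a u)).
Proof. exact: augc_act. Qed.
Definition joincr (U : subc X) : subc (join Y X) := Subc (@joincr_subproof U).
Lemma inlc_subproof m n (a : op m.+1 n.+1) (u : join Y X n) :
  jr u = 0 -> jr (sact a u) = 0.
Proof.
move=> r0 /=; have e : jl u = n.+1 by rewrite -(jlr u) r0 addn0.
by rewrite e cutl_max subnn.
Qed.
Definition inlc : subc (join Y X) := Subc inlc_subproof.
End JoinC.

Lemma joincl_incl (Y X : sset) (U : subc Y) n (u : join Y X n) :
  joincl X U n u -> exists w : join (sub U) X n, join_mapl X (incl U) n w = u.
Proof.
case: u => [[|l] r lr y x] /= h.
  by exists (@JoinOb (sub U) X n 0 r lr tt x); case: y h.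
by exists (@JoinOb (sub U) X n l.+1 r lr (exist _ y h) x).
Qed.

Lemma join_mapl_incl_inj (Y X : sset) (U : subc Y) n (w w' : join (sub U) X n) :
  join_mapl X (incl U) n w = join_mapl X (incl U) n w' -> w = w'.
Proof.
case: w w' => [l r lr y x] [l' r' lr' y' x'] e.
have el : l = l' := congr1 (@jl _ _ _) e; have er : r = r' := congr1 (@jr _ _ _) e.
subst l' r'; have [ey ex] := join_ob_inv e; rewrite /= in ex; subst x'.
rewrite (Prop_irrelevance lr lr'); congr JoinOb.
case: l lr lr' y y' e ey => [|l] lr lr' y y' e /= ey; first by case: y {e ey}; case: y'.
exact: sub_ext.
Qed.

(* Maps k : Y -> A_{/d} correspond to maps Y * X -> A extending d; [hat] and
   [slice_of] are the two directions. *)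
Section Hat.
Variables (X A : sset) (d : smap X A) (Y : sset).

Section HatDef.
Variable k : smap Y (slice d).
Definition hat_fun n (u : join Y X n) : A n :=
  match u with JoinOb l r lr y x =>
    match l return (l + r = n.+1 -> aug Y l -> A n) with
    | 0 => fun lr _ => d n (aug_act (op_cast (esym (lr : r = n.+1))) x : aug X n.+1)
    | l'.+1 => fun lr y => sval (k l' y) n (@JoinOb (simplex l') X n l'.+1 r lr (op_id l'.+1) x)
    end lr y
  end.

Lemma hat_fun_inr n (x : X n) : hat_fun (join_inr Y X n x) = d n x.
Proof.
rewrite /=; congr (d n _); rewrite -[RHS]sact_id; congr (sact _ x).
by apply: op_ext => i; rewrite op_castE op_idE.
Qed.

Lemma slice_inr m (s : slice d m) n (x : X n) : sval s n (join_inr _ X n x) = d n x.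
Proof. exact: (congr1 (fun f : smap X A => f n x) (svalP s)). Qed.

Lemma hat_fun_mapl m (y : Y m) n (w : join (simplex m) X n) :
  hat_fun (join_mapl X (yoneda y) n w) = sval (k m y) n w.
Proof.
case: w => [[|l] r lr a x] /=.
  have e : r = n.+1 := lr; subst r.
  have -> : JoinOb lr a x = join_inr (simplex m) X n x.
    by case: a; congr JoinOb; apply: Prop_irrelevance.
  rewrite slice_inr -[in RHS](sact_id x); congr (d n (sact _ x)).
  by apply: op_ext => i; rewrite op_castE op_idE.
by rewrite smap_nat /= op_comp1.
Qed.

Lemma hat_subproof m n (a : op m.+1 n.+1) (u : join Y X n) :
  hat_fun (sact a u) = sact a (hat_fun u).
Proof.
have [[x ->]|[l [y [w ->]]]] := join_case u.
  by rewrite -smap_nat !hat_fun_inr smap_nat.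
by rewrite -smap_nat !hat_fun_mapl smap_nat.
Qed.
Definition hat : smap (join Y X) A := SMap hat_subproof.

Lemma hat_inr n x : hat n (join_inr Y X n x) = d n x.
Proof. exact: hat_fun_inr. Qed.
Lemma hat_mapl m (y : Y m) n (w : join (simplex m) X n) :
  hat n (join_mapl X (yoneda y) n w) = sval (k m y) n w.
Proof. exact: hat_fun_mapl. Qed.
Lemma hat_inl n (y : Y n) : hat n (join_inl Y X n y) = slice_pr d n (k n y).
Proof.
by rewrite /= -hat_mapl /= sact_id.
Qed.
End HatDef.

Section SliceOf.
Variables (F : smap (join Y X) A) (Fd : scomp F (join_inr Y X) = d).
Lemma slice_of_subproof n (y : Y n) :
  scomp (scomp F (join_mapl X (yoneda y))) (join_inr _ X) = d.
Proof. by rewrite -scompA join_mapl_inr. Qed.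
Lemma slice_of_nat m n (a : op m.+1 n.+1) (y : Y n) :
  (exist _ _ (slice_of_subproof (sact a y)) : slice d m)
  = sact a (exist _ _ (slice_of_subproof y) : slice d n).
Proof.
apply/slice_ext/smap_ext => l [[|q] r lr b x] //=.
by rewrite sact_comp.
Qed.
Definition slice_of : smap Y (slice d) :=
  @SMap Y (slice d) (fun n y => exist _ _ (slice_of_subproof y)) slice_of_nat.

Lemma hat_slice_of : hat slice_of = F.
Proof.
apply: smap_ext => n u; have [[x ->]|[l [y [w ->]]]] := join_case u.
  by rewrite hat_inr -[in LHS]Fd.
by rewrite hat_mapl.
Qed.
Lemma slice_pr_of n (y : Y n) : slice_pr d n (slice_of n y) = F n (join_inl Y X n y).
Proof. by rewrite -hat_inl hat_slice_of. Qed.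
End SliceOf.

End Hat.

Lemma hat_comp (X A : sset) (d : smap X A) (Y Y' : sset) (k : smap Y (slice d))
    (f : smap Y' Y) : hat (scomp k f) = scomp (hat k) (join_mapl X f).
Proof. by apply: smap_ext => n [[|l] r lr y x]. Qed.

(** By transposition, lifting U in V against A_{/d} -> A is extending a map from the union of V and
    U * X to V * X, the map being d on X. *)
Lemma slice_lifts (X A : sset) (d : smap X A) (V : sset) (U : subc V) :
  (forall f : smap (sub (orc (inlc V X) (joincl X U))) A,
    (forall n x h, f n (exist _ (join_inr V X n x) h) = d n x) ->
    exists h : smap (join V X) A, forall n x hx, h n x = f n (exist _ x hx)) ->
  lifts (slice_pr d) U (fullc V).
Proof.
move=> ext f g fg.
pose S := orc (inlc V X) (joincl X U).
pose R n (u : sub S n) (v : A n) :=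
  (exists y, sval u = join_inl V X n y /\ v = g n y) \/
  (exists w, sval u = join_mapl X (incl U) n w /\ v = hat f n w).
have cross n y (w : join (sub U) X n) :
    join_inl V X n y = join_mapl X (incl U) n w -> hat f n w = g n y.
  move=> e; have [y' we] : exists y', w = join_inl _ X n y'.
    by apply: join_inlP; rewrite -[jr w]/(jr (join_mapl X (incl U) n w)) -e.
  subst w; have -> : y = sval y' by apply: (@join_inl_inj V X); rewrite e.
  by rewrite hat_inl fg.
have fn n u v v' : R n u v -> R n u v' -> v = v'.
  move=> [[y [e ->]]|[w [e ->]]] [[y' [e' ->]]|[w' [e' ->]]].
  + by congr (g n _); apply: (@join_inl_inj V X); rewrite -e -e'.
  + by symmetry; apply: cross; rewrite -e -e'.
  + by apply: cross; rewrite -e -e'.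
  + by congr (hat f n _); apply: join_mapl_incl_inj; rewrite -e -e'.
have [|//|m n a u v|fS fSP] := @rel_smap (sub S) A R.
- move=> n u; case: (svalP u) => [/join_inlP[y e]|/joincl_incl[w e]].
    by exists (g n y); left; exists y.
  by exists (hat f n w); right; exists w; rewrite e.
- case=> [[y [e ->]]|[w [e ->]]]; [left; exists (sact a y) | right; exists (sact a w)].
    by rewrite !smap_nat -e.
  by rewrite !smap_nat -e.
have fSm n w hw : fS n (exist _ (join_mapl X (incl U) n w) hw) = hat f n w.
  by apply: fn (fSP _ _) _; right; exists w.
have [n x h|h hP] := ext fS.
  apply: fn (fSP _ _) _; right; exists (join_inr _ X n x).
  by rewrite hat_inr.
have inS n w : S n (join_mapl X (incl U) n w).
  right; case: w => [[|l] r lr y x] //=; exact: svalP.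
have hd : scomp h (join_inr V X) = d.
  apply: smap_ext => n x /=.
  have hx : S n (join_inr V X n x) by right.
  by rewrite (hP _ _ hx) (fSm n (join_inr (sub U) X n x) hx) hat_inr.
exists (scomp (slice_of hd) (incl _)); split=> [n y hy hy'|n [y hy]]; last first.
  rewrite [LHS]slice_pr_of.
  have hi : S n (join_inl V X n y) by left.
  by rewrite (hP _ _ hi); apply: fn (fSP _ _) _; left; exists y.
apply/slice_ext/smap_ext => m w.
have e : join_mapl X (yoneda y) m w
    = join_mapl X (incl U) m (join_mapl X (yoneda (exist _ y hy : sub U n)) m w).
  by case: w => [[|l] r lr a x].
have hw : S m (join_mapl X (yoneda y) m w) by rewrite e; apply: inS.
rewrite [LHS](hP _ _ hw); move: hw; rewrite e => hw.
by rewrite fSm hat_mapl.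
Qed.

(** * Joins with a horn: slice projections are right fibrations *)

Section Augv.
Variable n : nat.
(** Vertices as natural numbers, with value 0 on the empty simplex and junk past the end. The bound
    [augv_lt] holds even for junk values. *)
Definition augv l : aug (simplex n) l -> nat -> nat :=
  if l is l'.+1 then fun y i => (y : op l'.+1 n.+1) (inord i) else fun _ _ => 0.

Lemma augv_lt l (y : aug (simplex n) l) i : augv y i < n.+1.
Proof. by case: l y => [|l] y //=; apply: ltn_ord. Qed.
Lemma augv_mono l (y : aug (simplex n) l) i j : i <= j -> j < l -> augv y i <= augv y j.
Proof.
by case: l y => [|l] y //= ij jl; apply: op_le; rewrite !inordK //; lia.
Qed.
Lemma augv_act p l (a : op p l) (y : aug (simplex n) l) (i : 'I_p) :
  augv (aug_act a y) i = augv y (a i).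
Proof.
case: p a i => [|p] a i; first by case: i.
case: l a y => [|l] a y /=; first by case: (op_absurd a).
by rewrite op_compE !inord_val.
Qed.
Lemma augv_ext l (y y' : aug (simplex n) l) :
  (forall i : 'I_l, augv y i = augv y' i) -> y = y'.
Proof.
case: l y y' => [|l] y y'; first by case: y; case: y'.
by move=> e; apply: op_ext => i; have := e i; rewrite /= inord_val.
Qed.
Lemma augv_id i : i < n.+1 -> @augv n.+1 (op_id n.+1) i = i.
Proof. by move=> ilt; rewrite /= op_idE inordK. Qed.
End Augv.

(* Simplices of Delta^n * Delta^r, identified with Delta^(n + r + 1), act on the
   top simplex of Delta^n * X determined by an r-simplex of X. *)
Section Top.
Variables (n r N : nat) (eN : n.+1 + r.+1 = N.+1).

Section Jop.
Variables (m l q : nat) (lr : l + q = m.+1).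
Variables (y : aug (simplex n) l) (a : aug (simplex r) q).
Definition jopv (i : nat) : nat := if i < l then augv y i else n.+1 + augv a (i - l).
Lemma jopv_lt i : jopv i < N.+1.
Proof.
rewrite /jopv; case: ifP => _; first by have := augv_lt y i; lia.
by have := augv_lt a (i - l); lia.
Qed.
Lemma jop_mono : {homo (fun i : 'I_m.+1 => inord (jopv i) : 'I_N.+1) : i j / i <= j}.
Proof.
move=> i j ij; rewrite !inordK ?jopv_lt // /jopv; have := ltn_ord j.
case: ifP => il; case: ifP => jl //; try lia.
- by move=> _; apply: augv_mono.
- by have := augv_lt y i; lia.
- by move=> jm; rewrite leq_add2l; apply: augv_mono; lia.
Qed.
Definition jop : op m.+1 N.+1 := mk_op jop_mono.
Lemma jopE i : jop i = jopv i :> nat.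
Proof. by rewrite mk_opE inordK ?jopv_lt. Qed.

Lemma jop_cutl : cutl jop n.+1 = l.
Proof.
apply: cutl_uniq => [|i]; first by lia.
rewrite jopE /jopv; case: ifP => _; first by rewrite augv_lt.
by rewrite ltnNge leq_addr.
Qed.
End Jop.

Variable X : sset.
Definition top (x : X r) : join (simplex n) X N :=
  @JoinOb (simplex n) X N n.+1 r.+1 eN (op_id n.+1) x.

Lemma aug_map_id (x : X r) : aug_map (yoneda x) (op_id r.+1 : aug (simplex r) r.+1)
  = x :> aug X r.+1.
Proof. exact: sact_id. Qed.

Lemma jop_top m l q (lr : l + q = m.+1) (y : aug (simplex n) l)
    (a : aug (simplex r) q) (x : X r) :
  sact (jop lr y a) (top x) = JoinOb lr y (aug_map (yoneda x) a).
Proof.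
have el := jop_cutl lr y a.
have er : m.+1 - cutl (jop lr y a) n.+1 = q by rewrite el -lr addKn.
apply: (join_ob_ext el er) => /=.
  apply: augv_ext => i; rewrite !augv_act augv_id ?ltn_ord // reslE jopE /= op_castE.
  by rewrite /jopv -[X in _ < X]el ltn_ord.
transitivity (aug_map (yoneda x)
  (aug_act (resr (jop lr y a) eN) (op_id r.+1 : aug (simplex r) r.+1))).
  by rewrite aug_map_nat aug_map_id.
rewrite -aug_map_nat; congr aug_map.
apply: augv_ext => i; rewrite !augv_act augv_id ?ltn_ord // resrE jopE /= op_castE.
rewrite /jopv [cutl _ _ + i < l]ltnNge -[X in X <= _]el leq_addr /=.
by rewrite addKn -[X in _ - X]el addKn.
Qed.

Lemma act_top m (c : op m.+1 N.+1) : exists l q (lr : l + q = m.+1) y a,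
  c = jop lr y a /\
  forall x : X r, sact c (top x) = JoinOb lr y (aug_map (yoneda x) a).
Proof.
exists (cutl c n.+1), (m.+1 - cutl c n.+1), (join_act_subproof c n.+1),
  (aug_act (resl c n.+1) (op_id n.+1 : aug (simplex n) n.+1)),
  (aug_act (resr c eN) (op_id r.+1 : aug (simplex r) r.+1)).
set lr := join_act_subproof _ _; set y := aug_act _ _; set a := aug_act _ _.
have ce : c = jop lr y a.
  apply: op_ext => i; rewrite jopE /jopv; case: ifP => il.
    rewrite -[i : nat]/(Ordinal il : nat) augv_act augv_id ?ltn_ord // reslE.
    by congr (nat_of_ord (c _)); apply/val_inj.
  have il' : i - cutl c n.+1 < m.+1 - cutl c n.+1.
    by have := ltn_ord i; have := cutl_le c n.+1; move: il; lia.
  rewrite -[i - _]/(Ordinal il' : nat) augv_act augv_id ?ltn_ord // resrE.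
  have e : shiftr (Ordinal il') = i by apply/val_inj; rewrite /=; lia.
  by rewrite e subnKC // leqNgt -cutl_lt il.
by split=> // x; rewrite {1}ce jop_top.
Qed.
End Top.

Lemma in_hornP n (k : 'I_n.+1) m (b : op m.+1 n.+1) :
  in_horn k b <-> exists j, [/\ j < n.+1, j != k & forall i, b i != j :> nat].
Proof.
split=> [/existsP[j /andP[jk /forallP bj]]|[j [jn jk bj]]].
  by exists j; split=> // i; apply: bj.
apply/existsP; exists (Ordinal jn); rewrite jk; apply/forallP => i; exact: bj.
Qed.

Lemma aug_horn n (k : 'I_n.+1) l (y : aug (simplex n) l) : 0 < k ->
  augc (hornc k) y <-> exists j, [/\ j < n.+1, j != k & forall i, i < l -> augv y i != j].
Proof.
move=> k0; case: l y => [|l] y /=.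
  by split=> // _; exists 0; split=> //; rewrite neq_ltn k0.
rewrite in_hornP; split=> -[j [jn jk h]]; exists j; split=> // i.
by have := h i (ltn_ord i); rewrite inord_val.
Qed.

Lemma nsurjP p q (a : op p q) :
  ~ surj a <-> exists j, j < q /\ forall i, a i != j :> nat.
Proof.
split=> [/nsurj_misses[j /forallP h]|[j [jq h]] s]; first by exists j.
by have [i ai] := s (Ordinal jq); have := h i; rewrite ai eqxx.
Qed.

Section SliceFib.
Variables (X A : sset) (d : smap X A).
Hypothesis qA : quasi_category A.

(** Each nondegenerate r-simplex of X contributes a Delta^(n+r+1), attached along its horn at k.
    Since k <= n < n + r + 1, this horn is inner even for k = n, which is why the slice projection
    lifts against last horns although A has only inner fillers. *)
Lemma join_horn_lifts n (k : 'I_n.+1) : 0 < k ->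
  lifts (bang A) (orc (inlc (simplex n) X) (joincl X (hornc k))) (fullc _).
Proof.
move=> k0; set S := orc _ _.
pose F r := orc S (@joincr (simplex n) X (skel X r)).
have F0 : F 0 = S.
  apply: subc_ext => m u; split; last by left.
  case=> //; case: u => l [|q] lr y x //= h; first by left.
  by case: h => i [c [z [//]]].
have FU : unionc F = fullc _.
  apply: subc_ext => m u; split=> // _; exists (jr u); right => /=.
  case: u => l [|q] lr y x //=; exists q, (op_id _), x; split=> //.
  by rewrite sact_id.
rewrite -F0 -FU; apply: lifts_chain => r.
  move=> m u [h|h]; [by left | right].
  case: u h => l [|q] lr y x //= [i [c [z [ir e]]]].
  by exists i, c, z; split=> //; apply: ltnW.
pose N := n + r.+1; have eN : n.+1 + r.+1 = N.+1 by [].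
pose K : 'I_N.+1 := inord k.
have KE : K = k :> nat by rewrite inordK // /N; have := ltn_ord k; lia.
pose I := {x : X r | nd x}.
have CE m l q (lr : l + q = m.+1) y a (x : I) :
    hornc K m (jop eN lr y a : simplex N m)
    <-> F r m (JoinOb lr y (aug_map (yoneda (sval x)) a)).
  rewrite [hornc _ _ _](in_hornP K); split.
    case=> j [jN jK h]; rewrite KE in jK.
    have h' i : i < m.+1 -> jopv y a i != j.
      by move=> im; have := h (Ordinal im); rewrite jopE.
    have [jn|nj] := ltnP j n.+1.
      left; right; apply/(aug_horn y k0); exists j; split=> // i il.
      by have := h' i; rewrite /jopv il; apply; lia.
    right => /=; case: q a lr h h' => [|q] a lr h h' //=.
    apply: nsurj_skel; apply/nsurjP; exists (j - n.+1); split; first by rewrite /N in jN; lia.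
    move=> i; have := h' (l + i); rewrite /jopv [l + i < l]ltnNge leq_addr /= addKn inord_val.
    by have := ltn_ord i; move: ((a : op _ _) i : nat) => v; lia.
  rewrite KE; case=> [[q0|/(aug_horn y k0)[j [jn jk h]]]|h].
  - rewrite /= in q0.
    (* A simplex without vertices in X misses the last vertex N, and N differs from k because k <= n
       < N. *)
    exists N; split=> //; first by have := ltn_ord k; rewrite /N; lia.
    move=> i; have il : i < l by have := ltn_ord i; lia.
    by rewrite jopE /jopv il; have := augv_lt y i; rewrite /N; lia.
  - exists j; split=> //; first by rewrite /N; lia.
    move=> i; rewrite jopE /jopv; case: ifP => [/h //|_].
    by move: jn; lia.
  - case: q lr a h => [|q] lr a h.
      exists N; split=> //; first by have := ltn_ord k; rewrite /N; lia.
      move=> i; have il : i < l by have := ltn_ord i; lia.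
      by rewrite jopE /jopv il; have := augv_lt y i; rewrite /N; lia.
    have [/(nd_surj_skel (svalP x)) //|/nsurjP[j [jr aj]]] := pselect (surj (a : op q.+1 r.+1)).
    exists (n.+1 + j); split; first by rewrite /N; lia.
      by have := ltn_ord k; lia.
    move=> i; rewrite jopE /jopv; case: ifP => _.
      by have := augv_lt y i; lia.
    by rewrite eqn_add2l; apply: aj.
apply: (@attach _ _ (bang A) _ _ _ I (fun _ => simplex N)
  (fun x => yoneda (top eN (sval x))) (fun _ => hornc K) (fun _ => fullc _)) => //.
- move=> x m c _; have [l [q [lr [y [a [_ E]]]]]] := act_top eN X c.
  rewrite -[yoneda _ _ c]/(sact (c : op _ _) (top eN (sval x))) E.
  right => /=; case: q a lr {E} => [|q] a lr //=.
  by exists r, a, (sval x).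
- move=> x m c _; have [l [q [lr [y [a [e E]]]]]] := act_top eN X c.
  rewrite -[yoneda _ _ c]/(sact (c : op _ _) (top eN (sval x))) E e.
  exact: CE.
- move=> m u h; have [hr|nr] := pselect (F r m u); [by left | right].
  case: u h nr => l [|q] lr y x; first by move=> _ []; left; left.
  case=> [h|[i [c [z [ir e]]]]] nr; first by case: nr; left.
  have ei : i = r.
    apply/eqP; rewrite eqn_leq -ltnS ir leqNgt; apply/negP => lt; apply: nr.
    by right; exists i, c, z.
  subst i; have ndz : nd z.
    by move=> h; apply: nr; right ; move: e => /= ->; apply: in_skel_act.
  exists (exist _ z ndz), (jop eN lr y (c : aug (simplex r) q.+1)); split=> //.
  by rewrite -[LHS]/(sact (jop eN lr y (c : aug (simplex r) q.+1)) (top eN z)) jop_top; congr JoinOb.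
- move=> x x' m c c' _ _.
  rewrite -[yoneda _ _ c]/(sact (c : op _ _) (top eN (sval x))).
  rewrite -[yoneda _ _ c']/(sact (c' : op _ _) (top eN (sval x'))).
  have [l [q [lr [y [a [e E]]]]]] := act_top eN X c.
  have [l' [q' [lr' [y' [a' [e' E']]]]]] := act_top eN X c'.
  rewrite E E' => nF eF.
  have er : q = q' := congr1 (@jr _ _ _) eF.
  have el : l = l' := congr1 (@jl _ _ _) eF.
  subst l' q'; have [_ ex] := join_ob_inv eF.
  have nF' : ~ F r m (JoinOb lr' y' (aug_map (yoneda (sval x')) a')) by rewrite -eF.
  case: q lr lr' a a' {e e' E E'} eF nF nF' ex => [|q] lr lr' a a' eF nF nF' /= ex.
    by case: nF; left; left.
  have s1 : surj (a : op _ _).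
    by apply: contrapT => ns; apply: nF; right; apply: nsurj_skel.
  have s2 : surj (a' : op _ _).
    by apply: contrapT => ns; apply: nF'; right; apply: nsurj_skel.
  have [xx _] := nd_uniq (svalP x) (svalP x') s1 s2 ex.
  exact: sval_inj.
- move=> x m c c' _ _.
  rewrite -[yoneda _ _ c]/(sact (c : op _ _) (top eN (sval x))).
  rewrite -[yoneda _ _ c']/(sact (c' : op _ _) (top eN (sval x))).
  have [l [q [lr [y [a [e E]]]]]] := act_top eN X c.
  have [l' [q' [lr' [y' [a' [e' E']]]]]] := act_top eN X c'.
  rewrite E E' => nF eF.
  have er : q = q' := congr1 (@jr _ _ _) eF.
  have el : l = l' := congr1 (@jl _ _ _) eF.
  subst l' q'; have [ey ex] := join_ob_inv eF.
  have nF' : ~ F r m (JoinOb lr' y' (aug_map (yoneda (sval x)) a')) by rewrite -eF.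
  rewrite e e' ey (Prop_irrelevance lr lr').
  case: q lr lr' a a' {e e' E E'} eF nF nF' ex => [|q] lr lr' a a' eF nF nF' /= ex.
    by case: nF; left; left.
  have s1 : surj (a : op _ _).
    by apply: contrapT => ns; apply: nF; right; apply: nsurj_skel.
  have s2 : surj (a' : op _ _).
    by apply: contrapT => ns; apply: nF'; right; apply: nsurj_skel.
  by have [_ ->] := nd_uniq (svalP x) (svalP x) s1 s2 ex.
- move=> x; apply: (qcat_fib qA); rewrite ?KE //=.
  by rewrite /N; have := ltn_ord k; lia.
Qed.

Lemma slice_pr_fib : horn_fib true (slice_pr d).
Proof.
move=> n k k0 _; apply: slice_lifts => f _.
have [h hP] := lifts_pt f (join_horn_lifts k0).
exists (full_smap h) => m u hu; exact: hP.
Qed.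
End SliceFib.

Lemma fib_total (P Q : sset) (p : smap P Q) :
  horn_fib false p -> quasi_category Q -> quasi_category P.
Proof.
move=> hp /qcat_fib hQ; apply: fib_qcat => n k k0 kn f g _.
have [h hP] := lifts_pt (scomp p f) (hQ n k k0 kn).
have [|h' [h1 _]] := hp n k k0 kn f (full_smap h).
  by move=> m x; rewrite /= (hP m _ (svalP x)) /=; congr (p m (f m _)); apply: sub_ext.
by exists h'; split=> // m x; apply: op_ext => i; rewrite !ord1.
Qed.

Lemma fib_weak (P Q : sset) (p : smap P Q) : horn_fib true p -> horn_fib false p.
Proof. by move=> hp n k k0 kn; apply: hp. Qed.

Lemma slice_qcat (X A : sset) (d : smap X A) :
  quasi_category A -> quasi_category (slice d).
Proof. by move=> qA; apply: fib_total (qA); apply/fib_weak/slice_pr_fib. Qed.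

(** * Terminal vertices *)

Local Notation pt := (simplex 0).

Lemma pt_uniq m (x y : pt m) : x = y.
Proof. by apply: op_ext => i; rewrite !ord1. Qed.

Section Cone.
Variable n : nat.
Let eN : n.+1 + 1 = n.+2 := addn1 n.+1.

(* The isomorphism of Delta^(n+1) with the join of Delta^n and a point. *)
Definition cone_iso : smap (simplex n.+1) (join (simplex n) pt) :=
  yoneda (top eN (op_id 1 : pt 0)).

Lemma cone_isoE m (c : simplex n.+1 m) : exists l q (lr : l + q = m.+1)
  (y : aug (simplex n) l) (a : aug pt q),
  c = jop eN lr y a /\ cone_iso m c = JoinOb lr y a.
Proof.
have [l [q [lr [y [a [e E]]]]]] := act_top eN pt c.
exists l, q, lr, y, a; split=> //; rewrite [LHS](E (op_id 1 : pt 0)).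
by congr JoinOb; apply: aug_pt_uniq.
Qed.

Definition cone_inv_fun m (u : join (simplex n) pt m) : simplex n.+1 m :=
  jop eN (jlr u) (jy u) (jx u).

Lemma cone_invK m (u : join (simplex n) pt m) : cone_iso m (cone_inv_fun u) = u.
Proof.
rewrite [LHS]jop_top; case: u => l q lr y a /=.
by congr JoinOb; apply: aug_pt_uniq.
Qed.

Lemma cone_isoK m (c : simplex n.+1 m) : cone_inv_fun (cone_iso m c) = c.
Proof. by have [l [q [lr [y [a [-> ->]]]]]] := cone_isoE c. Qed.

Lemma cone_inv_subproof l m (a : op l.+1 m.+1) (u : join (simplex n) pt m) :
  cone_inv_fun (sact a u) = sact a (cone_inv_fun u).
Proof. by rewrite -[RHS]cone_isoK smap_nat cone_invK. Qed.
Definition cone_inv : smap (join (simplex n) pt) (simplex n.+1) := SMap cone_inv_subproof.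

(** The cone on the boundary of Delta^n is the horn of Delta^(n+1) at its last vertex, the cone
    point. This turns lifts against last horns into the trivial fibration of [slice_post_tfib]. *)
Lemma cone_joincl m (c : simplex n.+1 m) :
  joincl pt (bndc n) m (cone_iso m c) <-> hornc ord_max m c.
Proof.
have [l [q [lr [y [a [ec ->]]]]]] := cone_isoE c.
rewrite ec [hornc _ _ _]in_hornP; split.
  rewrite [joincl _ _ _ _]/= => h; have [j [jn hj]] : exists j, j < n.+1 /\ forall i, i < l -> augv y i != j.
    case: l lr y h {ec} => [|l] lr y /=; first by exists 0.
    case/bndcP/nsurjP => j [jn hj]; exists j; split=> // i _; exact: hj.
  exists j; split; first exact: ltnW.
    by rewrite neq_ltn jn.
  move=> i; rewrite jopE /jopv; case: ifP => [il|_]; first exact: hj.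
  by rewrite neq_ltn (leq_trans jn) ?leq_addr ?orbT.
case=> j [jn jm h]; rewrite [joincl _ _ _ _]/=; case: l lr y h {ec} => [|l] lr y h //.
rewrite [augc _ _]/=.
apply/bndcP/nsurjP; exists j; split; first by move: jn jm; rewrite -ltnS /=; lia.
move=> i; have im : i < m.+1 by have := ltn_ord i; lia.
by have := h (Ordinal im); rewrite jopE /jopv /= ltn_ord inord_val.
Qed.

Lemma cone_inlc m (c : simplex n.+1 m) :
  inlc (simplex n) pt m (cone_iso m c) <-> misses (c : op _ _) ord_max.
Proof.
have [l [q [lr [y [a [ec ->]]]]]] := cone_isoE c.
have E i : (jop eN lr y a i == ord_max) = (jopv y a i == n.+1).
  by rewrite -(inj_eq val_inj) -[val (jop _ _ _ _ _)]/(nat_of_ord (jop eN lr y a i)) jopE.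
rewrite ec; split=> [q0|/forallP h].
  have {}q0 : q = 0 := q0.
  apply/forallP => i; rewrite E /jopv.
  have -> : i < l by have := ltn_ord i; lia.
  by have := augv_lt y i; rewrite neq_ltn => ->.
change (q = 0); apply/eqP; apply/negPn/negP => q1; have lm : l < m.+1 by lia.
have := h (Ordinal lm); rewrite E /jopv /= ltnn subnn.
case: q a q1 {lr ec h E} => // q a _; have := augv_lt a 0.
by case: (augv a 0) => // _; rewrite addn0 eqxx.
Qed.

(** Adding the base to the cone on its boundary gives the whole boundary of Delta^(n+1). Hence
    terminality of t and the trivial fibration property of Q_{/t} -> Q are the same extension
    problems. *)
Lemma cone_bnd m (c : simplex n.+1 m) :
  orc (inlc (simplex n) pt) (joincl pt (bndc n)) m (cone_iso m c) <-> bndc n.+1 m c.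
Proof.
split=> [[/cone_inlc h|/cone_joincl/existsP[j /andP[_ h]]]|/existsP[j h]].
- by apply/existsP; exists ord_max.
- by apply/existsP; exists j.
have [e|ne] := eqVneq j ord_max; first by left; apply/cone_inlc; rewrite -e.
by right; apply/cone_joincl/existsP; exists j; rewrite ne.
Qed.

Lemma cone_iso_max m (x : pt m) : cone_iso m (op_const m.+1 ord_max) = join_inr _ pt m x.
Proof.
rewrite -[RHS]cone_invK; congr (cone_iso m _); apply: op_ext => i.
by rewrite mk_opE jopE /jopv /= subn0 [(x : op _ _) _]ord1 addn0.
Qed.
End Cone.

Section Terminal.
Variables (Q : sset) (t : Q 0).

Lemma terminal_tfib : terminal t -> tfib (slice_pr (yoneda t)).
Proof.
move=> ht n; apply: slice_lifts => f fd.
have nat l m (a : op l.+1 m.+1) (b : boundary n.+1 m) :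
    f l (exist _ (cone_iso n l (sval (sact a b))) (proj2 (cone_bnd (sval (sact a b)) ) (svalP (sact a b))))
    = sact a (f m (exist _ (cone_iso n m (sval b)) (proj2 (cone_bnd (sval b)) (svalP b)))).
  by rewrite -smap_nat; congr (f l _); apply: sub_ext; exact: (smap_nat (cone_iso n) a (sval b)).
have [|g gP] := ht n (@SMap (boundary n.+1) Q _ nat).
  move=> /=; have h : orc (inlc (simplex n) pt) (joincl pt (bndc n)) 0 (join_inr _ pt 0 (op_id 1)).
    by right.
  transitivity (f 0 (exist _ _ h)); last by rewrite fd /= sact_id.
  by congr (f 0 _); apply: sub_ext; apply: cone_iso_max.
exists (scomp g (cone_inv n)) => m u hu /=.
have hb : bndc n.+1 m (cone_inv n m u) by apply/cone_bnd; rewrite [cone_iso _ _ _]cone_invK.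
rewrite [LHS](gP m (exist _ _ hb)) /=; congr (f m _); apply: sub_ext.
exact: cone_invK.
Qed.

Lemma tfib_terminal : tfib (slice_pr (yoneda t)) -> terminal t.
Proof.
move=> ht n f ft; pose U := bndc n.
have bP m (w : join (sub U) pt m) : in_boundary (cone_inv n m (join_mapl pt (incl U) m w) : op _ _).
  apply/(cone_bnd (cone_inv n m _)); rewrite [cone_iso _ _ _]cone_invK; right.
  by case: w => [[|l] r lr y x] //; apply: (svalP y).
have bP' m (y : simplex n m) : in_boundary (cone_inv n m (join_inl _ pt m y) : op _ _).
  by apply/(cone_bnd (cone_inv n m _)); rewrite [cone_iso _ _ _]cone_invK; left.
pose bd m (b : simplex n.+1 m) (h : in_boundary (b : op m.+1 n.+2)) : boundary n.+1 m :=
  exist (fun b : op m.+1 n.+2 => in_boundary b) b h.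
have nat l m (a : op l.+1 m.+1) w : f l (bd _ _ (bP l (sact a w)))
    = sact a (f m (bd _ _ (bP m w))).
  by rewrite -smap_nat; congr (f l _); apply: sval_inj; exact: (smap_nat (scomp (cone_inv n) (join_mapl pt (incl U))) a w).
have nat' l m (a : op l.+1 m.+1) y : f l (bd _ _ (bP' l (sact a y)))
    = sact a (f m (bd _ _ (bP' m y))).
  by rewrite -smap_nat; congr (f l _); apply: sval_inj; exact: (smap_nat (scomp (cone_inv n) (join_inl _ pt)) a y).
(* The boundary of Delta^(n+1) splits into a cone, where f is [F], and the face opposite the cone
   point, where f is [v]. [F] transposes to a map from the boundary of Delta^n to Q_{/t}, lying over
   [v]. *)
pose F : smap (join (sub U) pt) Q := SMap nat.
pose v : smap (simplex n) Q := SMap nat'.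
have Fd : scomp F (join_inr (sub U) pt) = yoneda t.
  apply: smap_ext => m x /=; rewrite -ft -smap_nat; congr (f m _); apply: sval_inj.
  rewrite -[sval _]/(cone_inv n m (join_inr _ pt m x)) -(cone_iso_max n x).
  rewrite [LHS]cone_isoK.
  transitivity (op_comp (op_const 1 (@ord_max n.+1)) (x : op _ _)); last by [].
  by apply: op_ext => i; rewrite op_compE !mk_opE.
have [m y|h [h1 h2]] := lifts_full (f := slice_of Fd) (g := v) (ht n).
  by rewrite slice_pr_of; congr (f m _); apply: sval_inj.
exists (scomp (hat h) (cone_iso n)) => m x.
rewrite -[LHS]/(hat h m (cone_iso n m (sval x))).
have [/join_inlP[y e]|/joincl_incl[w e]] := proj2 (cone_bnd (sval x)) (svalP x).
  rewrite e hat_inl h2; congr (f m _); apply: sval_inj.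
  by rewrite -[LHS]/(cone_inv n m (join_inl _ pt m y)) -e [LHS]cone_isoK.
have hU : scomp h (incl U) = slice_of Fd.
  by apply: smap_ext => l y; rewrite /= (h1 _ _ (svalP y)); congr (slice_of Fd l _); apply: sub_ext.
rewrite -e -[LHS]/(scomp (hat h) (join_mapl pt (incl U)) m w) -hat_comp hU hat_slice_of.
congr (f m _); apply: sval_inj.
by rewrite -[LHS]/(cone_inv n m (join_mapl pt (incl U) m w)) e [LHS]cone_isoK.
Qed.
End Terminal.

(** * The map of slices induced by a right fibration *)

Section SlicePost.
Variables (X E B : sset) (d : smap X E) (p : smap E B).
Lemma slice_post_subproof n (s : slice d n) :
  scomp (scomp p (sval s)) (join_inr (simplex n) X) = scomp p d.
Proof. by rewrite -scompA (svalP s). Qed.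
Lemma slice_post_nat m n (a : op m.+1 n.+1) (s : slice d n) :
  (exist _ _ (slice_post_subproof (sact a s)) : slice (scomp p d) m)
  = sact a (exist _ _ (slice_post_subproof s) : slice (scomp p d) n).
Proof. by apply: slice_ext; apply: scompA. Qed.
Definition slice_post : smap (slice d) (slice (scomp p d)) :=
  @SMap (slice d) (slice (scomp p d)) (fun n s => exist _ _ (slice_post_subproof s))
    slice_post_nat.

Lemma hat_post (Y : sset) (k : smap Y (slice d)) :
  hat (scomp slice_post k) = scomp p (hat k).
Proof. by apply: smap_ext => n [[|l] r lr y x]. Qed.


Lemma slice_post_lifts (V : sset) (U : subc V) :
  lifts p (joincl X U) (fullc (join V X)) -> lifts slice_post U (fullc V).
Proof.
move=> L f g fg.
pose R n (u : sub (joincl X U) n) (v : E n) :=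
  exists w, sval u = join_mapl X (incl U) n w /\ v = hat f n w.
have fn n u v v' : R n u v -> R n u v' -> v = v'.
  move=> [w [e ->]] [w' [e' ->]]; congr (hat f n _).
  by apply: join_mapl_incl_inj; rewrite -e -e'.
have [|//|m n a u v [w [e ->]]|fS fSP] := @rel_smap (sub (joincl X U)) E R.
- by move=> n u; have [w e] := joincl_incl (svalP u); exists (hat f n w), w.
- by exists (sact a w); rewrite !smap_nat -e.
have pf : scomp p (hat f) = scomp (hat g) (join_mapl X (incl U)).
  rewrite -hat_post -hat_comp; congr hat; apply: smap_ext => n y; exact: fg.
have fSm n w hw : fS n (exist _ (join_mapl X (incl U) n w) hw) = hat f n w.
  by apply: fn (fSP _ _) _; exists w.
have [n u|h [h1 h2]] := lifts_full (f := fS) (g := hat g) L.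
  case: (fSP n u) => w [-> ->].
  exact: (congr1 (fun F : smap _ _ => F n w) pf).
have inS n w : joincl X U n (join_mapl X (incl U) n w).
  by case: w => [[|l] r lr y x] //; apply: (svalP y).
have hm n w : h n (join_mapl X (incl U) n w) = hat f n w by rewrite (h1 _ _ (inS n w)) fSm.
have hd : scomp h (join_inr V X) = d.
  apply: smap_ext => n x; transitivity (hat f n (join_inr (sub U) X n x)).
    exact: (hm n (join_inr (sub U) X n x)).
  exact: hat_inr.
exists (scomp (slice_of hd) (incl _)); split=> [n y hy hy'|n [y hy]].
  apply/slice_ext/smap_ext => m w; rewrite -(hat_mapl f (exist _ y hy : sub U n)) -hm.
  by congr (h m _); case: w => [[|l] r lr a x].
apply/slice_ext/smap_ext => m w.
by rewrite -[LHS]/(p m (h m _)) h2 hat_mapl.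
Qed.
End SlicePost.

(** Lifting a boundary inclusion against this map transposes to lifting its join with pt against p,
    and that join is the horn inclusion at the last vertex. *)
Lemma slice_post_tfib (E B : sset) (p : smap E B) (d : smap pt E) :
  horn_fib true p -> tfib (slice_post d p).
Proof.
move=> hp n; apply: slice_post_lifts.
apply: (lifts_iso (phi := cone_iso n) (psi := cone_inv n)).
- exact: cone_isoK.
- exact: cone_invK.
have -> : preimc (cone_iso n) (joincl pt (bndc n)) = hornc ord_max.
  by apply: subc_ext => m c; apply: cone_joincl.
have -> : preimc (cone_iso n) (fullc (join (simplex n) pt)) = fullc _ by apply: subc_ext.
exact: hp.
Qed.

(** * Homotopies *)

Local Notation I1 := (simplex 1).
Definition c0 m : I1 m := op_const m.+1 ord0.
Definition c1 m : I1 m := op_const m.+1 ord_max.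
Lemma c0E m i : (c0 m : op _ _) i = ord0. Proof. exact: mk_opE. Qed.
Lemma c1E m i : (c1 m : op _ _) i = ord_max. Proof. exact: mk_opE. Qed.

Lemma c0_neq_c1 m : c0 m <> c1 m.
Proof. by move=> e; have := @c1E m ord0; rewrite -e c0E. Qed.

Lemma const_act q (i : 'I_q) m n (a : op m.+1 n.+1) :
  op_comp (op_const n.+1 i) a = op_const m.+1 i.
Proof. by apply: op_ext => j; rewrite op_compE !mk_opE. Qed.

Lemma c0_act m n (a : op m.+1 n.+1) : sact a (c0 n) = c0 m.
Proof. exact: const_act. Qed.
Lemma c1_act m n (a : op m.+1 n.+1) : sact a (c1 n) = c1 m.
Proof. exact: const_act. Qed.

Lemma c1P m (c : I1 m) : (forall i, (c : op _ _) i = ord_max) -> c = c1 m.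
Proof. by move=> h; apply: op_ext => i; rewrite h ?c0E ?c1E. Qed.

(** The horn of Delta^1 at its last vertex is that vertex alone, so [prod_lifts] for n = k = 1 lifts
    homotopies backwards from the end 1. *)
Lemma horn_c1 m (c : I1 m) : hornc (ord_max : 'I_2) m c <-> c = c1 m.
Proof.
split=> [/in_hornP[j [j2 jm h]]|->].
  have j0 : j = 0 by move: j2 jm => /=; lia.
  apply: c1P => i; apply/val_inj; have := h i; rewrite j0.
  by have := ltn_ord ((c : op _ _) i) => /=; lia.
by apply/in_hornP; exists 0; split=> // i; rewrite c1E.
Qed.

Lemma lifts_rel (P Q : sset) (p : smap P Q) (T : sset) (S : subc T)
    (R : forall n, T n -> P n -> Prop) (g : smap T Q) :
  lifts p S (fullc T) ->
  (forall n x, S n x -> exists v, R n x v) ->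
  (forall n x v v', R n x v -> R n x v' -> v = v') ->
  (forall m n (a : op m.+1 n.+1) x v, R n x v -> R m (sact a x) (sact a v)) ->
  (forall n x v, R n x v -> p n v = g n x) ->
  exists h : smap T P, (forall n x v, S n x -> R n x v -> h n x = v)
    /\ (forall n x, p n (h n x) = g n x).
Proof.
move=> L tot fn nat pg.
have [|||f fP] := @rel_smap (sub S) P (fun n x v => R n (sval x) v).
- by move=> n x; apply: tot; apply: svalP.
- by move=> n x; apply: fn.
- by move=> m n a x v; apply: nat.
have [n x|h [h1 h2]] := lifts_full (f := f) (g := g) L; first by apply: pg; apply: fP.
exists h; split=> // n x v hx hv; rewrite (h1 _ _ hx).
exact: fn (fP n (exist _ x hx)) hv.
Qed.

Section CylLift.
Variables (P Q : sset) (p : smap P Q).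

Lemma cyl_lift (V : sset) (U : subc V) (f : smap (sprod I1 (sub U)) P)
    (f1 : smap V P) (g : smap (sprod I1 V) Q) : horn_fib true p ->
  (forall m y, f m (c1 m, y) = f1 m (sval y)) ->
  (forall m c y, p m (f m (c, y)) = g m (c, sval y)) ->
  (forall m y, p m (f1 m y) = g m (c1 m, y)) ->
  exists h : smap (sprod I1 V) P,
    [/\ forall m c (y : sub U m), h m (c, sval y) = f m (c, y),
        forall m y, h m (c1 m, y) = f1 m y & forall m x, p m (h m x) = g m x].
Proof.
move=> hp ff1 pf pf1.
pose R n (x : sprod I1 V n) (v : P n) := (exists y : sub U n, sval y = x.2 /\ v = f n (x.1, y))
  \/ (x.1 = c1 n /\ v = f1 n x.2).
have L := @prod_lifts true P Q p 1 ord_max V U hp isT isT.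
have [||||h [h1 h2]] := @lifts_rel P Q p _ _ R g L.
- move=> n [c y] [/horn_c1 /= ->|hy]; first by exists (f1 n y); right.
  by exists (f n (c, exist _ y hy)); left; exists (exist _ y hy).
- move=> n [c y] v v' [[y1 [/= e1 ->]]|[/= e1 ->]] [[y2 [/= e2 ->]]|[/= e2 ->]] //.
  + by congr (f n (c, _)); apply: sub_ext; rewrite e1 e2.
  + by rewrite e2 ff1 e1.
  + by rewrite e1 ff1 e2.
- move=> m n a [c y] v [[y1 [/= e1 ->]]|[/= e1 ->]]; [left | right].
    by exists (sact a y1); rewrite -smap_nat /= e1.
  by rewrite /= e1 -smap_nat; split=> //; apply: c1_act.
- move=> n [c y] v [[y1 [/= e1 ->]]|[/= e1 ->]]; first by rewrite pf e1.
  by rewrite pf1 e1.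
exists h; split=> // [m c y|m y]; apply: h1.
- by right; apply: svalP.
- by left; exists y.
- by left; apply/horn_c1.
- by right.
Qed.

Lemma endc_subproof (Y : sset) m n (a : op m.+1 n.+1) (x : sprod I1 Y n) :
  x.1 = c0 n \/ x.1 = c1 n -> (sact a x).1 = c0 m \/ (sact a x).1 = c1 m.
Proof. by case=> /= ->; [left; apply: c0_act | right; apply: c1_act]. Qed.
Definition endc (Y : sset) : subc (sprod I1 Y) := Subc (@endc_subproof Y).

(** [prod_lifts] for Delta^1 x Y relative to its two ends. The lifting direction is the first
    coordinate; the side at 0 of this coordinate is the one produced. *)
Lemma square_lift (Y : sset) (f0 f1 : smap (sprod I1 Y) P) (f : smap (sprod I1 Y) P)
    (g : smap (sprod I1 (sprod I1 Y)) Q) : horn_fib true p ->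
  (forall m y, f0 m (c1 m, y) = f m (c0 m, y)) ->
  (forall m y, f1 m (c1 m, y) = f m (c1 m, y)) ->
  (forall m c y, p m (f0 m (c, y)) = g m (c, (c0 m, y))) ->
  (forall m c y, p m (f1 m (c, y)) = g m (c, (c1 m, y))) ->
  (forall m x, p m (f m x) = g m (c1 m, x)) ->
  exists h : smap (sprod I1 (sprod I1 Y)) P,
    [/\ forall m c y, h m (c, (c0 m, y)) = f0 m (c, y),
        forall m c y, h m (c, (c1 m, y)) = f1 m (c, y) &
        forall m x, p m (h m x) = g m x].
Proof.
move=> hp e0 e1 p0 p1 pf.
pose R n (x : sprod I1 (sprod I1 Y) n) (v : P n) :=
  [\/ x.2.1 = c0 n /\ v = f0 n (x.1, x.2.2), x.2.1 = c1 n /\ v = f1 n (x.1, x.2.2)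
   | x.1 = c1 n /\ v = f n x.2].
have L := @prod_lifts true P Q p 1 ord_max (sprod I1 Y) (endc Y) hp isT isT.
have [||||h [h1 h2]] := @lifts_rel P Q p _ _ R g L.
- move=> n [c [i y]] [/horn_c1 /= ->|[/= ->|/= ->]].
  + by exists (f n (i, y)); apply: Or33.
  + by exists (f0 n (c, y)); apply: Or31.
  + by exists (f1 n (c, y)); apply: Or32.
- move=> n [c [i y]] v v' [] [/= E ->] [] [/= E' ->] //.
  + by case: (@c0_neq_c1 n); rewrite -E -E'.
  + by rewrite E' E e0.
  + by case: (@c0_neq_c1 n); rewrite -E -E'.
  + by rewrite E' E e1.
  + by rewrite E' E e0.
  + by rewrite E' E e1.
- move=> m n a [c [i y]] v [] [/= -> ->]; rewrite -smap_nat.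
  + by apply: Or31; split=> //; apply: c0_act.
  + by apply: Or32; split=> //; apply: c1_act.
  + by apply: Or33; split=> //; apply: c1_act.
- by move=> n [c [i y]] v [] [/= -> ->].
exists h; split=> // m c y; apply: h1.
- by right; left.
- by apply: Or31.
- by right; right.
- by apply: Or32.
Qed.

Lemma tfib_homotopy (Y : sset) (k0 k1 : smap Y P) (g : smap (sprod I1 Y) Q) : tfib p ->
  (forall m y, p m (k0 m y) = g m (c0 m, y)) ->
  (forall m y, p m (k1 m y) = g m (c1 m, y)) ->
  exists h : smap (sprod I1 Y) P,
    [/\ forall m y, h m (c0 m, y) = k0 m y,
        forall m y, h m (c1 m, y) = k1 m y & forall m x, p m (h m x) = g m x].
Proof.
move=> tp p0 p1.
pose R n (x : sprod I1 Y n) (v : P n) :=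
  (x.1 = c0 n /\ v = k0 n x.2) \/ (x.1 = c1 n /\ v = k1 n x.2).
have [|||||h [h1 h2]] := @lifts_rel P Q p _ (endc Y) R g.
- exact: tfib_lifts.
- move=> n [c y] [] /= ->; [exists (k0 n y) | exists (k1 n y)]; by [left | right].
- move=> n [c y] v v' [] [/= E ->] [] [/= E' ->] //;
  by case: (@c0_neq_c1 n); rewrite -E -E'.
- move=> m n a [c y] v [] [/= -> ->]; rewrite -smap_nat.
  + by left; split=> //; apply: c0_act.
  + by right; split=> //; apply: c1_act.
- by move=> n [c y] v [] [/= -> ->].
by exists h; split=> // m y; apply: h1; rewrite /R /=; by [left | right].
Qed.

Lemma tfib_lift (Y : sset) (g : smap Y Q) : tfib p ->
  exists h : smap Y P, forall m y, p m (h m y) = g m y.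
Proof.
move=> tp; have [|||||h [_ h2]] := @lifts_rel P Q p Y (emptyc Y) (fun _ _ _ => False) g.
- exact: tfib_lifts.
- by [].
- by [].
- by [].
- by [].
by exists h.
Qed.
End CylLift.

Section Collapse.
Variables Y X : sset.
Lemma collapse0 m (y : Y m) (x : X m) : collapse Y X m (c0 m, (y, x)) = join_inl Y X m y.
Proof.
have e : cutl (c0 m) 1 = m.+1 by apply: cutl_uniq => // i; rewrite c0E ltn_ord.
have e' : m.+1 - cutl (c0 m) 1 = 0 by rewrite e subnn.
apply: (join_ob_ext e e'); last exact: aug0_uniq.
congr (@aug_act Y _ m.+1 _ y); apply: op_ext => i.
by rewrite op_castE !mk_opE.
Qed.
Lemma collapse1 m (y : Y m) (x : X m) : collapse Y X m (c1 m, (y, x)) = join_inr Y X m x.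
Proof.
have e : cutl (c1 m) 1 = 0 by apply: cutl_uniq => // i; rewrite c1E.
have e' : m.+1 - cutl (c1 m) 1 = m.+1 by rewrite e subn0.
apply: (join_ob_ext e e'); first exact: aug0_uniq.
congr (@aug_act X _ m.+1 _ x); apply: op_ext => i.
by rewrite op_castE !mk_opE /= [X in X + _]e.
Qed.
End Collapse.

Lemma collapse_map (Y Y' X X' : sset) (f : smap Y Y') (g : smap X X') n c y x :
  join_map f g n (collapse Y X n (c, (y, x))) = collapse Y' X' n (c, (f n y, g n x)).
Proof. by congr JoinOb; rewrite (aug_map_nat f, aug_map_nat g). Qed.

Section ExpEdge.
Variables Y B : sset.
Implicit Types (e : sexp B Y 1) (g : smap Y B).

Lemma exp_src e g : (forall m y, (e : smap (sprod I1 Y) B) m (c0 m, y) = g m y) -> esrc e = vtx g.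
Proof.
move=> h; apply: smap_ext => m [b y] /=; rewrite -h; congr (_ m (_, y)).
by apply: op_ext => i; rewrite ?c0E ?c1E op_compE !mk_opE ord1.
Qed.
Lemma exp_tgt e g : (forall m y, (e : smap (sprod I1 Y) B) m (c1 m, y) = g m y) -> etgt e = vtx g.
Proof.
move=> h; apply: smap_ext => m [b y] /=; rewrite -h; congr (_ m (_, y)).
by apply: op_ext => i; rewrite ?c0E ?c1E op_compE !mk_opE ord1.
Qed.
Lemma src_exp e g : esrc e = vtx g -> forall m y, (e : smap (sprod I1 Y) B) m (c0 m, y) = g m y.
Proof.
move=> h m y; have := congr1 (fun F : sexp B Y 0 => (F : smap (sprod pt Y) B) m (op_const m.+1 ord0 : pt m, y)) h.
rewrite /= => <-; congr (_ m (_, y)).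
by apply: op_ext => i; rewrite ?c0E op_compE !mk_opE.
Qed.
Lemma tgt_exp e g : etgt e = vtx g -> forall m y, (e : smap (sprod I1 Y) B) m (c1 m, y) = g m y.
Proof.
move=> h m y; have := congr1 (fun F : sexp B Y 0 => (F : smap (sprod pt Y) B) m (op_const m.+1 ord0 : pt m, y)) h.
rewrite /= => <-; congr (_ m (_, y)).
by apply: op_ext => i; rewrite ?c1E op_compE !mk_opE.
Qed.
Lemma degen_exp g e : (forall m c y, (e : smap (sprod I1 Y) B) m (c, y) = g m y) ->
  e = degen0 (vtx g : sexp B Y 0).
Proof. by move=> h; apply: smap_ext => m [c y]; rewrite h. Qed.
End ExpEdge.


Section Square.
Variables (Y B : sset) (G : smap (sprod I1 (sprod I1 Y)) B).
Variables (el e0 e1 : sexp B Y 1) (g1 : smap Y B).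
Hypothesis elE : forall m c y, G m (c0 m, (c, y)) = (el : smap (sprod I1 Y) B) m (c, y).
Hypothesis e0E : forall m c y, G m (c, (c0 m, y)) = (e0 : smap (sprod I1 Y) B) m (c, y).
Hypothesis e1E : forall m c y, G m (c, (c1 m, y)) = (e1 : smap (sprod I1 Y) B) m (c, y).
Hypothesis g1E : forall m c y, G m (c1 m, (c, y)) = g1 m y.

Lemma hi_mono : {homo (fun i : 'I_3 => inord (minn i 1) : 'I_2) : i j / i <= j}.
Proof. by move=> [[|[|[|i]]] iP] [[|[|[|j]]] jP] //= _; rewrite ?inordK. Qed.
(** One of the two codegeneracies [2] -> [1]: the middle vertex goes to 1 here and to 0 under
    [op_lo]. *)
Definition op_hi : op 3 2 := mk_op hi_mono.
Lemma lo_mono : {homo (fun i : 'I_3 => inord i.-1 : 'I_2) : i j / i <= j}.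
Proof. by move=> [[|[|[|i]]] iP] [[|[|[|j]]] jP] //= _; rewrite ?inordK. Qed.
Definition op_lo : op 3 2 := mk_op lo_mono.

Lemma hi_face : [/\ op_comp op_hi (coface (inord 2)) = op_id 2,
  op_comp op_hi (coface (inord 0)) = op_const 2 ord_max &
  op_comp op_hi (coface (inord 1)) = op_id 2].
Proof.
by split; apply: op_ext => -[[|[|i]] iP] //;
  rewrite op_compE /op_hi !mk_opE /= ?inordK // op_idE.
Qed.
Lemma lo_face : [/\ op_comp op_lo (coface (inord 2)) = op_const 2 ord0,
  op_comp op_lo (coface (inord 0)) = op_id 2 &
  op_comp op_lo (coface (inord 1)) = op_id 2].
Proof.
by split; apply: op_ext => -[[|[|i]] iP] //;
  rewrite op_compE /op_lo !mk_opE /= ?inordK // op_idE.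
Qed.

Section Sigma.
Variables (Z : sset) (F : smap (sprod I1 (sprod I1 Z)) B) (a b : op 3 2).
Lemma sigma_subproof m n (c : op m.+1 n.+1) (x : sprod (simplex 2) Z n) :
  F m (op_comp a (sact c x).1, (op_comp b (sact c x).1, (sact c x).2))
  = sact c (F n (op_comp a x.1, (op_comp b x.1, x.2))).
Proof. by rewrite -smap_nat /= !op_compA. Qed.
Definition sigma : sexp B Z 2 := @SMap (sprod (simplex 2) Z) B
  (fun n x => F n (op_comp a x.1 : I1 n, (op_comp b x.1 : I1 n, x.2))) sigma_subproof.
Lemma sigma_face i m c z : (fc i sigma : smap (sprod I1 Z) B) m (c, z)
  = F m (op_comp (op_comp a (coface (inord i))) c,
      (op_comp (op_comp b (coface (inord i))) c, z)).
Proof. by rewrite /= !op_compA. Qed.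
End Sigma.

(** The two triangles of the square share the diagonal. One shows it to be the composite of el and
    e1; the other, having the constant side [g1] as second edge, shows it to be homotopic to e0. *)
Lemma square_hedge (x y z : ho (sexp B Y)) (h1 : esrc el = x) (h2 : etgt el = y)
    (h3 : esrc e1 = y) (h4 : etgt e1 = z) (h5 : esrc e0 = x) (h6 : etgt e0 = z) :
  mcomp (hedge h3 h4) (hedge h1 h2) = hedge h5 h6.
Proof.
have [hi2 hi0 hi1] := hi_face; have [lo2 lo0 lo1] := lo_face.
have t1 : tri el e1 (fc 1 (sigma G op_lo op_hi)).
  exists (sigma G op_lo op_hi); split=> //; apply: smap_ext => m [c w]; rewrite sigma_face.
    by rewrite lo2 hi2 const_act op_1comp elE.
  by rewrite lo0 hi0 const_act op_1comp e1E.
have t2 : tri e0 (degen0 (z : sexp B Y 0)) (fc 1 (sigma G op_lo op_hi)).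
  exists (sigma G op_hi op_lo); split; apply: smap_ext => m [c w]; rewrite sigma_face.
  - by rewrite lo2 hi2 const_act op_1comp e0E.
  - rewrite lo0 hi0 const_act op_1comp g1E -h4.
    have -> : etgt e1 = vtx g1 by apply: exp_tgt => l u; rewrite -e1E g1E.
    by [].
  - by rewrite sigma_face hi1 lo1.
have [_ s1 s2] := tri_bd t1.
rewrite (hedge_tri h1 h2 h3 h4 (etrans s1 h1) (etrans s2 h4) t1).
rewrite -(hedge_tri h5 h6 (degen_src _) (degen_tgt _) _ _ t2).
by rewrite hedge_degen m1comp.
Qed.
End Square.

(** * Edges of B^Y over a vertex of B *)

Definition cyl (Y : sset) n (c : I1 n) (y : Y n) : join Y pt n :=
  collapse Y pt n (c, (y, bang Y n y)).

Lemma cyl_map (Y Y' : sset) (f : smap Y Y') n c y :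
  join_mapl pt f n (@cyl Y n c y) = cyl c (f n y).
Proof. by congr JoinOb; rewrite (aug_map_nat f). Qed.

Lemma cyl_act (Y : sset) m n (a : op m.+1 n.+1) (c : I1 n) (y : Y n) :
  cyl (sact a c) (sact a y) = sact a (cyl c y).
Proof. by rewrite -smap_nat; congr (collapse Y pt m (_, (_, _))); apply: pt_uniq. Qed.

Section Over.
Variables (B : sset) (v : smap pt B).
Notation D := (slice v).
Notation q := (slice_pr v).

Lemma ev_subproof m n (a : op m.+1 n.+1) (x : sprod I1 D n) :
  hat (sid D) m (cyl (sact a x).1 (sact a x).2) = sact a (hat (sid D) n (cyl x.1 x.2)).
Proof. by rewrite -smap_nat; congr (hat _ m _); apply: cyl_act. Qed.
(* The homotopy from the projection B_{/v} -> B to the constant map at [v]. *)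
Definition ev : smap (sprod I1 D) B :=
  @SMap (sprod I1 D) B (fun n x => hat (sid D) n (cyl x.1 x.2)) ev_subproof.

Lemma ev0 n s : ev n (c0 n, s) = q n s.
Proof.
transitivity (hat (sid D) n (join_inl D pt n s)); last exact: hat_inl.
by congr (hat (sid D) n _); apply: collapse0.
Qed.
Lemma ev1 n s : ev n (c1 n, s) = v n (op_const n.+1 ord0).
Proof.
transitivity (hat (sid D) n (join_inr D pt n (bang D n s))); last exact: hat_inr.
by congr (hat (sid D) n _); apply: collapse1.
Qed.

Lemma ev_hat (Y : sset) (k : smap Y D) n c y : ev n (c, k n y) = hat k n (cyl c y).
Proof.
have -> : k = scomp (sid D) k by apply: smap_ext.
by rewrite hat_comp -[RHS]/(hat (sid D) n (join_mapl pt k n (cyl c y))) cyl_map.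
Qed.

Lemma evE n c (s : D n) : ev n (c, s) = sval s n (cyl c (op_id n.+1 : simplex n n)).
Proof.
rewrite -(hat_mapl (sid D)) cyl_map -[LHS]/(hat (sid D) n (cyl c s)).
by congr (hat (sid D) n (cyl c _)); rewrite [RHS](sact_id s).
Qed.

Lemma cst_subproof (Y : sset) n (y : Y n) :
  scomp (scomp v (bang (join (simplex n) pt))) (join_inr (simplex n) pt) = v.
Proof. by apply: smap_ext => m x /=; congr (v m _); apply: pt_uniq. Qed.
Lemma cst_nat (Y : sset) m n (a : op m.+1 n.+1) (y : Y n) :
  (exist _ _ (cst_subproof (sact a y)) : D m) = sact a (exist _ _ (cst_subproof y) : D n).
Proof. by apply: slice_ext; apply: smap_ext => l u; congr (v l _); apply: pt_uniq. Qed.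
(* Constant at the degenerate edge of the vertex [v]. *)
Definition cst (Y : sset) : smap Y D := @SMap Y D (fun n y => exist _ _ (cst_subproof y)) (@cst_nat Y).

Lemma ev_cst Y n c y : ev n (c, cst Y n y) = v n (op_const n.+1 ord0).
Proof. by rewrite evE /=; congr (v n _); apply: pt_uniq. Qed.
Lemma pr_cst Y n y : q n (cst Y n y) = v n (op_const n.+1 ord0).
Proof. by rewrite -ev0 ev_cst. Qed.

Section Contract.
Variable n : nat.
Lemma con_mono (c : I1 n) : {homo (fun i : 'I_n.+2 =>
  if i < cutl (c : op _ _) 1 then i else ord_max) : i j / i <= j}.
Proof.
move=> i j ij; case: ifP => h1; case: ifP => h2 //; last by lia.
by rewrite -ltnS.
Qed.
(** As an endomorphism of Delta^n * pt, it fixes the vertices where c is 0 and moves the others to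
    the cone point; precomposing with it gives [gamma]. *)
Definition con (c : I1 n) : op n.+2 n.+2 := mk_op (con_mono c).
Lemma conE (c : I1 n) i :
  con c i = (if i < cutl (c : op _ _) 1 then i : nat else n.+1) :> nat.
Proof. by rewrite mk_opE; case: ifP. Qed.

Definition opS m (a : op m.+1 n.+1) : op m.+2 n.+2 :=
  jop (addn1 n.+1) (addn1 m.+1) (a : aug (simplex n) m.+1) (op_id 1 : aug pt 1).
End Contract.
End Over.

Lemma opSE m n (a : op m.+1 n.+1) (i : 'I_m.+2) :
  opS a i = (if i < m.+1 then a (inord i) : nat else n.+1) :> nat.
Proof.
rewrite /opS jopE /jopv; case: ifP => // im.
have -> : i - m.+1 = 0 by have := ltn_ord i; lia.
by rewrite augv_id // addn0.
Qed.

Lemma opS_iso m n (a : op m.+1 n.+1) l (x : simplex m.+1 l) :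
  join_mapl pt (simplex_map a) l (cone_iso m l x) = cone_iso n l (op_comp (opS a) x : simplex _ _).
Proof.
rewrite -[cone_iso m l x]/(sact (x : op _ _) (top (addn1 m.+1) (op_id 1 : pt 0))) smap_nat.
rewrite -[RHS]/(sact (op_comp (opS a) x) (top (addn1 n.+1) (op_id 1 : pt 0))) sact_comp.
congr (sact _ _); rewrite /opS jop_top; congr JoinOb; last exact: aug_pt_uniq.
by rewrite /= op_comp1.
Qed.

Lemma opS_inv m n (a : op m.+1 n.+1) l (u : join (simplex m) pt l) :
  cone_inv n l (join_mapl pt (simplex_map a) l u) = op_comp (opS a) (cone_inv m l u) :> op _ _.
Proof.
rewrite -[RHS](cone_isoK (op_comp (opS a) (cone_inv m l u) : simplex _ _)).
by rewrite -opS_iso [cone_iso _ _ _]cone_invK.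
Qed.

Lemma con_opS m n (a : op m.+1 n.+1) (c : I1 n) :
  op_comp (con c) (opS a) = op_comp (opS a) (con (sact a c)).
Proof.
have cm := cutl_le (sact a c : op _ _) 1; have cn := cutl_le (c : op _ _) 1.
apply: op_ext => i; rewrite !op_compE conE (opSE a i); case: (ltnP i m.+1) => im.
  have -> : (a (inord i) < cutl (c : op _ _) 1) = (i < cutl (sact a c : op _ _) 1).
    have := inordK im; move: (inord i) => j <-; rewrite !cutl_lt.
    by rewrite -[(sact a c : op _ _) j]/(op_comp (c : op _ _) a j) op_compE.
  by rewrite (opSE a (con _ _)) conE; case: ifP => ic; rewrite ?im ?ltnn.
have -> : (n.+1 < cutl (c : op _ _) 1) = false by apply/negbTE; rewrite -leqNgt.
rewrite (opSE a (con _ _)) conE; have -> : (i < cutl (sact a c : op _ _) 1) = false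
  by apply/negbTE; rewrite -leqNgt (leq_trans cm).
by rewrite ltnn.
Qed.

Lemma con_max n (c : I1 n) m : op_comp (con c) (op_const m.+1 ord_max) = op_const m.+1 ord_max.
Proof. by apply: op_ext => i; rewrite op_compE conE !mk_opE; case: ifP. Qed.

Definition con_join n (c : I1 n) : smap (join (simplex n) pt) (join (simplex n) pt) :=
  scomp (cone_iso n) (scomp (simplex_map (con c)) (cone_inv n)).

Lemma con_join_inr n (c : I1 n) m x : con_join c m (join_inr (simplex n) pt m x) = join_inr _ pt m x.
Proof.
rewrite -[LHS]/(cone_iso n m (op_comp (con c) (cone_inv n m (join_inr _ pt m x)) : simplex _ _)).
by rewrite -{1}(cone_iso_max n x) [cone_inv _ _ _]cone_isoK con_max (cone_iso_max n x).
Qed.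

Lemma con_join_map m n (a : op m.+1 n.+1) (c : I1 n) l u :
  join_mapl pt (simplex_map a) l (con_join (sact a c) l u)
  = con_join c l (join_mapl pt (simplex_map a) l u).
Proof.
rewrite [LHS]opS_iso -[RHS]/(cone_iso n l (op_comp (con c) (cone_inv n l (join_mapl pt (simplex_map a) l u)) : simplex _ _)).
by rewrite opS_inv !op_compA con_opS.
Qed.

Lemma con_join0 n l u : con_join (c0 n) l u = u.
Proof.
rewrite -[RHS](cone_invK u) -[LHS]/(cone_iso n l (op_comp (con (c0 n)) (cone_inv n l u) : simplex _ _)).
congr (cone_iso n l _); apply: op_ext => i; rewrite op_compE mk_opE.
have -> : cutl (c0 n) 1 = n.+1 by apply: cutl_uniq => // j; rewrite c0E ltn_ord.
by case: ifP => // h; have := ltn_ord (cone_inv n l u i); rewrite /=; move: h => /=; lia.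
Qed.

Lemma con_join1 n l u : con_join (c1 n) l u = join_inr (simplex n) pt l (bang _ l u).
Proof.
rewrite -[LHS]/(cone_iso n l (op_comp (con (c1 n)) (cone_inv n l u) : simplex _ _)).
rewrite -(cone_iso_max n (bang _ l u)); congr (cone_iso n l _); apply: op_ext => i.
rewrite op_compE !mk_opE.
have -> : cutl (c1 n) 1 = 0 by apply: cutl_uniq => // j; rewrite c1E.
by [].
Qed.

Lemma cone_invE n m (u : join (simplex n) pt m) i :
  (cone_inv n m u : op _ _) i = (if i < jl u then augv (jy u) i else n.+1) :> nat.
Proof.
rewrite [LHS](jopE (addn1 n.+1) (jlr u) (jy u) (jx u)) /jopv; case: ifP => // _.
by have := augv_lt (jx u) (i - jl u); case: augv => // _; rewrite addn0.
Qed.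

Lemma con_join_inl n (c : I1 n) :
  con_join c n (join_inl (simplex n) pt n (op_id n.+1)) = cyl c (op_id n.+1 : simplex n n).
Proof.
rewrite -[RHS](cone_invK (cyl c (op_id n.+1 : simplex n n))).
rewrite -[LHS]/(cone_iso n n (op_comp (con c) (cone_inv n n (join_inl (simplex n) pt n (op_id n.+1))) : simplex _ _)).
congr (cone_iso n n _); apply: op_ext => i; rewrite op_compE conE !cone_invE.
rewrite ltn_ord augv_id ?ltn_ord //; case: (ltnP i (cutl (c : op _ _) 1)) => h //.
set u := cyl c _; rewrite -[jy u]/(aug_act (inl_op (c : op _ _) 1) (op_id n.+1 : aug (simplex n) n.+1)).
by rewrite -[i : nat]/(Ordinal h : nat) augv_act augv_id ?ltn_ord // mk_opE.
Qed.

Section Over2.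
Variables (B : sset) (v : smap pt B).
Notation D := (slice v).
Notation q := (slice_pr v).

Lemma gamma_ok n (c : I1 n) (s : D n) : scomp (scomp (sval s) (con_join c)) (join_inr _ pt) = v.
Proof.
apply: smap_ext => m x; rewrite -[LHS]/(sval s m (con_join c m (join_inr _ pt m x))).
by rewrite con_join_inr slice_inr.
Qed.
Lemma gamma_subproof m n (a : op m.+1 n.+1) (x : sprod I1 D n) :
  (exist _ _ (gamma_ok (sact a x).1 (sact a x).2) : D m)
  = sact a (exist _ _ (gamma_ok x.1 x.2) : D n).
Proof.
case: x => c s; apply/slice_ext/smap_ext => l u.
by congr (sval s l _); apply: con_join_map.
Qed.
(* The contraction of B_{/v} onto the terminal vertex; it lies over [ev]. *)
Definition gamma : smap (sprod I1 D) D :=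
  @SMap (sprod I1 D) D (fun n x => exist _ _ (gamma_ok x.1 x.2)) gamma_subproof.

Lemma gamma0 n s : gamma n (c0 n, s) = s.
Proof. by apply/slice_ext/smap_ext => l u; congr (sval s l _); apply: con_join0. Qed.
Lemma gamma1 n s : gamma n (c1 n, s) = cst v D n s.
Proof.
apply/slice_ext/smap_ext => l u; rewrite -[LHS]/(sval s l (con_join (c1 n) l u)).
by rewrite con_join1 slice_inr.
Qed.
Lemma pr_gamma n x : q n (gamma n x) = ev v n x.
Proof. by case: x => c s; rewrite evE -con_join_inl. Qed.

Section Psi.
Variable Y : sset.
Implicit Types k : smap Y D.

(* A map Y -> B_{/v} as an edge of B^Y ending at the constant map at [v]. *)
Definition psi k : sexp B Y 1 := scomp (ev v) (sprod_map (sid I1) k).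

Lemma psiE k m c y : (psi k : smap (sprod I1 Y) B) m (c, y) = ev v m (c, k m y).
Proof. by []. Qed.
Lemma psi_src k : esrc (psi k) = vtx (scomp q k).
Proof. by apply: exp_src => m y; rewrite psiE ev0. Qed.
Lemma psi_tgt k : etgt (psi k) = vtx (scomp v (bang Y)).
Proof. by apply: exp_tgt => m y; rewrite psiE ev1. Qed.

(** The square to which [square_hedge] applies is [ev] after H: its sides are q H, [psi k0],
    [psi k1] and the constant at v. *)
Lemma psi_comp (H : smap (sprod I1 Y) D) k0 k1 (x y z : ho (sexp B Y))
    (e : sexp B Y 1) (h1 : esrc e = x) (h2 : etgt e = y)
    (h3 : esrc (psi k1) = y) (h4 : etgt (psi k1) = z)
    (h5 : esrc (psi k0) = x) (h6 : etgt (psi k0) = z) :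
  (forall m y, H m (c0 m, y) = k0 m y) -> (forall m y, H m (c1 m, y) = k1 m y) ->
  (forall m c y, (e : smap (sprod I1 Y) B) m (c, y) = q m (H m (c, y))) ->
  mcomp (hedge h3 h4) (hedge h1 h2) = hedge h5 h6.
Proof.
move=> H0 H1 He.
apply: (@square_hedge Y B (scomp (ev v) (sprod_map (sid I1) H)) e (psi k0) (psi k1)
  (scomp v (bang Y))).
- by move=> m c w; rewrite He -ev0.
- by move=> m c w; rewrite psiE -H0.
- by move=> m c w; rewrite psiE -H1.
- by move=> m c w; rewrite [LHS]ev1.
Qed.

Lemma psi_homotopy (H : smap (sprod I1 Y) D) k0 k1 (g : smap Y B) (x z : ho (sexp B Y))
    (h3 : esrc (psi k1) = x) (h4 : etgt (psi k1) = z)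
    (h5 : esrc (psi k0) = x) (h6 : etgt (psi k0) = z) :
  (forall m y, H m (c0 m, y) = k0 m y) -> (forall m y, H m (c1 m, y) = k1 m y) ->
  (forall m c y, q m (H m (c, y)) = g m y) ->
  hedge h3 h4 = hedge h5 h6.
Proof.
move=> H0 H1 Hg.
have xg : x = vtx g.
  by rewrite -h5 psi_src; congr vtx; apply: smap_ext => m y; rewrite /= -H0 [LHS]Hg.
have eg : (scomp g (spr2 I1 Y) : sexp B Y 1) = degen0 (x : sexp B Y 0).
  by rewrite xg; apply: degen_exp.
have s1 : esrc (degen0 (x : sexp B Y 0)) = x := degen_src _.
have t1 : etgt (degen0 (x : sexp B Y 0)) = x := degen_tgt _.
rewrite -(psi_comp s1 t1 h3 h4 h5 h6 H0 H1); last by move=> m c y; rewrite Hg -eg.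
by rewrite hedge_degen mcomp1.
Qed.

Hypothesis qB : quasi_category B.

(** The homotopy e is lifted backwards from the constant map [cst] at its end 1, and k is the start
    of the lift. By [psi_comp] the class of e followed by that of [psi (cst v Y)], an identity, is
    that of [psi k]. *)
Lemma psi_surj (e : sexp B Y 1) (g : smap Y B) :
  esrc e = vtx g -> etgt e = vtx (scomp v (bang Y)) ->
  exists k, scomp q k = g /\
    forall (x y : ho (sexp B Y)) (h1 : esrc e = x) (h2 : etgt e = y)
      (h3 : esrc (psi k) = x) (h4 : etgt (psi k) = y), hedge h1 h2 = hedge h3 h4.
Proof.
move=> es et.
have hf := slice_pr_fib (d := v) qB.
pose none := @SMap (sprod I1 (sub (emptyc Y))) D
  (fun n x => False_rect _ (svalP x.2)) (fun m n a x => False_ind _ (svalP x.2)).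
have [|||H [_ H1 H2]] := @cyl_lift D B q Y (emptyc Y) none (cst v Y) e hf.
- by move=> m [].
- by move=> m c [].
- by move=> m y; rewrite pr_cst (tgt_exp et) /=; congr (v m _); apply: pt_uniq.
have kN m n (a : op m.+1 n.+1) (y : Y n) : H m (c0 m, sact a y) = sact a (H n (c0 n, y)).
  by rewrite -smap_nat /= -[op_comp (c0 n) a]/(sact a (c0 n)) c0_act.
pose k : smap Y D := SMap kN.
exists k; split.
  by apply: smap_ext => n y; rewrite /= [LHS]H2 (src_exp es).
move=> x y h1 h2 h3 h4.
have s1 : esrc (psi (cst v Y)) = y.
  rewrite -h2 et psi_src; congr vtx; apply: smap_ext => m w.
  by rewrite [LHS]pr_cst; congr (v m _); apply: pt_uniq.
have t1 : etgt (psi (cst v Y)) = y by rewrite psi_tgt -et.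
rewrite -(@psi_comp H k (cst v Y) _ _ _ _ h1 h2 s1 t1 h3 h4) //.
have E : psi (cst v Y) = degen0 (y : sexp B Y 0).
  rewrite -h2 et; apply: degen_exp => m c w; rewrite psiE ev_cst.
  by congr (v m _); apply: pt_uniq.
move: s1 t1; rewrite E => s1 t1.
by rewrite hedge_degen m1comp.
Qed.

(** Equality of classes gives a 2-simplex of B^Y with edges: degenerate, [psi k'], [psi k]. Spread
    over a square and lifted to B_{/v}, it becomes a homotopy over g. *)
Lemma psi_inj k k' (x y : ho (sexp B Y)) (h1 : esrc (psi k) = x) (h2 : etgt (psi k) = y)
    (h3 : esrc (psi k') = x) (h4 : etgt (psi k') = y) (g : smap Y B) :
  scomp q k = g -> hedge h1 h2 = hedge h3 h4 ->
  exists H : smap (sprod I1 Y) D,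
    [/\ forall m y, H m (c0 m, y) = k m y, forall m y, H m (c1 m, y) = k' m y &
        forall m c y, q m (H m (c, y)) = g m y].
Proof.
move=> qk E; have hf := slice_pr_fib (d := v) qB.
have [s [s2 s0 s1]] := hedge_homotopic (exp_qcat (Y := Y) qB) E.
have xg : x = vtx g by rewrite -h1 psi_src qk.
(* [chi] maps the square onto Delta^2 and collapses the side j = 1 to the vertex 2. The sides i = 0,
   i = 1, j = 0 go to the edges 02, 12, 01. *)
pose chi (i j : 'I_2) : 'I_3 := if j == ord_max then ord_max else inord i.
have op_m l (a b : op l.+1 2) : {homo (fun t => chi (a t) (b t)) : t u / t <= u}.
  move=> t u tu; rewrite /chi; have := op_le a tu; have := op_le b tu.
  case: (b t) => [[|[|bt]] btP] //; case: (b u) => [[|[|bu]] buP] //=;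
  case: (a t) => [[|[|at_]] atP] //; case: (a u) => [[|[|au]] auP] //=; by rewrite ?inordK.
pose G0 n (w : sprod I1 (sprod I1 Y) n) : B n :=
  (s : smap (sprod (simplex 2) Y) B) n (mk_op (op_m n w.2.1 w.1) : simplex 2 n, w.2.2).
have GN m n (a : op m.+1 n.+1) (w : sprod I1 (sprod I1 Y) n) : G0 m (sact a w) = sact a (G0 n w).
  rewrite /G0 -smap_nat; congr (_ m (_, _)); apply: op_ext => t.
  transitivity (nat_of_ord (op_comp (mk_op (op_m n w.2.1 w.1)) a t)); last by [].
  by rewrite op_compE !mk_opE; congr (nat_of_ord (chi _ _)).
pose G : smap (sprod I1 (sprod I1 Y)) B := SMap GN.
have face_s i m c w : (fc i s : smap (sprod I1 Y) B) m (c, w)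
  = (s : smap (sprod (simplex 2) Y) B) m (op_comp (coface (inord i)) (c : op _ _) : simplex 2 m, w) by [].
have Gi0 m c w : G m (c, (c0 m, w)) = ev v m (c, k m w).
  rewrite -psiE -s1 face_s; congr (_ m (_, w)); apply: op_ext => t.
  rewrite op_compE !mk_opE /= /chi ?c0E /bump inordK //.
  by case: ((c : op _ _) t) => [[|[|ct]] ctP] //=; rewrite inordK.
have Gi1 m c w : G m (c, (c1 m, w)) = ev v m (c, k' m w).
  rewrite -psiE -s0 face_s; congr (_ m (_, w)); apply: op_ext => t.
  rewrite op_compE !mk_opE /= /chi ?c1E /bump inordK //.
  by case: ((c : op _ _) t) => [[|[|ct]] ctP] //=; rewrite inordK.
have Gj0 m i w : G m (c0 m, (i, w)) = g m w.
  have : (fc 2 s : smap (sprod I1 Y) B) m (i, w) = g m w by rewrite s2 xg.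
  move=> <-; rewrite face_s; congr (_ m (_, w)); apply: op_ext => t.
  rewrite op_compE !mk_opE /= /chi ?c0E /bump inordK //=.
  by case: ((i : op _ _) t) => [[|[|ct]] ctP] //=; rewrite inordK.
have Gj1 m i w : G m (c1 m, (i, w)) = v m (op_const m.+1 ord0).
  have e : etgt (psi k) = vtx (scomp v (bang Y)) := psi_tgt k.
  have := tgt_exp e w; rewrite -s1 face_s /= => <-; congr (_ m (_, w)); apply: op_ext => t.
  by rewrite op_compE !mk_opE /= /chi ?c1E /bump inordK.
(* [gamma] contracts both k and k' onto [cst]; these contractions are the prescribed sides, and the
   side of the lift at 0 joins k to k'. *)
have [|||||h [H0 H1 H2]] := @square_lift D B q Y
  (scomp gamma (sprod_map (sid I1) k)) (scomp gamma (sprod_map (sid I1) k'))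
  (cst v (sprod I1 Y)) G hf.
- by move=> m w; rewrite [LHS]gamma1; apply: slice_ext.
- by move=> m w; rewrite [LHS]gamma1; apply: slice_ext.
- by move=> m c w; rewrite [LHS]pr_gamma Gi0.
- by move=> m c w; rewrite [LHS]pr_gamma Gi1.
- by move=> m [i w]; rewrite pr_cst Gj1.
have HN m n (a : op m.+1 n.+1) (w : sprod I1 Y n) : h m (c0 m, sact a w) = sact a (h n (c0 n, w)).
  by rewrite -smap_nat /= -[op_comp (c0 n) a]/(sact a (c0 n)) c0_act.
exists (SMap HN); split=> [m w|m w|m c w] /=.
- by rewrite H0 [LHS]gamma0.
- by rewrite H1 [LHS]gamma0.
- by rewrite [LHS]H2 Gj0.
Qed.
End Psi.
End Over2.

(** * From a cone in A^X to a map out of the join *)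

Definition omin n (A : pred 'I_n.+1) : 'I_n.+1 := rev_ord (omax (fun i => A (rev_ord i))).

Lemma eq_omin n (A B : pred 'I_n.+1) : A =1 B -> omin A = omin B.
Proof. by move=> AB; rewrite /omin (@eq_omax _ _ (fun i => B (rev_ord i))). Qed.

Lemma ominP n (A : pred 'I_n.+1) i0 : A i0 ->
  A (omin A) /\ forall i, A i -> omin A <= i.
Proof.
move=> Ai0; have [|h1 h2] := @omaxP n (fun i => A (rev_ord i)) (rev_ord i0).
  by rewrite rev_ordK.
split=> // i Ai; have := h2 (rev_ord i); rewrite rev_ordK => /(_ Ai) /=.
by have := ltn_ord i; move: (omax _ : nat) => w; lia.
Qed.

(* In the grid with the corner (M, 0) removed, the last point (i, 0) of a chain on
   the bottom row is followed in column i + 1 by a least point (i + 1, j), j > 0;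
   the pairing adds or removes (i, j), which lies strictly between the two. *)
Section CornerGrid.
Variables (M N : nat).
Notation G := ('I_M.+1 * 'I_N.+1)%type.
Implicit Types D E : {set G}.

Definition cg_SS D : Prop :=
  (exists i : 'I_M.+1, forall g, g \in D -> g.1 != i) \/
  (exists j : 'I_N.+1, forall g, g \in D -> g.2 != j).
Definition cg_TT D : Prop := (ord_max, ord0) \notin D.

Definition cg_i0 D := omax (fun i => (i, ord0) \in D).
Definition cg_i1 D : 'I_M.+1 := inord (cg_i0 D).+1.
Definition cg_j D := omin (fun j => (cg_i1 D, j) \in D).
Definition cg_v D : G := (cg_i0 D, cg_j D).
Definition cg_row D := [set g in D | g.2 == ord0].
Definition cg_right D := [set g in D | cg_i0 D < g.1].
(** Lexicographic again. Removing w from a larger member so as to leave a smaller one requires w on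
    the bottom row, which lowers the first count though it may raise the second, or w in the column
    [cg_i1], which keeps the first and lowers the second. *)
Definition cg_mu D := #|cg_row D| * #|{: G}|.+1 + #|cg_right D|.

Definition cg_adm := adm cg_SS cg_TT.

Lemma cg_onto D : ~ cg_SS D ->
  (forall i, exists j, (i, j) \in D) /\ (forall j, exists i, (i, j) \in D).
Proof.
move=> nD; split=> [i|j]; apply: contrapT => h; apply: nD; [left; exists i | right; exists j];
  move=> [i' j'] gD; apply/eqP => /= e; subst; apply: h; by [exists j' | exists i'].
Qed.

Lemma cg_i0P D : cg_adm D -> (cg_i0 D, ord0) \in D /\
  forall i, (i, ord0) \in D -> i <= cg_i0 D.
Proof.
case=> _ _ /cg_onto[_ /(_ ord0)[i iD]].
exact: (@omaxP _ (fun i => (i, ord0) \in D) i).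
Qed.

Lemma cg_i1E D : cg_adm D -> cg_i1 D = (cg_i0 D).+1 :> nat.
Proof.
move=> aD; have [i0D _] := cg_i0P aD; case: aD => _ tD _.
rewrite inordK // ltnS ltn_neqAle -[X in _ <= X]/((ord_max : 'I_M.+1) : nat).
rewrite -ltnS (ltn_ord _) andbT; apply/eqP => e; case/negP: tD.
by have -> : ord_max = cg_i0 D by apply: val_inj.
Qed.

Lemma cg_jP D : cg_adm D -> (cg_i1 D, cg_j D) \in D /\
  forall j, (cg_i1 D, j) \in D -> cg_j D <= j.
Proof.
case=> _ _ /cg_onto[/(_ (cg_i1 D))[j jD] _].
exact: (@ominP _ (fun j => (cg_i1 D, j) \in D) j).
Qed.

Lemma cg_j0 D : cg_adm D -> cg_j D != ord0.
Proof.
move=> aD; have [jD _] := cg_jP aD; have [_ i0m] := cg_i0P aD.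
by apply/eqP => e; move: jD; rewrite e => /i0m; rewrite cg_i1E // ltnn.
Qed.

Lemma cg_i10 D : cg_adm D -> cg_i1 D != cg_i0 D.
Proof. by move=> aD; rewrite -val_eqE /= cg_i1E // neq_ltn ltnSn orbT. Qed.

Lemma cg_i0E D E : (forall i, ((i, ord0) \in D) = ((i, ord0) \in E)) -> cg_i0 D = cg_i0 E.
Proof. exact: eq_omax. Qed.

Lemma cg_vE D E : (forall i, ((i, ord0) \in D) = ((i, ord0) \in E)) ->
  (forall j, ((cg_i1 D, j) \in D) = ((cg_i1 D, j) \in E)) -> cg_v D = cg_v E.
Proof.
move=> h1 h2; have e := cg_i0E h1; rewrite /cg_v e; congr pair.
by rewrite /cg_j; apply: eq_omin => j; rewrite h2 /cg_i1 e.
Qed.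

Lemma cg_rowU D : cg_adm D -> forall i, ((i, ord0) \in cg_v D |: D) = ((i, ord0) \in D).
Proof. by move=> aD i; rewrite !inE xpair_eqE [ord0 == _]eq_sym (negPf (cg_j0 aD)) andbF. Qed.
Lemma cg_rowD D : cg_adm D -> forall i, ((i, ord0) \in D :\ cg_v D) = ((i, ord0) \in D).
Proof. by move=> aD i; rewrite !inE xpair_eqE [ord0 == _]eq_sym (negPf (cg_j0 aD)) andbF. Qed.
Lemma cg_colU D : cg_adm D -> forall j, ((cg_i1 D, j) \in cg_v D |: D) = ((cg_i1 D, j) \in D).
Proof. by move=> aD j; rewrite !inE xpair_eqE (negPf (cg_i10 aD)). Qed.
Lemma cg_colD D : cg_adm D -> forall j, ((cg_i1 D, j) \in D :\ cg_v D) = ((cg_i1 D, j) \in D).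
Proof. by move=> aD j; rewrite !inE xpair_eqE (negPf (cg_i10 aD)). Qed.

Lemma cg_muE D E : (forall i, ((i, ord0) \in D) = ((i, ord0) \in E)) ->
  (forall g : G, cg_i0 D < g.1 -> (g \in D) = (g \in E)) -> cg_mu D = cg_mu E.
Proof.
move=> h1 h2; have e1 : cg_row D = cg_row E.
  apply/setP => -[i j]; rewrite !inE /=.
  by case: (eqVneq j ord0) => [->|]; rewrite ?andbF // h1.
have e2 : cg_right D = cg_right E.
  apply/setP => g; rewrite !inE -(cg_i0E h1).
  by case: (ltnP (cg_i0 D) g.1) => h; rewrite ?andbF // h2.
by rewrite /cg_mu e1 e2.
Qed.

Lemma cg_SSd D E : D \subset E -> cg_SS E -> cg_SS D.
Proof.
move=> /subsetP DE [[i h]|[j h]]; [left; exists i | right; exists j] => g /DE; exact: h.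
Qed.

Variables (P Q : sset) (p : smap P Q).
Hypothesis hp : horn_fib false p.

Lemma corner_grid_lifts (S S' : subc (sprod (simplex M) (simplex N))) :
  (forall l (x : sprod (simplex M) (simplex N) l), S l x <-> cg_TT (gim x) /\ cg_SS (gim x)) ->
  (forall l (x : sprod (simplex M) (simplex N) l), S' l x <-> cg_TT (gim x)) ->
  lifts p S S'.
Proof.
move=> SE S'E.
apply: (@grid_lifts M N cg_SS cg_TT cg_v cg_mu false (#|{: G}| * #|{: G}|.+1 + #|{: G}|)) => //.
- exact: cg_SSd.
- by move=> D E /subsetP DE; apply: contra => /DE.
- by move=> D; rewrite leq_add ?max_card // leq_mul2r max_card orbT.
- move=> D aD; symmetry; apply: cg_vE => [i|j]; first by rewrite cg_rowU.
  by rewrite cg_colU.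
- move=> D aD; symmetry; apply: cg_vE => [i|j]; first by rewrite cg_rowD.
  by rewrite cg_colD.
- move=> D aD; symmetry; apply: cg_muE => [i|[i j] /= h]; first by rewrite cg_rowU.
  by rewrite !inE xpair_eqE; case: eqP h => //= ->; rewrite ltnn.
- move=> D aD; symmetry; apply: cg_muE => [i|[i j] /= h]; first by rewrite cg_rowD.
  by rewrite !inE xpair_eqE; case: eqP h => //= ->; rewrite ltnn.
- move=> D aD; have [jD jm] := cg_jP aD; have i1E := cg_i1E aD; have [cD _ _] := aD.
  have cmp g : g \in D -> gle g (cg_v D) || gle (cg_v D) g.
    move=> gD; case/orP: (cD _ _ gD jD) => /andP[/= h1 h2]; last first.
      by apply/orP; right; rewrite /gle /= h2 andbT; apply: leq_trans h1; rewrite i1E.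
    move: h1; rewrite leq_eqVlt => /orP[/eqP/val_inj h1|h1]; last first.
      by apply/orP; left; rewrite /gle /= h2 andbT -ltnS -i1E.
    have := jm g.2; rewrite -h1 -surjective_pairing => /(_ gD) h3.
    by apply/orP; right; rewrite /gle /= h3 andbT h1 i1E.
  move=> g h; rewrite !inE => /orP[/eqP ->|gD] /orP[/eqP ->|hD].
  + by rewrite gle_refl.
  + by rewrite orbC cmp.
  + by rewrite cmp.
  + exact: cD.
- move=> D aD; have [_ tD _] := aD.
  by rewrite /cg_TT !inE negb_or tD andbT xpair_eqE [ord0 == _]eq_sym (negPf (cg_j0 aD)) andbF.
- move=> D aD; have [jD jm] := cg_jP aD; have [i0D _] := cg_i0P aD.
  have [_ _ nD] := aD; have [ex1 ex2] := cg_onto nD.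
  case=> [[i h]|[j h]].
    have [j ij] := ex1 i; have [e|ne] := eqVneq (i, j) (cg_v D).
      have := h (cg_i0 D, ord0); rewrite cg_rowD // i0D => /(_ isT) /=.
      by case: e => -> _; rewrite eqxx.
    by have := h (i, j); rewrite !inE ne ij eqxx => /(_ isT).
  have [i ij] := ex2 j; have [e|ne] := eqVneq (i, j) (cg_v D).
    have := h (cg_i1 D, cg_j D); rewrite cg_colD // jD => /(_ isT) /=.
    by case: e => _ ->; rewrite eqxx.
  by have := h (i, j); rewrite !inE ne ij eqxx => /(_ isT).
- move=> D aD; have [i0D _] := cg_i0P aD; exists (cg_i0 D, ord0) => //.
  by rewrite /gle /= leqnn /= leqn0; apply: cg_j0.
- move=> D aD; right; have [jD _] := cg_jP aD; exists (cg_i1 D, cg_j D) => //.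
  by rewrite /gle /= cg_i1E // ltnn.
- move=> E w aE vE wE wv nS vw.
  have lexi (a b d e f : nat) : a < b -> d <= f -> a * f.+1 + d < b * f.+1 + e.
    by move=> ab df; have : a.+1 * f.+1 <= b * f.+1 by [rewrite leq_mul2r ab orbT]; rewrite mulSn; lia.
  have [w0|w0] := eqVneq w.2 ord0.
    rewrite /cg_mu; apply: lexi; last exact: max_card.
    have -> : cg_row (E :\ w) = cg_row E :\ w by apply/setP => g; rewrite !inE andbA.
    by rewrite [X in _ < X](cardsD1 w) !inE wE w0 eqxx.
  have row i : ((i, ord0) \in E :\ w) = ((i, ord0) \in E).
    by rewrite !inE; case: eqP => // e; rewrite -e eqxx in w0.
  have i0E := cg_i0E row.
  have w1 : cg_i1 E = w.1.
    apply/eqP; apply/negPn/negP => ne.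
    have e : cg_v (E :\ w) = cg_v E.
      apply: cg_vE => // j; rewrite !inE /cg_i1 i0E; case: eqP => // e.
      by rewrite -e /cg_i1 eqxx in ne.
    by move: vw; rewrite e !inE eq_sym wv vE.
  rewrite /cg_mu (_ : cg_row (E :\ w) = cg_row E); last first.
    apply/setP => -[i j]; rewrite !inE /=; case: (eqVneq j ord0) => [->|]; rewrite ?andbF //.
    by have := row i; rewrite !inE => ->.
  rewrite ltn_add2l (_ : cg_right (E :\ w) = cg_right E :\ w); last first.
    by apply/setP => g; rewrite !inE i0E andbA.
  by rewrite [X in _ < X](cardsD1 w) !inE wE -w1 cg_i1E // ltnSn.
Qed.
End CornerGrid.

(** * Extension of maps to the bridge *)

Lemma nd_fix (V : sset) M (z : V M) (e : op M.+1 M.+1) : nd z -> sact e z = z -> surj e.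
Proof. by move=> ndz ez; apply: contrapT => /(@nsurj_skel V M M e z); rewrite ez. Qed.

(** With two vertices in pt, the operator identifying the last two vertices would fix z without
    being surjective. *)
Lemma join_nd_r (Y : sset) M (z : join Y pt M) : nd z -> jr z <= 1.
Proof.
move=> ndz; rewrite leqNgt; apply/negP => r2.
have em : {homo (fun i : 'I_M.+1 => inord (minn i M.-1) : 'I_M.+1) : i j / i <= j}.
  by move=> i j ij; rewrite !inordK; lia.
have eE i : mk_op em i = minn i M.-1 :> nat by rewrite mk_opE inordK; lia.
have [|i] := nd_fix (e := mk_op em) ndz _ ord_max; last first.
  move/(congr1 (@nat_of_ord _)); rewrite eE /=; have := jlr z; lia.
case: z r2 {ndz} => l r lr y x /= r2.
have el : cutl (mk_op em) l = l.
  by apply: cutl_uniq => [|i]; rewrite ?eE; have := ltn_ord ord_max; lia.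
have er : M.+1 - cutl (mk_op em) l = r by rewrite el -lr addKn.
apply: (join_ob_ext el er); last exact: aug_pt_uniq.
congr aug_act; apply: op_ext => i; rewrite reslE eE op_castE /=.
by have := ltn_ord i; rewrite {2}el; lia.
Qed.

Lemma join_nd_l (X : sset) N (z : join pt X N) : nd z -> jl z <= 1.
Proof.
move=> ndz; rewrite leqNgt; apply/negP => l2.
have N0 : 0 < N by have := jlr z; have := l2; lia.
have em : {homo (fun i : 'I_N.+1 => inord (maxn i 1) : 'I_N.+1) : i j / i <= j}.
  by move=> i j ij; rewrite !inordK; have := ltn_ord i; have := ltn_ord j; lia.
have eE i : mk_op em i = maxn i 1 :> nat by rewrite mk_opE inordK; have := ltn_ord i; lia.
have [|i] := nd_fix (e := mk_op em) ndz _ ord0; last first.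
  by move/(congr1 (@nat_of_ord _)); rewrite eE /=; lia.
case: z l2 {ndz} => l r lr y x /= l2.
have el : cutl (mk_op em) l = l.
  by apply: cutl_uniq => [|i]; rewrite ?eE; lia.
have er : N.+1 - cutl (mk_op em) l = r by rewrite el -lr addKn.
apply: (join_ob_ext el er); first exact: aug_pt_uniq.
congr aug_act; apply: op_ext => i; rewrite resrE eE op_castE /= [X in X + _]el; lia.
Qed.

Lemma cutl_mono p q q' (a : op p q) (b : op p q') l l' :
  cutl a l <= cutl b l' <-> forall i, a i < l -> b i < l'.
Proof.
split=> [h i|h]; first by rewrite -!cutl_lt => /leq_trans; apply.
rewrite leqNgt; apply/negP => lt.
have ip : cutl b l' < p by apply: leq_trans lt (cutl_le _ _).
have := h (Ordinal ip); rewrite -!cutl_lt /= ltnn lt => /(_ isT); discriminate.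
Qed.

Lemma augc_surj (Y : sset) (U : subc Y) p q (a : op q p) (y : aug Y p) :
  surj a -> augc U (aug_act a y) -> augc U y.
Proof.
case: p a y => [|p] a y // sa; case: q a sa => [|q] a sa.
  by have [[]] := sa ord0.
have [b [ab _]] := surj_section ord0 sa.
by move/(augc_act b); rewrite -aug_act_comp ab aug_act_id.
Qed.

Lemma resl_surj p q (a : op p q) l : l <= q -> surj a -> surj (resl a l).
Proof.
move=> lq sa j; have [i ai] := sa (widen_ord lq j).
have il : i < cutl a l by rewrite cutl_lt ai /=.
exists (Ordinal il); apply/val_inj; rewrite /= reslE.
have -> : widen_ord (cutl_le a l) (Ordinal il) = i by apply/val_inj.
by rewrite ai.
Qed.

Section Bridge.
Variables (Y X : sset).

(* A simplex (u, w) of [bridge] consists of a simplex of Y on the first [jl u]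
   vertices and a simplex of X on the last [jr w] vertices; the two segments
   overlap or at least exhaust the vertices. Both Y * X ([diag_bridge]) and
   (Y * pt) x X ([bridge_inr]) map to it. *)
Lemma bridge_subproof m n (a : op m.+1 n.+1) (x : sprod (join Y pt) (join pt X) n) :
  jl x.2 <= jl x.1 -> jl (sact a x).2 <= jl (sact a x).1.
Proof. by move=> h /=; apply/cutl_mono => i /leq_trans; apply. Qed.
Definition bridge : subc (sprod (join Y pt) (join pt X)) := Subc bridge_subproof.

Lemma bridge0_subproof (U : subc Y) m n (a : op m.+1 n.+1)
    (x : sprod (join Y pt) (join pt X) n) :
  [\/ jr x.1 = 0, jl x.2 = 0 | augc U (jy x.1)] ->
  [\/ jr (sact a x).1 = 0, jl (sact a x).2 = 0 | augc U (jy (sact a x).1)].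
Proof.
case=> h; [apply: Or31 | apply: Or32 | apply: Or33].
- exact: (inlc_subproof a h).
- by rewrite /= h cutl0.
- exact: augc_act.
Qed.
Definition bridge0 (U : subc Y) : subc (sprod (join Y pt) (join pt X)) :=
  andc bridge (Subc (@bridge0_subproof U)).

(** Skeletal induction over Y * pt and then over pt * X. The simplices z and z' that matter have
    exactly one vertex in pt, the last one of z and the first one of z', and what remains is the
    grid with a missing corner. *)
Lemma bridge_lifts (A : sset) (U : subc Y) : quasi_category A ->
  lifts (bang A) (bridge0 U) bridge.
Proof.
move=> qA.
apply: (@skel_lifts _ _ (bang A) _ (join Y pt) (spr1 _ _) _ _
  (fun M _ => sprod (simplex M) (join pt X))
  (fun M z => sprod_map (yoneda z) (sid _)) (fun M _ => spr1 _ _)) => //.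
- by move=> n x [].
- by move=> m z l [u w] a /= e; exists (a, w); rewrite /= -e.
- by move=> m z l [a w] [a' w'] /(congr1 snd) /= -> ->.
move=> M z ndz.
have [rz|rz] := eqVneq (jr z) 0.
  apply: lifts_triv => l [a w] h; split=> //; left; split=> //.
  apply: Or31; exact: (inlc_subproof (a : op _ _) rz).
have [Uz|nU] := pselect (augc U (jy z)).
  apply: lifts_triv => l [a w] h; split=> //; left; split=> //.
  apply: Or33; exact: augc_act.
have jr1 : jr z = 1 by have := join_nd_r ndz; move: rz; case: (jr z) => [|[|r]].
have jlM : jl z = M by have := jlr z; rewrite jr1 addn1 => -[].
set C := andc _ _; set C' := preimc _ _.
apply: (@skel_lifts _ _ (bang A) _ (join pt X) (spr2 _ _) C C'
  (fun N _ => sprod (simplex M) (simplex N))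
  (fun N z' => sprod_map (sid _) (yoneda z')) (fun N _ => spr2 _ _)) => //.
- by move=> n x [].
- by move=> m z' l [a w] b /= e; exists (a, b); rewrite /= -e.
- by move=> m z' l [a b] [a' b'] /(congr1 fst) /= -> ->.
move=> N z' ndz'.
have [lz'|lz'] := eqVneq (jl z') 0.
  apply: lifts_triv => l [a b] h; split=> //; left; split=> //; left; split=> //.
  by apply: Or32; rewrite /= lz' cutl0.
have jl1 : jl z' = 1 by have := join_nd_l ndz'; move: lz'; case: (jl z') => [|[|r]].
(* A vertex at (M, 0) would be in pt on both sides, hence belong neither to Y nor to X; [bridge]
   forbids exactly this. *)
have TTE l (x : sprod (simplex M) (simplex N) l) :
    preimc (sprod_map (sid _) (yoneda z')) C' l x <-> cg_TT (gim x).
  case: x => a b; rewrite -[preimc _ _ _ _]/(is_true (cutl (b : op _ _) (jl z') <= cutl (a : op _ _) (jl z))).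
  rewrite cutl_mono jl1 jlM; split=> [h|h i bi].
    apply/imsetP => -[i _] [e1 e2]; have := h i; rewrite -e2 -e1 /= ltnn.
    by move/(_ isT).
  rewrite ltn_neqAle -ltnS (ltn_ord _) andbT; apply/eqP => e; case/negP: h.
  have -> : (ord_max, ord0) = gpt ((a, b) : sprod (simplex M) (simplex N) l) i.
    congr pair; apply/val_inj; first exact: (esym e).
    by move: bi; rewrite ltnS leqn0 => /eqP.
  exact: gim_mem.
have SSl l a b : ~ surj (a : op l.+1 M.+1) -> cg_SS (gim ((a, b) : sprod (simplex M) (simplex N) l)).
  by move=> /nsurj_misses[i /forallP h]; left; exists i => g /imsetP[t _ ->]; apply: h.
have SSr l a b : ~ surj (b : op l.+1 N.+1) -> cg_SS (gim ((a, b) : sprod (simplex M) (simplex N) l)).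
  by move=> /nsurj_misses[i /forallP h]; right; exists i => g /imsetP[t _ ->]; apply: h.
apply: (corner_grid_lifts (qcat_fib qA)) => l [a b]; last exact: TTE.
split.
  case=> h h'; split; first exact/TTE.
  case: h => [[[[_ h]|h] _]|h]; [| exact: SSl | exact: SSr].
  case: h => /= h.
  - apply: SSl => /(_ ord_max)[i ai].
    have : i < cutl (a : op _ _) (jl z) by have := ltn_ord i; move: h; lia.
    by rewrite cutl_lt ai jlM /= ltnn.
  - apply: SSr => /(_ ord0)[i bi].
    by have := cutl_lt (b : op _ _) (jl z') i; rewrite h bi jl1.
  - apply: SSl => sa; apply: nU; apply: augc_surj h; apply: resl_surj sa.
    by rewrite jlM.
case=> /TTE h' h; split=> //; case: h => -[i h].
  left; split=> //; right; apply: (@misses_nsurj _ _ _ i); apply/forallP => t.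
  exact: (h (gpt ((a, b) : sprod (simplex M) (simplex N) l) t) (gim_mem _ _)).
right; apply: (@misses_nsurj _ _ _ i); apply/forallP => t.
exact: (h (gpt ((a, b) : sprod (simplex M) (simplex N) l) t) (gim_mem _ _)).
Qed.
End Bridge.

Section Rho.
Variables Y X : sset.

Lemma tail_mono r r' (h : r <= r') :
  {homo (fun i : 'I_r => cast_ord (subnK h) (rshift (r' - r) i)) : i j / i <= j}.
Proof. by move=> i j ij; rewrite /= leq_add2l. Qed.
Definition tail r r' (h : r <= r') : op r r' := mk_op (tail_mono h).
Lemma tailE r r' (h : r <= r') i : tail h i = r' - r + i :> nat.
Proof. by rewrite mk_opE. Qed.

Lemma bridge_jr n (x : sub (bridge Y X) n) : jr (sval x).1 <= jr (sval x).2.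
Proof.
have h : jl (sval x).2 <= jl (sval x).1 := svalP x.
by have := jlr (sval x).1; have := jlr (sval x).2; move: h; lia.
Qed.

Definition rho_fun n (x : sub (bridge Y X) n) : join Y X n :=
  JoinOb (jlr (sval x).1) (jy (sval x).1) (aug_act (tail (bridge_jr x)) (jx (sval x).2)).
Lemma rho_subproof m n (a : op m.+1 n.+1) (x : sub (bridge Y X) n) :
  rho_fun (sact a x) = sact a (rho_fun x).
Proof.
case: x => [[u w] h]; congr JoinOb; rewrite /= -!aug_act_comp; congr aug_act.
have h' : jl w <= jl u := h.
have e1 := jlr u; have e2 := jlr w.
apply: op_ext => i; rewrite !op_compE !(resrE, tailE).
have cm : cutl a (jl w) <= cutl a (jl u) by apply/cutl_mono => t /leq_trans; apply.
have cu := cutl_le a (jl u).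
have -> : shiftr (tail (bridge_jr (sact a (exist _ (u, w) h : sub (bridge Y X) n))) i) = shiftr i.
  by apply/val_inj; rewrite /= tailE /=; have := ltn_ord i; lia.
by have := shiftr_ge i; lia.
Qed.
(* On the overlap of the two segments of a simplex of [bridge], the simplex of Y
   is kept and the simplex of X is discarded. *)
Definition jrho : smap (sub (bridge Y X)) (join Y X) := SMap rho_subproof.

Lemma bridge_inl n y w : bridge Y X n (join_inl Y pt n y, w).
Proof. by rewrite /= -(jlr w) leq_addr. Qed.
Lemma bridge_inr n u x : bridge Y X n (u, join_inr pt X n x).
Proof. by []. Qed.

Lemma rho_inl n y w h : jrho n (exist _ (join_inl Y pt n y, w) h) = join_inl Y X n y.
Proof. by congr JoinOb; apply: aug0_uniq. Qed.

Lemma mu_subproof m n (a : op m.+1 n.+1) (z : sprod (join Y pt) X n) :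
  jrho m (exist _ ((sact a z).1, join_inr pt X m (sact a z).2) (bridge_inr _ _))
  = sact a (jrho n (exist _ (z.1, join_inr pt X n z.2) (bridge_inr _ _))).
Proof.
rewrite -smap_nat; congr (jrho m _); apply: sval_inj.
by congr pair; apply: (smap_nat (join_inr pt X)).
Qed.
(** Precomposing with it turns a map out of Y * X into a cone in A^X. Restricted along Delta^1 x Y
    -> Y * pt, it is the collapse map ([mu_cyl]), so that [theta] is compatible with the cones of
    the statement. *)
Definition jmu : smap (sprod (join Y pt) X) (join Y X) :=
  @SMap (sprod (join Y pt) X) (join Y X)
    (fun n z => jrho n (exist _ (z.1, join_inr pt X n z.2) (bridge_inr _ _))) mu_subproof.

Lemma mu_inl n y x : jmu n (join_inl Y pt n y, x) = join_inl Y X n y.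
Proof. exact: rho_inl. Qed.
Lemma mu_inr n t x : jmu n (join_inr Y pt n t, x) = join_inr Y X n x.
Proof.
congr JoinOb; rewrite /= -[RHS]sact_id; congr (sact _ x).
by apply: op_ext => i; rewrite tailE op_idE subnn.
Qed.

Lemma mu_cyl n c y x : jmu n (cyl c y, x) = collapse Y X n (c, (y, x)).
Proof.
congr JoinOb => /=; congr (@aug_act X _ n.+1 _ x); apply: op_ext => i.
rewrite tailE mk_opE /= subKn //; exact: cutl_le.
Qed.
End Rho.

Lemma mu_map (Y Y' X : sset) (f : smap Y Y') n u x :
  jmu Y' X n (join_mapl pt f n u, x) = join_mapl X f n (jmu Y X n (u, x)).
Proof. by congr JoinOb; congr aug_act; apply: op_ext => i; rewrite !tailE. Qed.

(** * The comparison of A_{/d} with (A^X)_{/d} *)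

Section Theta.
Variables (X A : sset) (d : smap X A).
Notation Q := (slice d).
Notation B := (sexp A X).
Notation dv := (diag_vertex d).

Lemma theta_ok : scomp (curry (scomp (hat (sid Q)) (jmu Q X))) (join_inr Q pt) = dv.
Proof.
apply: smap_ext => n t; apply: smap_ext => m [a x].
transitivity (hat (sid Q) m (join_inr Q X m x)); last by rewrite hat_inr.
congr (hat (sid Q) m _).
rewrite -(mu_inr Q (sact (a : op _ _) t) x); congr (jmu Q X m (_, x)).
exact: esym (smap_nat (join_inr Q pt) _ _).
Qed.
(* The comparison A_{/d} -> (A^X)_{/d}. *)
Definition theta : smap Q (slice dv) := slice_of theta_ok.

Lemma hat_theta (Y : sset) (k : smap Y Q) :
  hat (scomp theta k) = curry (scomp (hat k) (jmu Y X)).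
Proof.
rewrite hat_comp hat_slice_of; apply: smap_ext => n u; apply: smap_ext => m [a x].
have -> : k = scomp (sid Q) k by apply: smap_ext.
rewrite hat_comp; congr (hat (sid Q) m _).
rewrite -[RHS](mu_map k (sact (a : op _ _) u) x); congr (jmu Q X m (_, x)).
exact: esym (smap_nat (join_mapl pt k) _ _).
Qed.

Lemma pr_theta : scomp (slice_pr dv) theta = scomp (const_diag X A) (slice_pr d).
Proof.
apply: smap_ext => n s; apply: smap_ext => m [a x].
rewrite -[LHS]/((slice_pr dv n (theta n s) : smap (sprod (simplex n) X) A) m (a, x)).
rewrite slice_pr_of.
rewrite -[LHS]/(hat (sid Q) m (jmu Q X m (sact (a : op _ _) (join_inl Q pt n s), x))).
rewrite -smap_nat mu_inl hat_inl.
exact: (smap_nat (slice_pr d) (a : op _ _) s).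
Qed.

Lemma psi_theta (Y : sset) (k : smap Y Q) n (c : I1 n) (y : Y n) m (a : simplex n m) (x : X m) :
  ((psi (scomp theta k) : smap (sprod I1 Y) B) n (c, y) : smap (sprod (simplex n) X) A) m (a, x)
  = hat k m (collapse Y X m (sact (a : op _ _) c, (sact (a : op _ _) y, x))).
Proof.
rewrite psiE ev_hat hat_theta.
rewrite -[LHS]/(hat k m (jmu Y X m (sact (a : op _ _) (cyl c y), x))).
by rewrite -cyl_act mu_cyl.
Qed.
End Theta.

Lemma lifts_rel_pt (A T : sset) (S S' : subc T) (R : forall n, T n -> A n -> Prop) :
  lifts (bang A) S S' ->
  (forall n x, S n x -> exists v, R n x v) ->
  (forall n x v v', R n x v -> R n x v' -> v = v') ->
  (forall m n (a : op m.+1 n.+1) x v, R n x v -> R m (sact a x) (sact a v)) ->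
  exists h : smap (sub S') A, forall n x v (hx' : S' n x), S n x -> R n x v ->
    h n (exist _ x hx') = v.
Proof.
move=> L tot fn nat.
have [|||f fP] := @rel_smap (sub S) A (fun n x v => R n (sval x) v).
- by move=> n x; apply: tot; apply: svalP.
- by move=> n x; apply: fn.
- by move=> m n a x v; apply: nat.
have [h hP] := lifts_pt f L; exists h => n x v hx' hx hv; rewrite (hP _ _ hx).
exact: fn (fP n (exist _ x hx)) hv.
Qed.

Section BridgeExt.
Variables (Y X A : sset) (d : smap X A) (U : subc Y).
Hypothesis qA : quasi_category A.
Variables (b : smap Y A) (K : smap (sprod (join Y pt) X) A).
Variable F0 : smap (join (sub U) X) A.
Hypothesis Kb : forall n y x, K n (join_inl Y pt n y, x) = b n y.
Hypothesis Kd : forall n t x, K n (join_inr Y pt n t, x) = d n x.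
Hypothesis F0b : forall n (y : sub U n), F0 n (join_inl _ X n y) = b n (sval y).
Hypothesis F0K : forall n u x,
  K n (join_mapl pt (incl U) n u, x) = F0 n (jmu (sub U) X n (u, x)).

(** [bridge0] has three pieces, with prescribed maps [b], [K] and [F0] after [jrho]. The hypotheses
    make them agree on overlaps, and [bridge_lifts] extends the result. [F0] makes the extension
    relative to U. *)
Lemma bridge_ext : exists F : smap (sub (bridge Y X)) A,
  [/\ forall n y w h, F n (exist _ (join_inl Y pt n y, w) h) = b n y,
      forall n u x h, F n (exist _ (u, join_inr pt X n x) h) = K n (u, x) &
      forall n u w h h', F n (exist _ (join_mapl pt (incl U) n u, w) h)
        = F0 n (jrho (sub U) X n (exist _ (u, w) h'))].
Proof.
pose R n (x : sprod (join Y pt) (join pt X) n) (v : A n) :=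
  [\/ exists y, x.1 = join_inl Y pt n y /\ v = b n y,
      exists t, x.2 = join_inr pt X n t /\ v = K n (x.1, t) |
      exists u (h : bridge (sub U) X n (u, x.2)),
        x.1 = join_mapl pt (incl U) n u /\ v = F0 n (jrho (sub U) X n (exist _ (u, x.2) h))].
have inl_incl n y (u : join (sub U) pt n) : join_inl Y pt n y = join_mapl pt (incl U) n u ->
    exists y', u = join_inl _ pt n y' /\ y = sval y'.
  move=> e; have [y' ue] : exists y', u = join_inl _ pt n y'.
    by apply: join_inlP; rewrite -[jr u]/(jr (join_mapl pt (incl U) n u)) -e.
  by exists y'; split=> //; apply: (@join_inl_inj Y pt); rewrite e ue.
have x12 n (x : sprod (join Y pt) (join pt X) n) y t :
    x.1 = join_inl Y pt n y -> x.2 = join_inr pt X n t -> K n (x.1, t) = b n y.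
  by move=> -> _; apply: Kb.
have x13 n u w h y : join_inl Y pt n y = join_mapl pt (incl U) n u ->
    F0 n (jrho (sub U) X n (exist _ (u, w) h)) = b n y.
  move=> /inl_incl[y' [ue ->]]; subst u.
  by rewrite rho_inl F0b.
have x23 n u w h t : w = join_inr pt X n t ->
    F0 n (jrho (sub U) X n (exist _ (u, w) h)) = K n (join_mapl pt (incl U) n u, t).
  move=> we; subst w; rewrite F0K; congr (F0 n (jrho _ _ n _)); exact: sval_inj.
have [|||F FP] := @lifts_rel_pt A _ (bridge0 X U) (bridge Y X) R (@bridge_lifts Y X A U qA).
- move=> n [u w] [hb [h|h|h]].
  + by have [y e] := join_inlP h; exists (b n y); apply: Or31; exists y.
  + by have [t e] := join_inrP h; exists (K n (u, t)); apply: Or32; exists t.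
  + have [u' e] := joincl_incl (h : joincl pt U n u).
    have hb' : bridge (sub U) X n (u', w) by move: hb; rewrite /= -e.
    by exists (F0 n (jrho (sub U) X n (exist _ (u', w) hb'))); apply: Or33; exists u', hb'.
- move=> n [u w] v v' [[y [e1 ->]]|[t [e1 ->]]|[u' [h [e1 ->]]]]
    [[y' [e2 ->]]|[t' [e2 ->]]|[u1 [h1 [e2 ->]]]].
  + by congr (b n _); apply: (@join_inl_inj Y pt); rewrite -e1 -e2.
  + by rewrite e1 Kb.
  + by rewrite (x13 n u1 w h1 y) // -e1 -e2.
  + by rewrite e2 Kb.
  + by congr (K n (u, _)); apply: (@join_inr_inj pt X); rewrite -e1 -e2.
  + by rewrite (x23 n u1 w h1 t e1) e2.
  + by rewrite (x13 n u' w h y') // -e1 -e2.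
  + by rewrite (x23 n u' w h t' e2) e1.
  + have e : u' = u1 by apply: join_mapl_incl_inj; rewrite -e1 -e2.
    by subst u1; congr (F0 n (jrho _ _ n _)); apply: sval_inj.
- move=> m n a [u w] v [[y [/= e1 ->]]|[t [/= e1 ->]]|[u' [h [/= e1 ->]]]].
  + apply: Or31; exists (sact a y); rewrite -!smap_nat; split=> //.
    by rewrite /= e1; apply: esym (smap_nat (join_inl Y pt) a y).
  + apply: Or32; exists (sact a t); rewrite -!smap_nat; split=> //.
    by rewrite /= e1; apply: esym (smap_nat (join_inr pt X) a t).
  + apply: Or33; exists (sact a u'), (sc_act a h); split.
      by rewrite /= e1; apply: esym (smap_nat (join_mapl pt (incl U)) a u').
    rewrite -(smap_nat F0) -(smap_nat (jrho (sub U) X)).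
    by apply: (congr1 (fun z => F0 m (jrho (sub U) X m z))); apply: sval_inj.
exists F; split=> [n y w h|n u x h|n u w h h']; apply: FP.
- by split=> //; apply: Or31.
- by apply: Or31; exists y.
- by split=> //; apply: Or32.
- by apply: Or32; exists x.
- split=> //; apply: Or33 => /=; case: u {h h'} => [[|l] r lr y x] //; exact: (svalP y).
- by apply: Or33; exists u, h'.
Qed.

Variable F : smap (sub (bridge Y X)) A.
Hypothesis Fb : forall n y w h, F n (exist _ (join_inl Y pt n y, w) h) = b n y.
Hypothesis FK : forall n u x h, F n (exist _ (u, join_inr pt X n x) h) = K n (u, x).

Lemma diag_bridge n (u : join Y X n) :
  bridge Y X n (join_map (sid Y) (bang X) n u, join_map (bang Y) (sid X) n u).
Proof. exact: leqnn. Qed.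
Lemma diag_subproof m n (a : op m.+1 n.+1) (u : join Y X n) :
  F m (exist _ _ (diag_bridge (sact a u))) = sact a (F n (exist _ _ (diag_bridge u))).
Proof.
rewrite -smap_nat; congr (F m _); apply: sval_inj.
by congr pair; [apply: (smap_nat (join_map (sid Y) (bang X))) | apply: (smap_nat (join_map (bang Y) (sid X)))].
Qed.
(** Restriction along the embedding of Y * X in [bridge] that collapses X to a point in one
    component and Y in the other; here the two segments do not overlap. *)
Definition diag_ext : smap (join Y X) A := @SMap (join Y X) A
  (fun n u => F n (exist _ _ (diag_bridge u))) diag_subproof.

Lemma diag_ext_inr : scomp diag_ext (join_inr Y X) = d.
Proof.
apply: smap_ext => n x; rewrite -(Kd (bang X n x) x) -(@FK n (join_inr Y pt n (bang X n x)) x (bridge_inr _ _)).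
by congr (F n _); apply: sval_inj.
Qed.
Lemma diag_ext_inl n y : diag_ext n (join_inl Y X n y) = b n y.
Proof.
rewrite -(@Fb n y (join_inl pt X n (bang Y n y)) (bridge_inl _ _)).
by congr (F n _); apply: sval_inj.
Qed.
End BridgeExt.

Section Strictify.
Variables (X A : sset) (d : smap X A).
Hypothesis qA : quasi_category A.
Notation Q := (slice d).
Notation B := (sexp A X).
Notation dv := (diag_vertex d).

Section Data.
Variables (Y : sset) (k : smap Y (slice dv)) (b : smap Y A).
Hypothesis kb : scomp (slice_pr dv) k = scomp (const_diag X A) b.

Lemma uncurry_hat_inl n y x : uncurry (hat k) n (join_inl Y pt n y, x) = b n y.
Proof.
rewrite -[LHS]/((hat k n (join_inl Y pt n y) : smap (sprod (simplex n) X) A) n (op_id n.+1, x)).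
rewrite hat_inl -[slice_pr dv n _]/(scomp (slice_pr dv) k n y) kb.
exact: sact_id.
Qed.
Lemma uncurry_hat_inr n t x : uncurry (hat k) n (join_inr Y pt n t, x) = d n x.
Proof.
rewrite -[LHS]/((hat k n (join_inr Y pt n t) : smap (sprod (simplex n) X) A) n (op_id n.+1, x)).
by rewrite hat_inr.
Qed.
End Data.

Lemma lo_hi i : op_lo i <= op_hi i.
Proof. by case: i => [[|[|[|i]]] iP] //; rewrite !mk_opE /= !inordK. Qed.

Section Triangle.
Variables (Y : sset) (F : smap (sub (bridge Y X)) A).
(** Over Delta^2 the vertices 0, 1 carry Y and the vertices 1, 2 carry X. The edge 01 of [tri_cell]
    sees F only on Y, the edge 12 on (Y * pt) x X, the edge 02 on Y * X. *)
Lemma tri_bridge n (a : simplex 2 n) (y : Y n) (x : X n) :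
  bridge Y X n (collapse Y pt n (op_comp op_lo a : I1 n, (y, bang Y n y)),
                collapse pt X n (op_comp op_hi a : I1 n, (bang X n x, x))).
Proof.
rewrite [bridge _ _ _ _]/=; apply/cutl_mono => i; rewrite !op_compE.
exact: leq_ltn_trans (lo_hi _).
Qed.
Lemma tri_subproof m n (a : op m.+1 n.+1) (z : sprod (sprod (simplex 2) Y) X n) :
  F m (exist _ _ (tri_bridge (sact a z).1.1 (sact a z).1.2 (sact a z).2))
  = sact a (F n (exist _ _ (tri_bridge z.1.1 z.1.2 z.2))).
Proof.
rewrite -smap_nat; congr (F m _); apply: sval_inj; congr pair.
  rewrite -[RHS](smap_nat (collapse Y pt)); congr (collapse Y pt m (_, (_, _))).
    by rewrite /= op_compA.
  exact: pt_uniq.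
rewrite -[RHS](smap_nat (collapse pt X)); congr (collapse pt X m (_, (_, _))).
  by rewrite /= op_compA.
exact: pt_uniq.
Qed.
Definition tri_map : smap (sprod (sprod (simplex 2) Y) X) A :=
  @SMap (sprod (sprod (simplex 2) Y) X) A
    (fun n z => F n (exist _ _ (tri_bridge z.1.1 z.1.2 z.2))) tri_subproof.
Definition tri_cell : sexp B Y 2 := curry tri_map.
Lemma tri_cellE i n (c : I1 n) (y : Y n) m (e : simplex n m) (x : X m) (u : join Y pt m)
    (w : join pt X m) h :
  collapse Y pt m (op_comp (op_comp op_lo (coface (inord i))) (op_comp (c : op _ _) e) : I1 m,
    (sact (e : op _ _) y, bang Y m (sact (e : op _ _) y))) = u ->
  collapse pt X m (op_comp (op_comp op_hi (coface (inord i))) (op_comp (c : op _ _) e) : I1 m,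
    (bang X m x, x)) = w ->
  (((fc i tri_cell : smap (sprod I1 Y) B) n (c, y)) : smap (sprod (simplex n) X) A) m (e, x)
  = F m (exist _ (u, w) h).
Proof.
move=> eu ew.
rewrite -[LHS]/(F m (exist _ _ (tri_bridge (op_comp (op_comp (coface (inord i)) (c : op _ _)) (e : op _ _) : simplex 2 m) (sact (e : op _ _) y) x))).
congr (F m _); apply: sval_inj; rewrite -[RHS]/(u, w) -eu -ew -!op_compA //.
Qed.
End Triangle.

(** The extension to [bridge] of the transpose of k restricts on Y * X to the transpose of f, and
    [tri_cell] is a homotopy between the two 2-cells: its edge 01 is degenerate since F is b on
    Y. *)
Lemma strictify (Y : sset) (k : smap Y (slice dv)) (b : smap Y A) :
  scomp (slice_pr dv) k = scomp (const_diag X A) b ->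
  exists f : smap Y Q, scomp (slice_pr d) f = b /\
    forall (x y : ho (sexp B Y)) (h1 : esrc (psi k) = x) (h2 : etgt (psi k) = y)
      (h3 : esrc (psi (scomp (theta d) f)) = x) (h4 : etgt (psi (scomp (theta d) f)) = y),
      hedge h3 h4 = hedge h1 h2.
Proof.
move=> kb.
pose none := @SMap (sub (emptyc Y)) Q
  (fun n x => False_rect _ (svalP x)) (fun m n a x => False_ind _ (svalP x)).
have [||n u x|F [Fb FK _]] := @bridge_ext Y X A (emptyc Y) qA b (uncurry (hat k)) (hat none).
- exact: (uncurry_hat_inl kb).
- by move=> n [].
- have [[t ->]|[m [[] //]]] := join_case u.
  rewrite mu_inr hat_inr -(@uncurry_hat_inr Y k n t x).
  by congr (uncurry _ n (_, x)).
have Fd := diag_ext_inr (@uncurry_hat_inr Y k) FK.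
exists (slice_of Fd); split.
  by apply: smap_ext => n y; rewrite -[LHS]/(slice_pr d n (slice_of Fd n y)) slice_pr_of (diag_ext_inl Fb).
move=> x y h1 h2 h3 h4.
have [hi2 hi0 hi1] := hi_face; have [lo2 lo0 lo1] := lo_face.
have xg : x = vtx (scomp (const_diag X A) b) by rewrite -h1 psi_src kb.
have t : tri (degen0 (x : sexp B Y 0)) (psi k) (psi (scomp (theta d) (slice_of Fd))).
  exists (tri_cell F); split.
  - rewrite xg; apply: degen_exp => m c w; apply: smap_ext => l [e z].
    have hb := bridge_inl (sact (e : op _ _) w) (collapse pt X l (op_comp (c : op _ _) e : I1 l, (bang X l z, z))).
    rewrite (@tri_cellE Y F 2 m c w l e z _ _ hb).
    + by rewrite Fb smap_nat.
    + by rewrite lo2 const_act; apply: collapse0.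
    + by rewrite hi2 op_1comp.
  - apply: smap_ext => m [c w]; apply: smap_ext => l [e z].
    rewrite (@tri_cellE Y F 0 m c w l e z (cyl (sact (e : op _ _) c) (sact (e : op _ _) w)) (join_inr pt X l z) (bridge_inr _ _)).
    + by rewrite FK psiE ev_hat uncurryE cyl_act.
    + by rewrite lo0 op_1comp.
    + by rewrite hi0 const_act; apply: collapse1.
  - apply: smap_ext => m [c w]; apply: smap_ext => l [e z].
    rewrite psi_theta hat_slice_of.
    rewrite -[RHS]/(F l (exist _ _ (diag_bridge (collapse Y X l (sact (e : op _ _) c, (sact (e : op _ _) w, z)))))).
    apply: tri_cellE.
    + rewrite lo1 op_1comp collapse_map; congr (collapse Y pt l (_, (_, _))); exact: pt_uniq.
    + rewrite hi1 op_1comp collapse_map; congr (collapse pt X l (_, (_, _))); exact: pt_uniq.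
rewrite -(hedge_tri (degen_src _) (degen_tgt _) h1 h2 h3 h4 t).
by rewrite hedge_degen mcomp1.
Qed.

(** [psi_inj] gives a homotopy in (A^X)_{/d} over c b. It is strictified as in [strictify], with
    Delta^1 x Y for Y and relative to the two ends, where f and f' are already strict. *)
Lemma strict_homotopy (Y : sset) (f f' : smap Y Q) (b : smap Y A)
    (x y : ho (sexp B Y))
    (h1 : esrc (psi (scomp (theta d) f)) = x) (h2 : etgt (psi (scomp (theta d) f)) = y)
    (h3 : esrc (psi (scomp (theta d) f')) = x) (h4 : etgt (psi (scomp (theta d) f')) = y) :
  scomp (slice_pr d) f = b -> scomp (slice_pr d) f' = b -> hedge h1 h2 = hedge h3 h4 ->
  exists H : smap (sprod I1 Y) Q,
    [/\ forall m y, H m (c0 m, y) = f m y, forall m y, H m (c1 m, y) = f' m y &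
        forall m c y, slice_pr d m (H m (c, y)) = b m y].
Proof.
move=> fb f'b E.
have [|H [H0 H1 Hb]] := @psi_inj _ _ _ (exp_qcat (Y := X) qA) _ _ _ _ h1 h2 h3 h4 (scomp (const_diag X A) b) _ E.
  by rewrite scompA pr_theta -scompA fb.
pose Z := sprod I1 Y; pose U := endc Y.
pose R n (z : sub U n) (v : Q n) :=
  ((sval z).1 = c0 n /\ v = f n (sval z).2) \/ ((sval z).1 = c1 n /\ v = f' n (sval z).2).
have [|||kk kP] := @rel_smap (sub U) Q R.
- move=> n z; case: (svalP z) => e; [exists (f n (sval z).2); left | exists (f' n (sval z).2); right];
  by split.
- by move=> n z v v' [] [e ->] [] [e' ->] //; case: (@c0_neq_c1 n); rewrite -e -e'.
- move=> m n a z v [] [e ->]; rewrite -smap_nat; [left | right]; split=> //.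
    by rewrite -(c0_act a) -e.
  by rewrite -(c1_act a) -e.
have kb n z : slice_pr d n (kk n z) = b n (sval z).2.
  case: (kP n z) => -[_ ->].
    exact: (congr1 (fun g : smap Y A => g n (sval z).2) fb).
  exact: (congr1 (fun g : smap Y A => g n (sval z).2) f'b).
have Hk : scomp H (incl U) = scomp (theta d) kk.
  apply: smap_ext => n z; rewrite -[LHS]/(H n (sval z)) -[RHS]/(theta d n (kk n z)).
  case: (kP n z) => -[e ->].
    have -> : sval z = (c0 n, (sval z).2) by rewrite -e; case: (sval z).
    exact: H0.
  have -> : sval z = (c1 n, (sval z).2) by rewrite -e; case: (sval z).
  exact: H1.
have HK : scomp (slice_pr dv) H = scomp (const_diag X A) (scomp b (spr2 I1 Y)).
  by apply: smap_ext => n [c w]; apply: Hb.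
have [||n u z|F [Fb FK FU]] := @bridge_ext Z X A U qA (scomp b (spr2 I1 Y)) (uncurry (hat H)) (hat kk).
- exact: (uncurry_hat_inl HK).
- by move=> n z; rewrite hat_inl kb.
- have e : hat H n (join_mapl pt (incl U) n u) = hat (scomp (theta d) kk) n u.
    by rewrite -Hk hat_comp.
  rewrite -[LHS]/((hat H n (join_mapl pt (incl U) n u) : smap (sprod (simplex n) X) A) n (op_id n.+1, z)).
  rewrite e hat_theta -[LHS]/(hat kk n (jmu (sub U) X n (sact (op_id n.+1) u, z))).
  by rewrite sact_id.
have Fd := diag_ext_inr (@uncurry_hat_inr Z H) FK.
(* On the image of Y * X in [bridge] the two segments are complementary and [jrho] returns the
   original simplex, so the extension agrees with f and f' at the ends. *)
have FF n (u : join (sub U) X n) : diag_ext F n (join_mapl X (incl U) n u) = hat kk n u.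
  have hb := diag_bridge u.
  have hb' : bridge Z X n (join_mapl pt (incl U) n (join_map (sid _) (bang X) n u),
     join_map (bang (sub U)) (sid X) n u) := hb.
  transitivity (F n (exist _ _ hb')).
    rewrite -[LHS]/(F n (exist _ _ (diag_bridge (join_mapl X (incl U) n u)))).
    congr (F n _); apply: sval_inj; congr pair.
      by case: u {hb hb'} => [[|l] r lr w z].
    case: u {hb hb'} => [l r lr w z]; congr JoinOb; exact: aug_pt_uniq.
  rewrite (FU _ _ _ _ hb); congr (hat kk n _).
  case: u hb {hb'} => [l r lr w z] hb; congr JoinOb.
    by case: l lr w hb.
  rewrite [jx _]/= (_ : aug_map (sid X) z = z); last by case: r lr z hb.
  rewrite -[RHS]aug_act_id; congr aug_act; apply: op_ext => i.
  by rewrite tailE op_idE subnn.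
exists (slice_of Fd); split.
- move=> m w; apply/slice_ext/smap_ext => l z.
  have hU : U m (c0 m, w) by left.
  have e : join_mapl X (yoneda ((c0 m, w) : Z m)) l z
      = join_mapl X (incl U) l (join_mapl X (yoneda (exist _ _ hU : sub U m)) l z).
    by case: z => [[|q] r lr v z].
  rewrite -[LHS]/(diag_ext F l (join_mapl X (yoneda ((c0 m, w) : Z m)) l z)) e FF hat_mapl.
  by case: (kP m (exist _ _ hU)) => -[/= h ->] //; case: (c0_neq_c1 h).
- move=> m w; apply/slice_ext/smap_ext => l z.
  have hU : U m (c1 m, w) by right.
  have e : join_mapl X (yoneda ((c1 m, w) : Z m)) l z
      = join_mapl X (incl U) l (join_mapl X (yoneda (exist _ _ hU : sub U m)) l z).
    by case: z => [[|q] r lr v z].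
  rewrite -[LHS]/(diag_ext F l (join_mapl X (yoneda ((c1 m, w) : Z m)) l z)) e FF hat_mapl.
  by case: (kP m (exist _ _ hU)) => -[/= h ->] //; case: (c0_neq_c1 (esym h)).
- by move=> m c w; rewrite slice_pr_of (diag_ext_inl Fb).
Qed.
End Strictify.


(** * The comparison of limit cones *)

Lemma fmap_hedge (S T : sset) (F : smap S T) (x y : ho S) (e : S 1) (p : esrc e = x)
    (q : etgt e = y) :
  fmap (ho_map F) (hedge p q) = hedge (face_map F p) (face_map F q).
Proof. exact: ho_hom_class. Qed.

Lemma whisker_post_hedge (Y B C : sset) (k : smap B C) (f g : smap Y B) (e : sexp B Y 1)
    (h1 : esrc e = vtx f) (h2 : etgt e = vtx g)
    (p : esrc (scomp k e : sexp C Y 1) = vtx (scomp k f))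
    (q : etgt (scomp k e : sexp C Y 1) = vtx (scomp k g)) :
  whisker_post k (hedge h1 h2 : cell f g) = hedge p q.
Proof. by rewrite /whisker_post fmap_hedge hedge_cast; apply: hedge_eq. Qed.

Lemma whisker_pre_hedge (Z Y B : sset) (u : smap Z Y) (f g : smap Y B) (e : sexp B Y 1)
    (h1 : esrc e = vtx f) (h2 : etgt e = vtx g)
    (p : esrc (scomp e (sprod_map (sid I1) u) : sexp B Z 1) = vtx (scomp f u))
    (q : etgt (scomp e (sprod_map (sid I1) u) : sexp B Z 1) = vtx (scomp g u)) :
  whisker_pre (hedge h1 h2 : cell f g) u = hedge p q.
Proof. by rewrite /whisker_pre fmap_hedge hedge_cast; apply: hedge_eq. Qed.

Lemma scomp_yoneda (S T : sset) (F : smap S T) n (s : S n) : scomp F (yoneda s) = yoneda (F n s).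
Proof. by apply: smap_ext => m a; apply: smap_nat. Qed.

Section Main.
Variables (A : sset) (qA : quasi_category A) (X : sset) (d : smap X A).
Notation Q := (slice d).
Notation "'pi'" := (slice_pr d).
Notation B := (sexp A X).
Notation dv := (diag_vertex d).
Notation cd := (const_diag X A).

(** The target is a variable w with an equation because for Y = pt, in [cone_strict], it is d
    itself, equal to d! only propositionally. *)
Lemma cell_strict (Y : sset) (b : smap Y A) (w : smap Y B)
    (chi : cell (scomp cd b) w) : w = scomp dv (bang Y) ->
  exists (f : smap Y Q) (h3 : esrc (psi (scomp (theta d) f)) = vtx (scomp cd b))
    (h4 : etgt (psi (scomp (theta d) f)) = vtx w),
    scomp pi f = b /\ chi = hedge h3 h4.
Proof.
move=> wE; subst w.
have qB := exp_qcat (Y := X) qA.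
have [e [ex [ey ->]]] := hom_hedge (exp_qcat (Y := Y) qB) chi.
have [k [kb kP]] := psi_surj qB ex ey.
have [f [fb fP]] := strictify qA kb.
have h1 : esrc (psi k) = vtx (scomp cd b) by rewrite psi_src kb.
have h2 := psi_tgt k.
have h3 : esrc (psi (scomp (theta d) f)) = vtx (scomp cd b).
  by rewrite psi_src scompA pr_theta -scompA fb.
have h4 := psi_tgt (scomp (theta d) f).
exists f, h3, h4; split=> //.
by rewrite (kP _ _ ex ey h1 h2) (fP _ _ h1 h2 h3 h4).
Qed.

Section Vertex.
Variable t : Q 0.
Notation l := (pi 0 t).
Notation P := (slice (yoneda t)).
Notation "'pr'" := (slice_pr (yoneda t)).
Notation post := (slice_post (yoneda t) pi).

Lemma post_vertex : scomp pi (yoneda t) = yoneda l.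
Proof. exact: scomp_yoneda. Qed.

Lemma ev_post n c s : pi n (ev (yoneda t) n (c, s)) = ev (scomp pi (yoneda t)) n (c, post n s).
Proof. by rewrite !evE. Qed.

Lemma post_src (Y : sset) (k : smap Y P) (b : smap Y A) :
  scomp pi (scomp pr k) = b -> esrc (psi (scomp post k)) = vtx b.
Proof. by move=> <-; rewrite psi_src; congr vtx; apply: smap_ext. Qed.
Lemma post_tgt (Y : sset) (k : smap Y P) :
  etgt (psi (scomp post k)) = vtx (scomp (yoneda l) (bang Y)).
Proof. by rewrite psi_tgt post_vertex. Qed.
Lemma theta_src (Y : sset) (f : smap Y Q) (b : smap Y A) :
  scomp pi f = b -> esrc (psi (scomp (theta d) f)) = vtx (scomp cd b).
Proof. by move=> fb; rewrite psi_src scompA pr_theta -scompA fb. Qed.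

(** [psi_surj] represents the 2-cell by a map to A_{/l}, which is then lifted through the trivial
    fibration from Q_{/t}. *)
Lemma cell_repr (Y : sset) (b : smap Y A) (zeta : cell b (scomp (yoneda l) (bang Y))) :
  exists (k : smap Y P) (h : scomp pi (scomp pr k) = b),
    zeta = hedge (post_src h) (post_tgt k).
Proof.
have [e [ex [ey ->]]] := hom_hedge (exp_qcat (Y := Y) qA) zeta.
have ey' : etgt e = vtx (scomp (scomp pi (yoneda t)) (bang Y)) by rewrite post_vertex.
have [k0 [k0b k0P]] := psi_surj qA ex ey'.
have hf := slice_pr_fib (d := d) qA.
have [k kP] := tfib_lift k0 (slice_post_tfib (d := yoneda t) hf).
have kE : scomp post k = k0 by apply: smap_ext => m y; apply: kP.
have h : scomp pi (scomp pr k) = b by rewrite -k0b -kE; apply: smap_ext.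
exists k, h; move: (post_src h) (post_tgt k); rewrite kE => s1 t1.
exact: k0P.
Qed.

Lemma hat_yoneda n u : hat (yoneda t) n u = sval t n u.
Proof.
have e : u = join_mapl X (yoneda (op_id 1 : pt 0)) n u.
  by case: u => [[|q] r lr a x]; congr JoinOb; rewrite /= op_1comp.
rewrite {1}e hat_mapl.
exact: (congr1 (fun z : Q 0 => sval z n u) (sact_id t)).
Qed.

(** The 2-cell of the constant map at t is the whiskered limit cone; this links the cones of the
    definition to the representation by [psi]. *)
Lemma psi_theta_const (Y : sset) :
  psi (scomp (theta d) (scomp (yoneda t) (bang Y)))
  = scomp (slice_edge_pt t) (sprod_map (sid I1) (bang Y)).
Proof.
apply: smap_ext => n [c y]; apply: smap_ext => m [a x].
rewrite psi_theta hat_comp.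
rewrite -[LHS]/(hat (yoneda t) m (join_mapl X (bang Y) m (collapse Y X m (sact (a : op _ _) c, (sact (a : op _ _) y, x))))).
rewrite hat_yoneda.
transitivity (sval t m (cone_collapse X m (sact (a : op _ _) c, x))); last by [].
congr (sval t m _); congr JoinOb; exact: aug_pt_uniq.
Qed.

(** A map k to Q_{/t} is a homotopy in Q from pr k to the constant map at t. Its image under [theta]
    is the square of [psi_comp], whose projection to A^X is c applied to the 2-cell of k. *)
Lemma cone_comp (Y : sset) (k : smap Y P) (b : smap Y A)
    (h : scomp pi (scomp pr k) = b)
    (h3 : esrc (psi (scomp (theta d) (scomp pr k))) = vtx (scomp cd b))
    (h4 : etgt (psi (scomp (theta d) (scomp pr k))) = vtx (scomp dv (bang Y))) :
  mcomp (cell_cast (esym (scompA cd (yoneda l) (bang Y))) erefl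
           (whisker_pre (slice_cone_cell t) (bang Y)))
        (whisker_post cd (hedge (post_src h) (post_tgt k) : cell _ _)) = hedge h3 h4.
Proof.
have p1 : esrc (scomp (slice_edge_pt t) (sprod_map (sid I1) (bang Y)) : sexp B Y 1)
    = vtx (scomp (scomp cd (yoneda l)) (bang Y)).
  by rewrite -psi_theta_const psi_src scompA pr_theta -!scompA (scompA pi) post_vertex.
have p2 : etgt (scomp (slice_edge_pt t) (sprod_map (sid I1) (bang Y)) : sexp B Y 1)
    = vtx (scomp dv (bang Y)).
  by rewrite -psi_theta_const psi_tgt.
rewrite (whisker_pre_hedge (slice_edge_src t) (slice_edge_tgt t) p1 p2).
have q1 : esrc (scomp cd (psi (scomp post k)) : sexp B Y 1) = vtx (scomp cd b).
  by apply: exp_src => m y; apply: (congr1 (cd m)); apply: (src_exp (post_src h)).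
have q2 : etgt (scomp cd (psi (scomp post k)) : sexp B Y 1)
    = vtx (scomp cd (scomp (yoneda l) (bang Y))).
  by apply: exp_tgt => m y; apply: (congr1 (cd m)); apply: (tgt_exp (post_tgt k)).
rewrite (whisker_post_hedge (post_src h) (post_tgt k) q1 q2) /cell_cast hedge_cast.
move: (etrans p1 _) (etrans p2 _); rewrite -psi_theta_const => s1 s2.
apply: (@psi_comp B dv Y (scomp (theta d) (scomp (ev (yoneda t)) (sprod_map (sid I1) k)))).
- by move=> m y; rewrite -[LHS]/(theta d m (ev (yoneda t) m (c0 m, k m y))) ev0.
- move=> m y; rewrite -[LHS]/(theta d m (ev (yoneda t) m (c1 m, k m y))) ev1.
  by congr (theta d m (yoneda t m _)); apply: pt_uniq.
- move=> m c y; rewrite -[RHS]/(scomp (slice_pr dv) (theta d) m (ev (yoneda t) m (c, k m y))).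
  by rewrite pr_theta -[RHS]/(cd m (pi m (ev (yoneda t) m (c, k m y)))) ev_post.
Qed.

Lemma joyal_limit : joyal_limit_cone t -> limit_cone (slice_cone_cell t).
Proof.
move=> /terminal_tfib tp Y qY b chi.
have [f [h3 [h4 [fb ->]]]] := cell_strict chi erefl.
have [k kP] := tfib_lift f tp.
have kf : scomp pr k = f by apply: smap_ext => m y; apply: kP.
have h : scomp pi (scomp pr k) = b by rewrite kf.
exists (hedge (post_src h) (post_tgt k)); split.
  by subst f; rewrite (cone_comp h h3 h4).
move=> zeta; have [k' [h' ->]] := cell_repr zeta.
have h3' := theta_src h'; have h4' := psi_tgt (scomp (theta d) (scomp pr k')).
rewrite (cone_comp h' h3' h4') => E.
(* H joins pr k to pr k' over b. As pr is a trivial fibration, H lifts to a homotopy from k to k',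
   so both represent the same 2-cell. *)
have [H [H0 H1 Hb]] := strict_homotopy qA fb h' E.
have [|m y|K [K0 K1 Kp]] := tfib_homotopy (k0 := k) (k1 := k') (g := H) tp.
- by move=> m y; rewrite H0 kP.
- by rewrite H1.
symmetry; apply: (@psi_homotopy _ _ _ (scomp post K) _ _ b).
- by move=> m y; rewrite /= K0.
- by move=> m y; rewrite /= K1.
- by move=> m c y; rewrite -[LHS]/(pi m (pr m (K m (c, y)))) Kp Hb.
Qed.

Lemma limit_joyal : limit_cone (slice_cone_cell t) -> joyal_limit_cone t.
Proof.
move=> lim; apply: tfib_terminal.
have hf := slice_pr_fib (d := d) qA.
have qQ : quasi_category Q := slice_qcat (d := d) qA.
have hp : horn_fib true pr := slice_pr_fib (d := yoneda t) qQ.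
have qP : quasi_category P := slice_qcat (d := yoneda t) qQ.
(* Existence of zeta, for Y = Q and the 2-cell of the identity of Q, gives s with pr s homotopic to
   the identity over A. Lifting this homotopy backwards from s replaces s by a strict section. *)
have [s sp] : exists s : smap Q P, scomp pr s = sid Q.
  have g1 : scomp pi (sid Q) = pi by apply: smap_ext.
  have h3 := theta_src g1; have h4 := psi_tgt (scomp (theta d) (sid Q)).
  have [zeta [zP _]] := lim Q qQ pi (hedge h3 h4).
  have [s [h ze]] := cell_repr zeta.
  have h3' := theta_src h; have h4' := psi_tgt (scomp (theta d) (scomp pr s)).
  rewrite ze (cone_comp h h3' h4') in zP.
  have [H [H0 H1 Hb]] := strict_homotopy qA g1 h zP.
  pose none := @SMap (sprod I1 (sub (emptyc Q))) P
    (fun n x => False_rect _ (svalP x.2)) (fun m n a x => False_ind _ (svalP x.2)).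
  have [||m y|K [_ K1 Kp]] := @cyl_lift P Q pr Q (emptyc Q) none s H hp.
  - by move=> m [].
  - by move=> m c [].
  - by rewrite H1.
  have sN m n (a : op m.+1 n.+1) (y : Q n) : K m (c0 m, sact a y) = sact a (K n (c0 n, y)).
    by rewrite -smap_nat /= -[op_comp (c0 n) a]/(sact a (c0 n)) c0_act.
  exists (SMap sN); apply: smap_ext => n y; rewrite -[LHS]/(pr n (K n (c0 n, y))).
  by rewrite Kp H0.
have prs n y : pr n (s n y) = y by rewrite -[LHS]/(scomp pr s n y) sp.
(* Uniqueness of zeta, for Y = P: the identity and s pr have the same projection to Q, hence
   represent the same 2-cell and are homotopic. The homotopy h lies over A only, not yet over Q. *)
have [h [h0 h1]] : exists h : smap (sprod I1 P) P,
    (forall m x, h m (c0 m, x) = x) /\ (forall m x, h m (c1 m, x) = s m (pr m x)).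
  have e1 : scomp pi (scomp pr (sid P)) = scomp pi pr by apply: smap_ext.
  have e2 : scomp pi (scomp pr (scomp s pr)) = scomp pi pr.
    by apply: smap_ext => m x; apply: (congr1 (pi m)); apply: prs.
  have pe : scomp pr (sid P) = scomp pr (scomp s pr).
    by apply: smap_ext => m x; rewrite -[RHS]/(pr m (s m (pr m x))) prs.
  have h3 := theta_src e1; have h4 := psi_tgt (scomp (theta d) (scomp pr (sid P))).
  have [zeta [_ zU]] := lim P qP _ (hedge h3 h4).
  have z1 := zU _ (esym (cone_comp e1 h3 h4)).
  have z2 : zeta = hedge (post_src e2) (post_tgt (scomp s pr)).
    apply: zU; have h3' := theta_src e2; have h4' := psi_tgt (scomp (theta d) (scomp pr (scomp s pr))).
    by rewrite (cone_comp e2 h3' h4'); apply: hedge_eq; rewrite pe.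
  have [|H [H0 H1 _]] := psi_inj qA (g := scomp pi pr) _ (etrans (esym z1) z2).
    by apply: smap_ext.
  have [|m x|h [h0 h1 _]] := tfib_homotopy (k0 := sid P) (k1 := scomp s pr) (g := H)
      (slice_post_tfib (d := yoneda t) hf).
  - by move=> m x; rewrite H0.
  - by rewrite H1.
  by exists h.
(* To make h vertical over Q, a square over pr h is lifted with sides h, s pr h and, at the end 1,
   the constant homotopy at s pr. Its remaining side j runs from the identity to s pr and lies over
   pr. *)
pose g : smap (sprod I1 (sprod I1 P)) Q := scomp (scomp pr h) (sprod_map (sid I1) (spr2 I1 P)).
have [|||||K [K0 K1 Kp]] := @square_lift P Q pr P h (scomp (scomp s pr) h)
  (scomp (scomp s pr) (spr2 I1 P)) g hp.
- by move=> m x; rewrite h1.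
- by move=> m x; rewrite -[LHS]/(s m (pr m (h m (c1 m, x)))) h1 prs.
- by [].
- by move=> m c x; rewrite -[LHS]/(pr m (s m (pr m (h m (c, x))))) prs.
- by move=> m [i x]; rewrite -[LHS]/(pr m (s m (pr m x))) -[RHS]/(pr m (h m (c1 m, x))) h1.
have jN m n (a : op m.+1 n.+1) (x : sprod I1 P n) : K m (c0 m, sact a x) = sact a (K n (c0 n, x)).
  by rewrite -smap_nat /= -[op_comp (c0 n) a]/(sact a (c0 n)) c0_act.
pose j : smap (sprod I1 P) P := SMap jN.
have j0 m x : j m (c0 m, x) = x by rewrite -[LHS]/(K m (c0 m, (c0 m, x))) K0 h0.
have j1 m x : j m (c1 m, x) = s m (pr m x).
  by rewrite -[LHS]/(K m (c0 m, (c1 m, x))) K1 -[LHS]/(s m (pr m (h m (c0 m, x)))) h0.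
have jp m c x : pr m (j m (c, x)) = pr m x.
  by rewrite -[LHS]/(pr m (K m (c0 m, (c, x)))) Kp -[LHS]/(pr m (h m (c0 m, x))) h0.
(* The lift s v is correct over v but not on the boundary, where it is the end of j f. Lifting j f
   backwards from s v over the constant homotopy at v moves it to a lift that restricts to f. *)
move=> n f v fv.
have [|||L [L0 _ Lp]] := @cyl_lift P Q pr (simplex n) (bndc n)
  (scomp j (sprod_map (sid I1) f)) (scomp s v) (scomp v (spr2 I1 _)) hp.
- by move=> m y; rewrite -[LHS]/(j m (c1 m, f m y)) j1 fv.
- by move=> m c y; rewrite -[X in pr m X]/(j m (c, f m y)) jp fv.
- by move=> m y; rewrite -[X in pr m X]/(s m (v m y)) prs.
have LN m k (a : op m.+1 k.+1) (y : simplex n k) : L m (c0 m, sact a y) = sact a (L k (c0 k, y)).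
  by rewrite -smap_nat /= -[op_comp (c0 k) a]/(sact a (c0 k)) c0_act.
exists (scomp (SMap LN) (incl _)); split=> [m y hy hy'|m y].
  rewrite -[LHS]/(L m (c0 m, sval (exist _ y hy : sub (bndc n) m))) L0.
  by rewrite -[LHS]/(j m (c0 m, f m (exist _ y hy))) j0.
by rewrite -[X in pr m X]/(L m (c0 m, sval y)) Lp.
Qed.

End Vertex.

(** The case Y = pt of [cell_strict]. It lets an arbitrary cone be replaced by that of a vertex of
    the slice, so that the comparison for such vertices covers all limit cones. *)
Lemma cone_strict (l : A 0) (lam : cone d l) : exists t : Q 0, slice_cone t = existT _ l lam.
Proof.
have wE : dv = scomp dv (bang pt).
  by apply: smap_ext => n x; congr (dv n _); apply: pt_uniq.
have [f [h3 [h4 [fb e]]]] := cell_strict lam wE.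
pose t : Q 0 := f 0 (op_id 1 : pt 0).
have fE : f = yoneda t.
  apply: smap_ext => n x; rewrite -[RHS]/(sact (x : op _ _) (f 0 (op_id 1 : pt 0))).
  by rewrite -smap_nat /= op_1comp.
have lE : pi 0 t = l.
  have := congr1 (fun g : smap pt A => g 0 (op_id 1 : pt 0)) fb.
  by rewrite /= => ->; rewrite sact_id.
exists t; subst l; rewrite /slice_cone; congr existT; rewrite e.
apply: hedge_eq; rewrite fE.
have -> : yoneda t = scomp (yoneda t) (bang pt).
  by apply: smap_ext => n x; congr (yoneda t n _); apply: pt_uniq.
rewrite psi_theta_const; apply: smap_ext => n [c x]; congr (slice_edge_pt t n (c, _)).
exact: pt_uniq.
Qed.
End Main.

Theorem proposition5p2p8 (A : sset) (hA : quasi_category A)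
    (X : sset) (d : smap X A) :
  (forall t : slice d 0,
     joyal_limit_cone t <-> limit_cone (slice_cone_cell t)) /\
  (forall (l : A 0) (lam : cone d l),
     limit_cone lam <->
     exists t : slice d 0, joyal_limit_cone t /\ slice_cone t = existT _ l lam) /\
  (forall l : A 0,
     (exists lam : cone d l, limit_cone lam) <->
     exists t : slice d 0, joyal_limit_cone t /\ slice_pr d 0 t = l).
Proof.
have main (t : slice d 0) : joyal_limit_cone t <-> limit_cone (slice_cone_cell t).
  by split; [apply: (joyal_limit hA) | apply: (limit_joyal hA)].
have cones l (lam : cone d l) : limit_cone lam <->
    exists t : slice d 0, joyal_limit_cone t /\ slice_cone t = existT _ l lam.
  have tr t : slice_cone t = existT _ l lam ->
      limit_cone (slice_cone_cell t) <-> limit_cone lam.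
    by move=> e; rewrite -[limit_cone _]/(limit_cone (projT2 (slice_cone t))) e.
  split=> [lim|[t [/main ht e]]]; last exact/(tr t e).
  have [t e] := cone_strict hA lam.
  by exists t; split=> //; apply/main; apply/(tr t e).
split=> //; split=> // l; split=> [[lam /cones[t [ht e]]]|[t [/main ht e]]].
  by exists t; split=> //; apply: (congr1 (@projT1 _ _) e).
by subst l; exists (slice_cone_cell t).
Qed.
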